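(* Let $\mu$ be a classically infinitely divisible probability measure on $\mathbb{R}$ with characteristic function $\phi_\mu$ and Khintchine pair $[a,m]$, i.e. $$\log\phi_\mu(t)=ita+\int_{\mathbb{R}}\Big(e^{itx}-1-\frac{itx}{1+x^2}\Big)\frac{1+x^2}{x^2}\,m(dx),\qquad t\in\mathbb{R}.$$ Then there exists a unique $\boxplus$-infinitely divisible probability measure $\tilde\mu$ whose Voiculescu transform satisfies $$V_{\tilde\mu}(it)=it^2\int_0^\infty \overline{\log\phi_\mu(s)}\,e^{-ts}\,ds,\qquad t>0,\tag{A}$$ and moreover, for all $t>0$, $$it^2\int_0^\infty \overline{\log\phi_\mu(s)}\,e^{-ts}\,ds=a+\int_{\mathbb{R}}\frac{1+itx}{it-x}\,m(dx).\tag{Z}$$ If in addition $\mu$ is symmetric, i.e. $a=0$ and $m$ is symmetric (so $\phi_\mu$ is real), then for $t>0$ $$V_{\tilde\mu}(it)=it\int_0^\infty\int_{\mathbb{R}}(\cos(sx)-1)\frac{1+x^2}{x^2}\,m(dx)\,t e^{-st}\,ds=-it\int_{\mathbb{R}}\frac{1+x^2}{t^2+x^2}\,m(dx).$$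
   Context: A characteristic function $\phi$ on $\mathbb{R}$ is (classically) infinitely divisible iff it has the Khintchine representation $\phi(t)=\exp\{ita+\int_{\mathbb{R}}(e^{itx}-1-\frac{itx}{1+x^2})\frac{1+x^2}{x^2}m(dx)\}$ with a uniquely determined $a\in\mathbb{R}$ and finite Borel measure $m$ on $\mathbb{R}$ (the integrand at $x=0$ is understood as its limit $-t^2/2$); the pair $[a,m]$ is its Khintchine pair, and $\log\phi$ denotes the exponent in this representation (the continuous logarithm with $\log\phi(0)=0$). For a probability measure $\nu$ on $\mathbb{R}$, $V_\nu$ denotes its Voiculescu transform (so that $V_{\mu\boxplus\nu}=V_\mu+V_\nu$, $\boxplus$ being free additive convolution). Free Lévy–Khintchine characterization: $\nu$ is $\boxplus$-infinitely divisible iff $V_\nu(z)=a+\int_{\mathbb{R}}\frac{1+zx}{z-x}m(dx)$ for $z\in\mathbb{C}\setminus\mathbb{R}$, with uniquely determined $a\in\mathbb{R}$ and finite Borel measure $m$; moreover a $\boxplus$-infinitely divisible $\nu$ is uniquely determined by the values $V_\nu(it)$, $t>0$. *)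

(* Defs.v *)
From HB Require Import structures.
From mathcomp Require Import all_boot all_order all_algebra.
From mathcomp Require Import all_classical all_reals all_analysis.
From mathcomp Require Import complex.
Set Implicit Arguments.
Unset Strict Implicit.
Unset Printing Implicit Defensive.
Import Order.TTheory GRing.Theory Num.Theory.
Import numFieldNormedType.Exports.
Local Open Scope classical_set_scope.
Local Open Scope ring_scope.
Local Open Scope complex_scope.

Section Defs.
Variable R : realType.

Definition cexp (z : R[i]) : R[i] :=
  (expR (complex.Re z))%:C * (cos (complex.Im z) +i* sin (complex.Im z)).

Definition cint d (T : measurableType d) (mu : {measure set T -> \bar R})
    (D : set T) (f : T -> R[i]) : R[i] :=
  Rintegral mu D (fun x => complex.Re (f x)) +i* Rintegral mu D (fun x => complex.Im (f x)).

Definition charfun (mu : probability R R) (t : R) : R[i] :=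
  cint mu setT (fun x => cexp ('i * (t * x)%:C)).

Definition kh_integrand (t x : R) : R[i] :=
  if x == 0 then (- (t ^+ 2) / 2)%:C
  else (cexp ('i * (t * x)%:C) - 1 - 'i * (t * x / (1 + x ^+ 2))%:C)
       * ((1 + x ^+ 2) / x ^+ 2)%:C.

Definition khlog (a : R) (m : {finite_measure set R -> \bar R}) (t : R) : R[i] :=
  'i * (t * a)%:C + cint m setT (kh_integrand t).

Definition cauchy (nu : probability R R) (z : R[i]) : R[i] :=
  cint nu setT (fun x => (z - x%:C)^-1).
Definition Ftr (nu : probability R R) (z : R[i]) : R[i] := (cauchy nu z)^-1.

Definition cone (alpha beta : R) : set R[i] :=
  [set z | beta < complex.Im z /\ `|complex.Re z| < alpha * complex.Im z].

(* V agrees with the Voiculescu transform of nu on some truncated cone: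
   F_nu is univalent on a cone Gamma', and on Gamma_{alpha,beta} the map
   z |-> z + V z is the inverse of F_nu with values in Gamma', i.e.
   V z = F_nu^{-1}(z) - z. *)
Definition voiculescu_on_cone (nu : probability R R) (V : R[i] -> R[i]) : Prop :=
  exists alpha beta alpha' beta' : R,
    [/\ (0 < alpha) && (0 < beta), (0 < alpha') && (0 < beta'),
     (forall w1 w2, cone alpha' beta' w1 -> cone alpha' beta' w2 ->
        Ftr nu w1 = Ftr nu w2 -> w1 = w2) &
     (forall z, cone alpha beta z ->
        cone alpha' beta' (z + V z) /\ Ftr nu (z + V z) = z)].

(* V is the (analytic continuation to C^+ of the) Voiculescu transform *)
Definition voiculescu_ext (nu : probability R R) (V : R[i] -> R[i]) : Prop :=
  (forall z : R[i], 0 < complex.Im z -> derivable (V : R[i]^o -> R[i]^o) z 1)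
  /\ voiculescu_on_cone nu V.

(* free infinite divisibility: for every n >= 1 there is nu_n with
   nu = nu_n^{boxplus n}, i.e. V_nu = n V_{nu_n} on a common truncated cone *)
Definition free_inf_div (nu : probability R R) : Prop :=
  forall n : nat, (0 < n)%N ->
    exists (nun : probability R R) (V Vn : R[i] -> R[i]),
      [/\ voiculescu_on_cone nu V, voiculescu_on_cone nun Vn &
       exists alpha beta : R, [/\ 0 < alpha, 0 < beta &
          forall z, cone alpha beta z -> V z = n%:R * Vn z]].

Definition laplace_khlog (a : R) (m : {finite_measure set R -> \bar R}) (t : R)
  : R[i] :=
  'i * (t ^+ 2)%:C *
  cint (@lebesgue_measure R) [set s | 0 <= s]
       (fun s => (khlog a m s)^* * (expR (- (t * s)))%:C).

End Defs.

(* Main.v *)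
(* Put [V z = a + \int (1 + z x) / (z - x) m(dx)]. The Laplace transforms of the real and
   imaginary parts of the Khintchine kernel are rational in [t] and [x], so Fubini's theorem
   identifies [V (it)] with the Laplace transform of the conjugate of [log phi].

   A measure with Voiculescu transform [V] is built directly. Replace [x] by simple functions
   [h k x] in the integrand and iterate [F := w - V_k F] from [F := w]: each iterate is
   [w - b] minus a Cauchy transform with finitely many atoms, and its reciprocal is, by the
   spectral theorem for an arrow matrix, the Cauchy transform of a discrete law. At
   [w = z + V z], with [z] in a truncated cone, the iteration is a perturbed contraction
   towards [z]; a Helly limit [nu] of the discrete laws satisfies [F_nu (z + V z) = z].
   Rescaling [a] and [m] by [1 / n] gives free infinite divisibility.

   The values [V (it)] determine [F_nu] on a curve accumulating in the upper half plane,
   hence its Cauchy transform (expand at an accumulation point and move along discs), hence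
   [nu] by Stieltjes inversion. In the symmetric case the odd parts of the integrands
   vanish; any other admissible [V], being only assumed complex differentiable, is compared
   with the integral by an identity theorem deduced from Goursat's theorem and a maximum
   principle. *)

Require Import Defs.
From HB Require Import structures.
From mathcomp Require Import all_boot all_order all_algebra.
From mathcomp Require Import all_classical all_reals all_analysis.
From mathcomp Require Import measurable_realfun.
From mathcomp Require Import complex ring lra.
Import Order.TTheory GRing.Theory Num.Theory.
Import numFieldNormedType.Exports.
Set Implicit Arguments.
Unset Strict Implicit.
Unset Printing Implicit Defensive.
Local Open Scope classical_set_scope.
Local Open Scope ring_scope.
Local Open Scope complex_scope.
Import Normc.

(** * Complex-valued integrals *)

(** A usual route to a law with prescribed Voiculescu transform recognises the inverse of z + V z by
    the Nevanlinna representation of self-maps of the half plane. Positivity is obtained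
    algebraically here: the maps w - b - sum p / (w - x) with p >= 0 are stable under the iteration,
    because 1 / (F - x) is again a discrete Cauchy transform. Two rewritings of the kernel carry the
    estimates: x + (1 + x^2) / (z - x) shows nonnegative weights and the increments in z, while -z +
    (1 + z^2) / (z - x) gives bounds uniform in x. No moment of m is assumed, so V is small relative
    to z only high up in a cone, where [kh_weight] has a small integral. In the arctangent variable
    Helly's selection is unconditional; escape of mass to infinity is excluded afterwards, because
    Im w |G(w)| comes arbitrarily close to 1. An admissible V is tied to [Ftr] on one truncated cone
    only and is merely differentiable elsewhere. Uniqueness of the law needs V on the imaginary axis
    alone, but the symmetric formula, claimed for every such V and every t > 0, requires
    continuation down from the cone. *)

Section Toolkit.
Variable R : realType.
Implicit Types (z w : R[i]).

Lemma normE z : `|z| = (normc z)%:C. Proof. by []. Qed.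

Lemma normc_ge0 z : 0 <= normc z.
Proof. by case: z => a b; rewrite sqrtr_ge0. Qed.

Lemma normcR (x : R) : normc x%:C = `|x|.
Proof. by rewrite /= expr0n /= addr0 sqrtr_sqr. Qed.

Lemma normci : normc ('i : R[i]) = 1.
Proof. by rewrite /= expr0n /= add0r expr1n sqrtr1. Qed.

Lemma normcB z w : normc (z - w) <= normc z + normc w.
Proof. by rewrite -(normcN w) le_normcD. Qed.

Lemma normcBC z w : normc (z - w) = normc (w - z).
Proof. by rewrite -normcN opprB. Qed.

Lemma normc_Re z : `|complex.Re z| <= normc z.
Proof. by have := normc_ge_Re z; rewrite normE lecR. Qed.

Lemma normc_Im z : `|complex.Im z| <= normc z.
Proof.
case: z => a b /=; rewrite -(sqrtr_sqr b) ler_wsqrtr // lerDr.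
exact: sqr_ge0.
Qed.

Lemma normc_le z : normc z <= `|complex.Re z| + `|complex.Im z|.
Proof.
case: z => a b /=; have h : 0 <= `|a| + `|b| by rewrite addr_ge0.
rewrite -[leRHS]ger0_norm // -sqrtr_sqr ler_wsqrtr //.
rewrite sqrrD !real_normK ?num_real //.
have : 0 <= `|a| * `|b| by rewrite mulr_ge0.
by move=> ?; lra.
Qed.

Lemma normc_sqr z : normc z ^+ 2 = complex.Re z ^+ 2 + complex.Im z ^+ 2.
Proof. by case: z => a b /=; rewrite sqr_sqrtr // addr_ge0 // sqr_ge0. Qed.

Lemma normc_gt0 z : (0 < normc z) = (z != 0).
Proof.
rewrite lt_def normc_ge0 andbT; apply/idP/idP; apply: contra => /eqP.
  by move=> ->; rewrite normc0.
by move=> /eq0_normc ->.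
Qed.

Lemma normc_sub_ge z w : normc z - normc w <= normc (z - w).
Proof. by rewrite lerBlDr (le_trans _ (le_normcD _ _)) // subrK. Qed.

Lemma normcX z n : normc (z ^+ n) = normc z ^+ n.
Proof. by elim: n => [|n IH]; rewrite ?expr0 ?normc1 // !exprS normcM IH. Qed.

Lemma normc_conj z : normc z^* = normc z.
Proof. by case: z => a b /=; rewrite sqrrN. Qed.

Lemma cReD z w : complex.Re (z + w) = complex.Re z + complex.Re w.
Proof. by case: z w => [? ?] [? ?]. Qed.
Lemma cImD z w : complex.Im (z + w) = complex.Im z + complex.Im w.
Proof. by case: z w => [? ?] [? ?]. Qed.
Lemma cReN z : complex.Re (- z) = - complex.Re z. Proof. by case: z. Qed.
Lemma cImN z : complex.Im (- z) = - complex.Im z. Proof. by case: z. Qed.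
Lemma cReM z w : complex.Re (z * w) =
  complex.Re z * complex.Re w - complex.Im z * complex.Im w.
Proof. by case: z w => [? ?] [? ?]. Qed.
Lemma cImM z w : complex.Im (z * w) =
  complex.Re z * complex.Im w + complex.Im z * complex.Re w.
Proof. by case: z w => [? ?] [? ?]. Qed.
Lemma cReV z : complex.Re z^-1 = complex.Re z / (normc z ^+ 2).
Proof. by rewrite normc_sqr; case: z. Qed.
Lemma cImV z : complex.Im z^-1 = - complex.Im z / (normc z ^+ 2).
Proof. by rewrite normc_sqr; case: z => a b /=; rewrite mulNr. Qed.
Lemma complex_eq z w : complex.Re z = complex.Re w ->
  complex.Im z = complex.Im w -> z = w.
Proof. by case: z w => [? ?] [? ?] /= -> ->. Qed.

End Toolkit.

Section Cint.
Context d (T : measurableType d) (R : realType) (mu : {measure set T -> \bar R}).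
Implicit Types (D : set T) (f g : T -> R[i]).
Local Notation Re := complex.Re.
Local Notation Im := complex.Im.

Definition cmeasurable D f :=
  measurable_fun D (fun x => Re (f x)) /\ measurable_fun D (fun x => Im (f x)).

Definition cintegrable D f :=
  mu.-integrable D (EFin \o (fun x => Re (f x))) /\
  mu.-integrable D (EFin \o (fun x => Im (f x))).

Lemma cmeasurable_cst D k : cmeasurable D (cst k).
Proof. by split; exact: measurable_cst. Qed.

Lemma cmeasurableD D f g : cmeasurable D f -> cmeasurable D g ->
  cmeasurable D (fun x => f x + g x).
Proof.
move=> [f1 f2] [g1 g2]; split.
  by under eq_fun do rewrite cReD; exact: measurable_funD.
by under eq_fun do rewrite cImD; exact: measurable_funD.
Qed.

Lemma cmeasurableN D f : cmeasurable D f -> cmeasurable D (fun x => - f x).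
Proof.
move=> [f1 f2]; split.
  by under eq_fun do rewrite cReN; exact: measurableT_comp.
by under eq_fun do rewrite cImN; exact: measurableT_comp.
Qed.

Lemma cmeasurableB D f g : cmeasurable D f -> cmeasurable D g ->
  cmeasurable D (fun x => f x - g x).
Proof. by move=> hf hg; apply: cmeasurableD => //; exact: cmeasurableN. Qed.

Lemma cmeasurableM D f g : cmeasurable D f -> cmeasurable D g ->
  cmeasurable D (fun x => f x * g x).
Proof.
move=> [f1 f2] [g1 g2]; split.
  under eq_fun do rewrite cReM; apply: measurable_funB; exact: measurable_funM.
under eq_fun do rewrite cImM; apply: measurable_funD; exact: measurable_funM.
Qed.

Lemma cmeasurableR D (h : T -> R) : measurable_fun D h ->
  cmeasurable D (fun x => (h x)%:C).
Proof. by move=> mh; split => //=; exact: measurable_cst. Qed.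

Lemma measurable_normc D f : cmeasurable D f ->
  measurable_fun D (fun x => normc (f x)).
Proof.
move=> [f1 f2].
rewrite (_ : (fun x => normc (f x)) =
    (fun x => Num.sqrt (Re (f x) ^+ 2 + Im (f x) ^+ 2))); last first.
  by apply/funext => x; case: (f x).
apply: (@measurableT_comp _ _ _ _ _ _ (@Num.sqrt R)).
  exact: continuous_measurable_fun (@sqrt_continuous R).
by apply: measurable_funD; exact: measurable_funX.
Qed.

Lemma measurable_funV D (h : T -> R) : measurable D -> measurable_fun D h ->
  measurable_fun D (fun x => (h x)^-1).
Proof.
move=> mD mh.
(* Writing 1 / h as h times the power -1 of h^2 gives the power a nonnegative base; both sides
   vanish where h does, since 0^-1 = 0. *)
have -> : (fun x => (h x)^-1) = (fun x => h x * (h x ^+ 2) `^ (-1)).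
  apply/funext => x; rewrite powR_inv1 ?sqr_ge0 //.
  have [->|h0] := eqVneq (h x) 0; first by rewrite invr0 mul0r.
  by rewrite expr2 invfM mulrA divff // mul1r.
apply: measurable_funM => //.
apply: (@measurableT_comp _ _ _ _ _ _ (fun y : R => y `^ (-1))).
  exact: measurable_powR.
exact: measurable_funX.
Qed.

Lemma cmeasurableV D f : measurable D -> cmeasurable D f ->
  cmeasurable D (fun x => (f x)^-1).
Proof.
move=> mD mf; have [f1 f2] := mf; split.
  under eq_fun do rewrite cReV; apply: measurable_funM => //.
  by apply: measurable_funV => //; apply: measurable_funX; exact: measurable_normc.
under eq_fun do rewrite cImV; apply: measurable_funM => //.
  exact: measurableT_comp.
by apply: measurable_funV => //; apply: measurable_funX; exact: measurable_normc.
Qed.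

Lemma cintegrable_meas D f : cintegrable D f -> cmeasurable D f.
Proof.
by move=> [f1 f2]; split; apply/measurable_EFinP; exact: (measurable_int mu).
Qed.

Lemma cintegrable_le D f (g : T -> R) : measurable D -> cmeasurable D f ->
  mu.-integrable D (EFin \o g) -> (forall x, D x -> normc (f x) <= g x) ->
  cintegrable D f.
Proof.
move=> mD [f1 f2] ig fg; split.
  apply: (le_integrable mD _ _ ig); first exact/measurable_EFinP.
  move=> x Dx /=; rewrite lee_fin (le_trans (normc_Re _)) //.
  by rewrite (le_trans (fg _ Dx)) // ler_norm.
apply: (le_integrable mD _ _ ig); first exact/measurable_EFinP.
move=> x Dx /=; rewrite lee_fin (le_trans (normc_Im _)) //.
by rewrite (le_trans (fg _ Dx)) // ler_norm.
Qed.

Lemma cintegrable_norm D f : measurable D -> cintegrable D f ->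
  mu.-integrable D (EFin \o (fun x => normc (f x))).
Proof.
move=> mD hf; have [f1 f2] := cintegrable_meas hf; case: hf => i1 i2.
have i3 := integrableD mD (integrable_abse i1) (integrable_abse i2).
apply: (le_integrable mD _ _ i3).
  by apply/measurable_EFinP; exact: measurable_normc.
move=> x Dx /=; rewrite lee_fin (ger0_norm (normc_ge0 _)) ger0_norm ?addr_ge0 //.
exact: normc_le.
Qed.

Lemma eq_cint D f g : {in D, f =1 g} -> cint mu D f = cint mu D g.
Proof.
by move=> fg; congr (_ +i* _); apply: eq_Rintegral => x xD; rewrite fg.
Qed.

Lemma cintegrableD D f g : measurable D -> cintegrable D f -> cintegrable D g ->
  cintegrable D (fun x => f x + g x).
Proof.
move=> mD [f1 f2] [g1 g2]; split.
  apply: (eq_integrable mD _ _ _ (integrableD mD f1 g1)) => x _ /=.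
  by rewrite cReD.
apply: (eq_integrable mD _ _ _ (integrableD mD f2 g2)) => x _ /=.
by rewrite cImD.
Qed.

Lemma cintegrableZ D k f : measurable D -> cintegrable D f ->
  cintegrable D (fun x => k * f x).
Proof.
move=> mD hf; have := cintegrable_norm mD hf => i.
apply: (@cintegrable_le _ _ (fun x => normc k * normc (f x))) => //.
- apply: cmeasurableM; [exact: cmeasurable_cst|exact: cintegrable_meas].
- exact: (integrableZl mD (normc k) i).
- by move=> x _; rewrite normcM.
Qed.

Lemma cintegrableB D f g : measurable D -> cintegrable D f -> cintegrable D g ->
  cintegrable D (fun x => f x - g x).
Proof.
move=> mD hf hg; under eq_fun do rewrite -[- g _]mulN1r.
by apply: cintegrableD => //; exact: cintegrableZ.
Qed.

Lemma cintD D f g : measurable D -> cintegrable D f -> cintegrable D g ->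
  cint mu D (fun x => f x + g x) = cint mu D f + cint mu D g.
Proof.
move=> mD [f1 f2] [g1 g2]; apply: complex_eq => /=.
  by rewrite -RintegralD //; apply: eq_Rintegral => x _; rewrite cReD.
by rewrite -RintegralD //; apply: eq_Rintegral => x _; rewrite cImD.
Qed.

Lemma cintZ D k f : measurable D -> cintegrable D f ->
  cint mu D (fun x => k * f x) = k * cint mu D f.
Proof.
move=> mD [f1 f2]; case: k => a b; apply: complex_eq => /=.
  rewrite -!RintegralZl // -RintegralB //; last 2 first.
  - exact: (integrableZl mD a f1).
  - exact: (integrableZl mD b f2).
  by apply: eq_Rintegral => x _; rewrite cReM.
rewrite -!RintegralZl // -RintegralD //; last 2 first.
- exact: (integrableZl mD a f2).
- exact: (integrableZl mD b f1).
by apply: eq_Rintegral => x _; rewrite cImM.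
Qed.

Lemma cintN D f : measurable D -> cintegrable D f ->
  cint mu D (fun x => - f x) = - cint mu D f.
Proof.
by move=> mD hf; rewrite -mulN1r -cintZ //; apply: eq_cint => x _; rewrite mulN1r.
Qed.

Lemma cintB D f g : measurable D -> cintegrable D f -> cintegrable D g ->
  cint mu D (fun x => f x - g x) = cint mu D f - cint mu D g.
Proof.
move=> mD hf hg; rewrite cintD ?cintN //.
by under eq_fun do rewrite -mulN1r; exact: cintegrableZ.
Qed.

Lemma cint_real D (h : T -> R) : cint mu D (fun x => (h x)%:C) = (Rintegral mu D h)%:C.
Proof. by apply: complex_eq => //=; rewrite /Rintegral integral0. Qed.

(* Rotating the integral to the positive real axis reduces the bound to the real case. *)
Lemma normc_cint_le D f (g : T -> R) : measurable D -> cintegrable D f ->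
  mu.-integrable D (EFin \o g) -> (forall x, D x -> normc (f x) <= g x) ->
  normc (cint mu D f) <= Rintegral mu D g.
Proof.
move=> mD hf ig fg; set I := cint mu D f.
have g0 : 0 <= Rintegral mu D g.
  by apply: Rintegral_ge0 => x Dx; rewrite (le_trans (normc_ge0 _) (fg _ Dx)).
have [->|I0] := eqVneq I 0; first by rewrite normc0.
have nI : 0 < normc I by rewrite normc_gt0.
rewrite -(ler_pM2l nI) -expr2.
have -> : normc I ^+ 2 = Re (cint mu D (fun x => I^* * f x)).
  by rewrite cintZ // -/I normc_sqr; case: I {I0 nI} => a b /=; ring.
rewrite -RintegralZl //=; apply: le_Rintegral => //.
- by case: (cintegrableZ I^* mD hf).
- exact: (integrableZl mD (normc I) ig).
move=> x Dx; rewrite (le_trans (ler_norm _)) // (le_trans (normc_Re _)) //.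
by rewrite normcM normc_conj ler_pM ?normc_ge0 ?fg.
Qed.

(** Real dominated convergence is applied to the moduli |f_n - f|, dominated by 2 g. Convergence is
    expressed by real moduli, so no topology on [R[i]] enters. *)
Lemma cint_dominated_cvg D (f_ : nat -> T -> R[i]) f (g : T -> R) :
  measurable D -> (forall n, cmeasurable D (f_ n)) -> cmeasurable D f ->
  mu.-integrable D (EFin \o g) ->
  (forall n x, D x -> normc (f_ n x) <= g x) ->
  (forall x, D x -> normc (f x) <= g x) ->
  {ae mu, forall x, D x -> normc (f_ n x - f x) @[n --> \oo] --> (0 : R)} ->
  normc (cint mu D (f_ n) - cint mu D f) @[n --> \oo] --> (0 : R).
Proof.
move=> mD mf_ mf ig fg_ fg fcvg.
have if_ n : cintegrable D (f_ n) by apply: (cintegrable_le _ _ ig) => //; exact: fg_.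
have if' : cintegrable D f by apply: (cintegrable_le _ _ ig).
pose h n x := normc (f_ n x - f x).
have ih n : mu.-integrable D (EFin \o h n).
  by apply: cintegrable_norm => //; exact: cintegrableB.
have := @dominated_convergence _ _ _ mu D mD (fun n x => (h n x)%:E) (cst 0%E)
  (fun x => (2 * g x)%:E).
case.
- by move=> n; exact: (measurable_int mu (ih n)).
- exact: measurable_cst.
- apply: filterS fcvg => x h0 Dx /=.
  apply: cvg_EFin; last exact: h0.
  by near=> n.
- exact: (integrableZl mD 2 ig).
- apply: aeW => x n Dx; rewrite /= lee_fin ger0_norm ?normc_ge0 //.
  by rewrite mulr2n mulrDl mul1r (le_trans (normcB _ _)) // lerD ?fg ?fg_.
move=> _ _ lim0; rewrite integral0 in lim0.
have lim1 : Rintegral mu D (h n) @[n --> \oo] --> (0 : R).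
  exact: fine_cvg lim0.
apply: (squeeze_cvgr _ (cvg_cst 0) lim1).
apply: nearW => n; rewrite normc_ge0 -cintB //=.
by apply: normc_cint_le => //; exact: cintegrableB.
Unshelve. all: by end_near. Qed.

End Cint.

Section FiniteCint.
Context d (T : measurableType d) (R : realType)
  (mu : {finite_measure set T -> \bar R}).
Implicit Types (f g : T -> R[i]).

Lemma integrable_cst_fin (k : R) : mu.-integrable setT (EFin \o cst k).
Proof. exact: finite_measure_integrable_cst. Qed.

Lemma cintegrable_bdd f (M : R) : cmeasurable setT f ->
  (forall x, normc (f x) <= M) -> cintegrable mu setT f.
Proof.
by move=> mf fM; apply: (cintegrable_le _ mf (integrable_cst_fin M)).
Qed.

Lemma normc_cint_bdd f (M : R) : cmeasurable setT f ->
  (forall x, normc (f x) <= M) ->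
  normc (cint mu setT f) <= M * fine (mu setT).
Proof.
move=> mf fM; rewrite -Rintegral_cst //.
by apply: normc_cint_le => //; [exact: cintegrable_bdd|exact: integrable_cst_fin].
Qed.

Lemma cint_bdd_cvg (f_ : nat -> T -> R[i]) f (M : R) :
  (forall n, cmeasurable setT (f_ n)) -> cmeasurable setT f ->
  (forall n x, normc (f_ n x) <= M) -> (forall x, normc (f x) <= M) ->
  (forall x, normc (f_ n x - f x) @[n --> \oo] --> (0 : R)) ->
  normc (cint mu setT (f_ n) - cint mu setT f) @[n --> \oo] --> (0 : R).
Proof.
move=> m_ mf b_ b c; apply: (cint_dominated_cvg _ m_ mf (integrable_cst_fin M)) => //.
exact: aeW.
Qed.

End FiniteCint.

(** * Discrete Cauchy transforms *)

Local Open Scope sesquilinear_scope.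
Section PartialFractions.
Variable R : realType.
Implicit Types (s : seq (R * R)) (w : R[i]).

Definition weights_ge0 s := all (fun q => 0 <= q.1) s.

Definition dcauchy s w : R[i] := \sum_(q <- s) q.1%:C / (w - q.2%:C).

Lemma upper_subR_neq0 w (x : R) : 0 < complex.Im w -> w - x%:C != 0.
Proof.
move=> w0; apply/eqP => /(congr1 (@complex.Im R)).
by rewrite cImD cImN /= oppr0 addr0 => h; rewrite h ltxx in w0.
Qed.

(** Each fraction contributes -p Im w / |w - x|^2. Subtracting such a sum therefore raises the
    imaginary part, which keeps the later iterates in the upper half plane. *)
Lemma Im_dcauchy_le0 s w : weights_ge0 s -> 0 < complex.Im w ->
  complex.Im (dcauchy s w) <= 0.
Proof.
rewrite /dcauchy => + w0; elim: s => [|q s IH] /=; first by rewrite big_nil.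
move=> /andP[q0 s0]; rewrite big_cons cImD -[leRHS]addr0 lerD ?IH //.
rewrite cImM /= mul0r addr0 cImV cImD cImN /= oppr0 addr0.
by rewrite mulNr mulrN oppr_le0 mulr_ge0 // divr_ge0 ?exprn_ge0 ?normc_ge0 // ltW.
Qed.

Lemma dcauchy_ord s w : dcauchy s w =
  \sum_(j < size s) (nth 0 s j).1%:C / (w - (nth 0 s j).2%:C).
Proof. by rewrite /dcauchy (big_nth 0) big_mkord. Qed.

Section Arrowhead.
Variables (b : R) (s : seq (R * R)).
Local Notation n := (size s).
Let sc (j : 'I_n) : R[i] := (Num.sqrt (nth 0 s j).1)%:C.
Let sx (j : 'I_n) : R[i] := (nth 0 s j).2%:C.
(** Eliminating the diagonal block of w - A leaves the Schur complement w - b - sum sc^2 / (w - sx);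
    the border holds square roots so that these squares are the weights. *)
Let A : 'M[R[i]]_(1 + n) :=
  block_mx (b%:C)%:M (\row_j sc j) (\col_j sc j) (diag_mx (\row_j sx j)).

Lemma arrowhead_hermitian : A \is hermsymmx.
Proof.
apply: realsym_hermsym.
  apply/is_hermitianmxP; rewrite expr0 scale1r map_mx_id //.
  rewrite /A tr_block_mx tr_scalar_mx tr_diag_mx.
  by congr block_mx; apply/matrixP => i j; rewrite !mxE.
apply/mxOverP => i j; rewrite /A.
have r (x : R) : x%:C \is @Num.real R[i] by rewrite complex_real.
rewrite !mxE; case: splitP => k _; rewrite !mxE; case: splitP => l _; rewrite !mxE.
- by rewrite rpredMn //; exact: r.
- exact: r.
- exact: r.
- by rewrite rpredMn //; exact: r.
Qed.

(* [w - A] applied to the resolvent column with head [1 / (w - b - sum)] is the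
   first basis vector; diagonalizing the Hermitian matrix [A] turns that head into
   a convex combination of simple fractions with real poles. *)
Lemma inv_linear_sub_dcauchy : weights_ge0 s ->
  exists s', [/\ weights_ge0 s', \sum_(q <- s') q.1 = 1 &
    forall w, 0 < complex.Im w -> (w - b%:C - dcauchy s w)^-1 = dcauchy s' w].
Proof.
move=> s0.
have hA := arrowhead_hermitian.
have nA := hermitian_normalmx hA.
have /orthomx_spectralP AE := nA.
set P := spectralmx A in AE; set D := spectral_diag A in AE.
have Pu : P \is unitarymx := spectral_unitarymx A.
have PP : P *m P ^t* = 1%:M by apply/unitarymxP.
have PP' : P ^t* *m P = 1%:M by apply: mulmx1C.
have Dr j : D 0 j \is Num.real.
  have /mxOverP := hermitian_spectral_diag_real hA; exact.
pose o0 : 'I_(1 + n) := ord0.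
(* The spectral measure of [A] at the first basis vector: atoms at the eigenvalues, weighted by the
   squared moduli of the first column of [P]. By unitarity its total mass is a diagonal entry of the
   identity. *)
exists [seq (normc (P i o0) ^+ 2, complex.Re (D 0 i)) | i <- enum 'I_(1 + n)].
have nP i : (normc (P i o0) ^+ 2)%:C = P i o0 * (P i o0)^*.
  by rewrite rmorphXn /= -normE normCK.
split.
- by apply/allP => q /mapP[i _ ->] /=; rewrite exprn_ge0 // normc_ge0.
- rewrite big_map big_enum /=.
  apply: complexI; rewrite rmorph_sum /=.
  under eq_bigr do rewrite nP.
  have := congr1 (fun M : 'M[R[i]]_(1 + n) => M o0 o0) PP'.
  rewrite mxE [X in _ = X]mxE eqxx => h; rewrite -[RHS]h; apply: eq_bigr => i _.
  by rewrite !mxE mulrC.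
move=> w w0; rewrite /dcauchy big_map big_enum /=.
have wsx j : w - sx j != 0 by exact: upper_subR_neq0.
set h := w - b%:C - dcauchy s w.
have hE : h = w - b%:C - \sum_(j < n) (nth 0 s j).1%:C / (w - (nth 0 s j).2%:C).
  by rewrite /h dcauchy_ord.
have h0 : h != 0.
  have : 0 < complex.Im h.
    rewrite /h !cImD !cImN /= oppr0 addr0 (lt_le_trans w0) // lerDl oppr_ge0.
    exact: Im_dcauchy_le0.
  by apply: contraTN => /eqP ->; rewrite /= ltxx.
pose v : 'cV[R[i]]_(1 + n) :=
  col_mx (h^-1)%:M (\col_j (sc j / (w - sx j) * h^-1)).
have scE j : sc j * sc j = (nth 0 s j).1%:C.
  rewrite /sc -rmorphM /= -expr2 sqr_sqrtr //.
  by have /allP := s0; apply; exact: mem_nth.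
have resv : (w%:M - A) *m v = col_mx 1%:M 0.
  rewrite /A scalar_mx_block opp_block_mx add_block_mx mul_block_col.
  congr col_mx.
    rewrite -scalemx1 sub0r -raddfB /=.
    apply/matrixP => i j; rewrite !ord1 !mxE big_ord1 !mxE /= mulr1n.
    apply: (mulIf h0); rewrite mulrDl mul1r -mulrA.
    rewrite mulr1n mulVf // mulr1 mulr_suml.
    rewrite mul1r [RHS]hE; congr (_ + _).
    rewrite -sumrN; apply: eq_bigr => k _; rewrite !mxE -/(sx k).
    rewrite -scE -(mulrA (- sc k)) (mulrVK (_ : h \is a GRing.unit)) ?unitfE //.
    by rewrite mulNr mulrA.
  apply/matrixP => i j; rewrite !ord1 !mxE big_ord1 !mxE sub0r mulr1n.
  rewrite (bigD1 i) //= big1 ?addr0; last first.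
    by move=> k ki; rewrite !mxE eq_sym (negPf ki) !mulr0n subr0 mul0r.
  rewrite !mxE eqxx !mulr1n mulNr -/(sx i).
  by rewrite [_ * (_ * h^-1)]mulrA [_ * (sc i / _)]mulrCA divff // mulr1 addNr.
have : (w%:M - diag_mx D) *m (P *m v) = P *m col_mx 1%:M 0.
  rewrite -resv mulmxA mulmxA; congr (_ *m v).
  rewrite AE invmx_unitary // mulmxBl mulmxBr !mulmxA PP mul1mx.
  by rewrite scalar_mxC.
move=> Pv.
have DE i : (complex.Re (D 0 i))%:C = D 0 i by exact: RRe_real.
have c0 : col_mx (1%:M : 'M[R[i]]_1) (0 : 'M[R[i]]_(n, 1)) o0 0 = 1.
  have -> : o0 = lshift n (0 : 'I_1) by apply/val_inj.
  by rewrite col_mxEu mxE eqxx.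
have c1 k : k != o0 -> col_mx (1%:M : 'M[R[i]]_1) (0 : 'M[R[i]]_(n, 1)) k 0 = 0.
  rewrite mxE; case: splitP => l hl; rewrite !mxE //.
  by rewrite -val_eqE /= hl (ord1 l).
have Pvi i : (P *m v) i 0 = P i o0 / (w - (complex.Re (D 0 i))%:C).
  have wD : w - D 0 i != 0 by rewrite -DE; exact: upper_subR_neq0.
  have := congr1 (fun M : 'cV[R[i]]_(1 + n) => M i 0) Pv.
  rewrite mxE [X in _ = X]mxE (bigD1 i) //= big1 ?addr0; last first.
    by move=> k ki; rewrite !mxE eq_sym (negPf ki) !mulr0n subr0 mul0r.
  rewrite [X in _ = X](bigD1 o0) //= [X in _ = _ + X]big1 ?addr0; last first.
    by move=> k ki; rewrite c1 ?mulr0.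
  rewrite c0 mulr1 DE => <-.
  by rewrite [in RHS]mxE [in RHS]mxE eqxx mulr1n [in RHS]mxE [X in _ + - X]mxE eqxx mulr1n mulrC mulKf.
have v0 : v o0 0 = h^-1.
  have -> : o0 = lshift n (0 : 'I_1) by apply/val_inj.
  by rewrite col_mxEu mxE eqxx.
rewrite -v0 -[v]mul1mx -PP' -mulmxA mxE; apply: eq_bigr => i _.
by rewrite Pvi nP mulrA !mxE [X in X / _]mulrC.
Qed.

End Arrowhead.
End PartialFractions.

(** * Limits of discrete laws *)

Section CintMore.
Context d (T : measurableType d) (R : realType) (mu : {measure set T -> \bar R}).
Implicit Types (D : set T) (f g : T -> R[i]).

Lemma cint_setU D E f : measurable D -> measurable E ->
  cintegrable mu (D `|` E) f -> [disjoint D & E] ->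
  cint mu (D `|` E) f = cint mu D f + cint mu E f.
Proof.
move=> mD mE [f1 f2] DE; apply: complex_eq => /=; exact: Rintegral_setU.
Qed.

Lemma cint_cst D (k : R[i]) : measurable D ->
  cint mu D (cst k) = k * (fine (mu D))%:C.
Proof.
by move=> mD; apply: complex_eq; rewrite ?cReM ?cImM /= !mulr0 ?subr0 ?add0r Rintegral_cst.
Qed.

Lemma cint_null D f : measurable D -> cmeasurable D f -> mu D = 0%E ->
  cint mu D f = 0.
Proof.
move=> mD [f1 f2] D0; apply: complex_eq; rewrite /= /Rintegral null_set_integral //;
  exact/measurable_EFinP.
Qed.

Lemma cmeasurableS D E f : measurable E -> D `<=` E -> cmeasurable E f ->
  cmeasurable D f.
Proof. by move=> mE DE [f1 f2]; split; apply: measurable_funS; eauto. Qed.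

End CintMore.

(** * The kernel 1 / (w - x) in the angular variable *)

Section FractionKernel.
Variable R : realType.
Implicit Types (w : R[i]) (t u : R).

(* [1 / (w - tan t)], extended continuously by [0] where [cos t = 0] *)
Definition frac_tan w t : R[i] := (cos t)%:C / (w * (cos t)%:C - (sin t)%:C).

Lemma frac_tan_den w t : 0 < complex.Im w ->
  complex.Im w * `|cos t| <= normc (w * (cos t)%:C - (sin t)%:C).
Proof.
move=> w0; apply: le_trans (normc_Im _).
rewrite cImD cImN cImM /= oppr0 addr0 mulr0 add0r normrM.
by rewrite (gtr0_norm w0).
Qed.

Lemma frac_tan_bound w t : 0 < complex.Im w ->
  normc (frac_tan w t) <= (complex.Im w)^-1.
Proof.
move=> w0; rewrite normcM normcR normcV.
have [->|d0] := eqVneq (normc (w * (cos t)%:C - (sin t)%:C)) 0.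
  by rewrite invr0 mulr0 invr_ge0 ltW.
have dp : 0 < normc (w * (cos t)%:C - (sin t)%:C) by rewrite lt_def d0 normc_ge0.
rewrite ler_pdivrMr // mulrC ler_pdivlMr // mulrC.
exact: frac_tan_den.
Qed.

Lemma frac_tan_tan w t : cos t != 0 -> frac_tan w t = (w - (tan t)%:C)^-1.
Proof.
move=> c0; have e : sin t = tan t * cos t by rewrite /tan mulfVK.
rewrite /frac_tan e rmorphM /= -mulrBl invfM mulrCA mulfV ?mulr1 //.
by apply: contra c0 => /eqP/complexI ->.
Qed.

Lemma frac_tan_atan w t : frac_tan w (atan t) = (w - t%:C)^-1.
Proof.
by rewrite frac_tan_tan ?atanK // gt_eqF // cos_gt0_pihalf // atan_gtNpi2 atan_ltpi2.
Qed.

Definition frac_tan_cst w := (complex.Im w)^-1 + normc w / complex.Im w + 1.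

(** With D the modulus, |cos t| <= D / Im w, hence |sin t| <= D + |w| D / Im w; as |cos t| + |sin t|
    >= 1, D cannot be small. The terms of [frac_tan_cst] are the coefficients of D in these
    bounds. *)
Lemma frac_tan_den_ge w t : 0 < complex.Im w ->
  1 <= normc (w * (cos t)%:C - (sin t)%:C) * frac_tan_cst w.
Proof.
move=> w0; set D := normc _.
have hc : `|cos t| <= D / complex.Im w.
  by rewrite ler_pdivlMr // mulrC; exact: frac_tan_den.
have hs : `|sin t| <= D + normc w * `|cos t|.
  rewrite -2!normcR -normcM addrC -lerBlDl.
  apply: le_trans (normc_sub_ge _ _) _ .
  by rewrite normcBC.
have h1 : 1 <= `|cos t| + `|sin t|.
  have e := cos2Dsin2 t.
  have c1 : `|cos t| <= 1 by rewrite ler_norml cos_geN1 cos_le1.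
  have s1 : `|sin t| <= 1 by rewrite ler_norml sin_geN1 sin_le1.
  rewrite -e -[X in X + _]real_normK ?num_real // -[X in _ + X]real_normK ?num_real //.
  by rewrite lerD // expr2 ler_piMr.
rewrite /frac_tan_cst; have nw := normc_ge0 w.
have := ler_wpM2l nw hc.
rewrite !mulrDr mulr1 [D * (normc w / _)]mulrCA.
by move: (normc w * _) h1 hs hc => a; move: (normc w * _) => b; lra.
Qed.

(** Over the common denominator the terms in w cancel and the numerator is sin (t - u). The
    Lipschitz bound thus holds across the zeros of cos: a limit of angles may reach infinity without
    harm. *)
Lemma frac_tan_dist w t u : 0 < complex.Im w ->
  normc (frac_tan w t - frac_tan w u) <= frac_tan_cst w ^+ 2 * `|t - u|.
Proof.
move=> w0; pose D t := w * (cos t)%:C - (sin t)%:C.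
have K0 : 0 < frac_tan_cst w.
  by rewrite /frac_tan_cst ltr_wpDl // addr_ge0 // ?mulr_ge0 ?invr_ge0 ?normc_ge0 ?ltW.
have Dge v : (normc (D v))^-1 <= frac_tan_cst w.
  have h := frac_tan_den_ge v w0.
  have Dp : 0 < normc (D v).
    rewrite lt_def normc_ge0 andbT; apply: contraTN h => /eqP e.
    by rewrite -/(D v) e mul0r -ltNge ltr01.
  by rewrite -[_^-1]mul1r ler_pdivrMr // mulrC.
have D0 v : D v != 0.
  have h := frac_tan_den_ge v w0; apply: contraTN h => /eqP e.
  by rewrite -/(D v) e normc0 mul0r -ltNge ltr01.
have -> : frac_tan w t - frac_tan w u = (sin (t - u))%:C * ((D t)^-1 * (D u)^-1).
  rewrite sinB /frac_tan -/(D t) -/(D u).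
  apply: (mulIf (D0 t)); apply: (mulIf (D0 u)).
  rewrite mulrBl mulfVK // mulrBl [_ / D u * _]mulrAC mulfVK //.
  rewrite -[RHS]mulrA -[RHS]mulrA [_ * (D t * D u)](_ : _ = 1) ?mulr1; last first.
    by rewrite mulrACA !mulVf // mulr1.
  rewrite /D rmorphB !rmorphM /=; ring.
rewrite normcM normcM !normcV mulrC expr2 ler_pM //.
- by rewrite mulr_ge0 ?invr_ge0 ?normc_ge0.
- exact: normc_ge0.
- by rewrite ler_pM ?invr_ge0 ?normc_ge0.
rewrite normcR.
have sle (x : R) : 0 <= x -> `|sin x| <= x.
  move=> x0.
  have [->|xn] := eqVneq x 0; first by rewrite sin0 normr0.
  have xp : 0 < x by rewrite lt_def xn.
  have [|c _] := @MVT R sin cos 0 x xp (fun y _ => is_derive_sin y).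
    by apply: continuous_subspaceT => y; exact: continuous_sin.
  rewrite sin0 !subr0 => ->; rewrite normrM (ger0_norm x0) ler_piMl //.
  by rewrite ler_norml cos_geN1 cos_le1.
have [h|h] := leP 0 (t - u); first by rewrite (le_trans (sle _ h)) // ler_norm.
have h' : 0 <= - (t - u) by rewrite oppr_ge0 ltW.
by rewrite -normrN -sinN (le_trans (sle _ h')) // -[X in _ <= X]normrN ler_norm.
Qed.

Lemma cmeasurable_frac_tan w : cmeasurable setT (frac_tan w).
Proof.
have mc : measurable_fun setT (@cos R).
  exact: continuous_measurable_fun (@continuous_cos R).
have ms : measurable_fun setT (@sin R).
  exact: continuous_measurable_fun (@continuous_sin R).
apply: cmeasurableM; first exact: cmeasurableR.
apply: cmeasurableV => //; apply: cmeasurableB; last exact: cmeasurableR.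
by apply: cmeasurableM; [exact: cmeasurable_cst|exact: cmeasurableR].
Qed.

Lemma cmeasurable_frac_tan_comp d (T : measurableType d) (D : set T) (h : T -> R) w :
  measurable_fun D h -> cmeasurable D (frac_tan w \o h).
Proof.
move=> mh; have [f1 f2] := cmeasurable_frac_tan w.
by split; [exact: (measurableT_comp f1 mh)|exact: (measurableT_comp f2 mh)].
Qed.

End FractionKernel.

(** * Discrete laws as images of the uniform law *)

Section Quantile.
Variable R : realType.
Implicit Types (l : seq (R * R)) (a u v : R).
Local Notation P := (uniform_prob (@ltr01 R)).

Lemma uniform_prob_itv a b : 0 <= a -> a <= b -> b <= 1 ->
  P `[a, b[ = (b - a)%:E.
Proof.
move=> a0 ab b1; rewrite /uniform_prob.
rewrite (eq_integral (cst 1%E)); last first.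
  move=> x; rewrite inE /= in_itv /= => /andP[ax xb].
  by rewrite /uniform_pdf (le_trans a0 ax) (ltW (lt_le_trans xb b1)) subr0 invr1.
rewrite integral_cst //= mul1e lebesgue_measure_itv /= lte_fin.
case: ltP => // ba; have -> : a = b by apply/eqP; rewrite eq_le ab ba.
by rewrite subrr.
Qed.

(* the arctangent of the quantile function of the discrete law [l], started at level [a] *)
Fixpoint atan_quantile a l u : R :=
  if l is q :: l' then
    if u < a + q.1 then atan q.2 else atan_quantile (a + q.1) l' u
  else pi / 2.

Definition leq_atoms : rel (R * R) := fun q r => q.2 <= r.2.

Lemma atan_quantile_itv a l u : - (pi / 2) <= atan_quantile a l u <= pi / 2.
Proof.
elim: l a => [|q l IH] a /=.
  by rewrite lexx andbT ge0_cp // divr_ge0 ?pi_ge0.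
by case: ifP => // _; rewrite !ltW ?atan_gtNpi2 ?atan_ltpi2.
Qed.

Lemma atan_quantile_ge a l u x : all (fun r => x <= r.2) l ->
  atan x <= atan_quantile a l u.
Proof.
elim: l a => [|q l IH] a /=; first by rewrite ltW // atan_ltpi2.
by move=> /andP[xq xl]; case: ifP => _; [exact: le_atan|exact: IH].
Qed.

(** Past the total mass the value is pi / 2, above every arctangent, so monotonicity holds on the
    whole line. *)
Lemma atan_quantile_homo a l : sorted leq_atoms l ->
  {homo atan_quantile a l : u v / u <= v}.
Proof.
elim: l a => [|q l IH] a /= sl u v uv; first by rewrite lexx.
have tr : transitive leq_atoms by move=> x y z; exact: le_trans.
case: ifPn => ua; case: ifPn => va //.
- by apply: atan_quantile_ge; rewrite (path_sortedE tr) in sl; case/andP: sl.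
- by rewrite (le_lt_trans uv va) in ua.
- by apply: IH => //; exact: path_sorted sl.
Qed.

(** Induction on the atoms with a moving starting level: on the first interval, whose length is the
    first weight, the integrand is constant, and the rest is the same integral started at a +
    q.1. *)
Lemma cint_atan_quantile (G : R -> R[i]) (M : R) a l : cmeasurable setT G ->
  (forall t, normc (G t) <= M) ->
  weights_ge0 l -> sorted leq_atoms l -> 0 <= a -> a + \sum_(q <- l) q.1 = 1 ->
  cint P `[a, 1[ (G \o atan_quantile a l) = \sum_(q <- l) q.1%:C * G (atan q.2).
Proof.
move=> mG bG.
have key a' l' (D : set R) : measurable D -> sorted leq_atoms l' ->
    cintegrable P D (G \o atan_quantile a' l').
  move=> mD sl; apply: (@cintegrable_le _ _ _ P _ _ (cst M)) => //.
  - have mh : measurable_fun D (atan_quantile a' l').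
      by apply: nondecreasing_measurable => //; exact: atan_quantile_homo.
    case: mG => G1 G2.
    by split; [exact: (measurableT_comp G1 mh)|exact: (measurableT_comp G2 mh)].
  - exact: finite_measure_integrable_cst.
  - by move=> x _; exact: bG.
elim: l a => [|q l IH] a /=.
  by rewrite !big_nil addr0 => _ _ _ ->; rewrite set_itvco0 /cint !Rintegral_set0.
move=> /andP[q0 l0] sl a0; rewrite !big_cons addrA => e.
have sl' : sorted leq_atoms l by exact: path_sorted sl.
have S0 : 0 <= \sum_(j <- l) j.1.
  by rewrite big_seq; apply: sumr_ge0 => j jl; exact: (allP l0).
have aq : a <= a + q.1 by rewrite lerDl.
have aq1 : a + q.1 <= 1 by rewrite -e lerDl.
have <- : `[a, a + q.1[ `|` `[a + q.1, 1[ = `[a, 1[%classic :> set R.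
  by rewrite -itv_bndbnd_setU // bnd_simp.
rewrite cint_setU //; last 2 first.
- by apply: (@key a (q :: l)) => //; exact: measurableU.
- apply/disj_setPS => y [/=]; rewrite 2!in_itv/= => /andP[_ y1] /andP[y2 _].
  by rewrite ltNge y2 in y1.
congr (_ + _).
  rewrite (@eq_cint _ _ _ _ _ _ (cst (G (atan q.2)))); last first.
    by move=> x; rewrite inE /= in_itv /= => /andP[_ ->].
  rewrite cint_cst // mulrC; congr (_%:C * _).
  by rewrite [LHS](congr1 fine (uniform_prob_itv a0 aq aq1)) /= addrAC subrr add0r.
rewrite -(IH (a + q.1)) //; last by rewrite addr_ge0.
apply: eq_cint => x; rewrite inE /= in_itv /= => /andP[x1 _].
by rewrite ltNge x1.
Qed.

Lemma cint_uniform_prob (G : R -> R[i]) (M : R) : cmeasurable setT G ->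
  (forall t, normc (G t) <= M) -> cint P setT G = cint P `[0, 1[ G.
Proof.
move=> mG bG; rewrite -(setUv `[0, 1[).
have mI : measurable (`[0, 1[%classic : set R) by [].
rewrite cint_setU //; last 3 first.
- exact: measurableC.
- by rewrite setUv; exact: (@cintegrable_bdd _ _ _ (uniform_prob ltr01) _ M).
- by apply/disj_setPS; rewrite setICr.
rewrite [X in _ + X]cint_null ?addr0 //.
- exact: measurableC.
- exact: (cmeasurableS measurableT).
rewrite -(setTD `[0, 1[) measureD //=; last first.
  by rewrite -ge0_fin_numE // fin_num_measure.
by rewrite setTI probability_setT uniform_prob_itv // subr0 subee.
Qed.

Lemma exists_atan_quantile l : weights_ge0 l -> \sum_(q <- l) q.1 = 1 ->
  exists T : R -> R, [/\ {homo T : u v / u <= v},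
    forall u, - (pi / 2) <= T u <= pi / 2 &
    forall w, 0 < complex.Im w -> cint P setT (frac_tan w \o T) = dcauchy l w].
Proof.
move=> l0 l1; pose l' := sort leq_atoms l.
have tot : total leq_atoms by move=> x y; exact: le_total.
have sl : sorted leq_atoms l' by exact: sort_sorted.
have pl : perm_eq l' l by rewrite perm_sort.
have hT := atan_quantile_homo 0 sl.
exists (atan_quantile 0 l'); split => //; first by move=> u; exact: atan_quantile_itv.
move=> w w0.
have mf := cmeasurable_frac_tan w.
have bf t := frac_tan_bound t w0.
rewrite (cint_uniform_prob (M := (complex.Im w)^-1)); last 2 first.
- by apply: cmeasurable_frac_tan_comp; exact: nondecreasing_measurable.
- by move=> t; exact: bf.
rewrite (cint_atan_quantile mf bf) //; last 2 first.
- by rewrite /weights_ge0 (perm_all _ pl).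
- by rewrite add0r (perm_big _ pl).
rewrite (perm_big _ pl); apply: eq_bigr => q _.
by rewrite frac_tan_atan.
Qed.

End Quantile.

(** * Helly selection for monotone functions *)

Section Selection.
Variable R : realType.
Local Notation P := (uniform_prob (@ltr01 R)).

Import ArrowAsProduct.

(** A cluster point in a compact product, then a diagonal choice: [phi n] >= n is an index at which
    the first n + 1 rationals are within 1 / (n + 1). It need not increase with n; tending to
    infinity is enough for passing to limits. *)
Lemma cluster_on_rat (T : nat -> R -> R) (A B : R) :
  (forall k u, A <= T k u <= B) ->
  exists (phi : nat -> nat) (p : rat -> R),
    [/\ (forall n, (n <= phi n)%N), (forall q, A <= p q <= B) &
     forall q, T (phi n) (ratr q) @[n --> \oo] --> p q].
Proof.
move=> TAB.
pose F : set_system (prod_topology (fun _ : rat => R)) :=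
  (fun k : nat => (fun q : rat => T k (ratr q))) @ \oo.
have FF : ProperFilter F by exact: fmap_proper_filter.
have cpt : compact [set f : prod_topology (fun _ : rat => R) |
    forall q, (`[A, B]%classic : set R) (f q)].
  by apply: (@tychonoff rat (fun=> R) (fun=> `[A, B]%classic)) => q; exact: segment_compact.
have [|p [pAB pF]] := cpt F FF.
  by exists 0%N => // k _ q /=; rewrite in_itv /= TAB.
(* An enumeration of the rationals in which codes of no rational default to 0. *)
pose q_ (j : nat) : rat := odflt 0 (unpickle j).
have near_p n : nbhs p [set f : prod_topology (fun _ : rat => R) |
    forall j : 'I_n.+1, `|p (q_ j) - f (q_ j)| < n.+1%:R^-1].
  apply: (@filter_forall _ 'I_n.+1 (fun (j : 'I_n.+1)
    (f : prod_topology (fun _ : rat => R)) =>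
      `|p (q_ j) - f (q_ j)| < n.+1%:R^-1) (nbhs p)) => j.
  have := @proj_continuous rat (fun=> R) (q_ j) p.
  move=> /(_ (ball (p (q_ j)) n.+1%:R^-1)); apply.
  by apply: nbhsx_ballx; rewrite invr_gt0 ltr0n.
have ex n : exists k, (n <= k)%N /\
    forall j : 'I_n.+1, `|p (q_ j) - T k (ratr (q_ j))| < n.+1%:R^-1.
  have [|f [/= [k nk <-] h]] := pF
    [set (fun q : rat => T k (ratr q)) | k in [set k | (n <= k)%N]] _ _ (near_p n).
    by exists n => // k /= nk; exists k.
  by exists k.
have [phi phiP] := choice ex.
exists phi, p; split; [by move=> n; case: (phiP n)|by move=> q; have := pAB q; rewrite /= in_itv|].
move=> q; apply/cvgrPdist_lt => e e0.
near=> n.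
have [_ h] := phiP n.
have qn : (pickle q < n.+1)%N by near: n; exact: nbhs_infty_ge.
have qE : q_ (pickle q) = q by rewrite /q_ pickleK.
have h' := h (Ordinal qn); rewrite [q_ _]qE in h'; apply: (lt_trans h').
near: n; exact: near_infty_natSinv_lt (PosNum e0).
Unshelve. all: by end_near. Qed.

Variables (T : nat -> R -> R) (A B : R).
Hypothesis TAB : forall k u, A <= T k u <= B.
Hypothesis Thomo : forall k, {homo T k : u v / u <= v}.

(** [L] and [H] are the left and right limits of p along the rationals. Where they agree,
    monotonicity squeezes T (phi n) u to the common value; where they differ, the gaps ]L u, H u[
    are disjoint, hence countably many. *)
Lemma helly_selection : exists (phi : nat -> nat) (L : R -> R),
  [/\ (forall n, (n <= phi n)%N), {homo L : u v / u <= v},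
   (forall u, A <= L u <= B) &
   exists N : set R, countable N /\
     forall u, ~ N u -> T (phi n) u @[n --> \oo] --> L u].
Proof.
have [phi [p [phin pAB pcvg]]] := cluster_on_rat TAB.
have phomo (q r : rat) : q <= r -> p q <= p r.
  move=> qr; apply: (ler_cvg_to (pcvg q) (pcvg r)).
  by apply: nearW => n; apply: Thomo; rewrite ler_rat.
pose EL (u : R) : set R := [set p q | q in [set q : rat | ratr q < u]].
pose EH (u : R) : set R := [set p q | q in [set q : rat | u < ratr q]].
pose L u := sup (EL u).
pose H u := inf (EH u).
have ratlt (u v : R) : u < v -> exists q : rat, u < ratr q < v.
  by move=> uv; have [q] := rat_in_itvoo uv; rewrite in_itv /=; exists q.
have ELn u : EL u !=set0.
  have [|q /andP[_ qu]] := ratlt (u - 1) u; first by rewrite ltrBlDr ltrDl.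
  by exists (p q), q.
have EHn u : EH u !=set0.
  have [|q /andP[qu _]] := ratlt u (u + 1); first by rewrite ltrDl.
  by exists (p q), q.
have ELub u : has_ubound (EL u).
  by exists B => _ [q _ <-]; case/andP: (pAB q).
have EHlb u : has_lbound (EH u).
  by exists A => _ [q _ <-]; case/andP: (pAB q).
have pL (q : rat) u : ratr q < u -> p q <= L u.
  by move=> qu; apply: ub_le_sup => //; exists q.
have Lp (q : rat) u : u <= ratr q -> L u <= p q.
  move=> uq; apply: ge_sup => // _ [r /= ru <-]; apply: phomo.
  by rewrite -(ler_rat R) ltW // (lt_le_trans ru).
have pH (q : rat) u : ratr q <= u -> p q <= H u.
  move=> uq; apply: lb_le_inf => // _ [r /= ru <-]; apply: phomo.
  by rewrite -(ler_rat R) ltW // (le_lt_trans uq).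
have Hp (q : rat) u : u < ratr q -> H u <= p q.
  by move=> qu; apply: ge_inf => //; exists q.
have HL u v : u < v -> H u <= L v.
  by move=> /ratlt[q /andP[uq qv]]; rewrite (le_trans (Hp _ _ uq)) // pL.
have LH u : L u <= H u.
  apply: ge_sup => // _ [r /= ru <-]; apply: pH; exact: ltW.
exists phi, L; split => //.
- move=> u v; rewrite le_eqVlt => /orP[/eqP -> //|uv].
  exact: le_trans (LH u) (HL _ _ uv).
- move=> u; have [x Ex] := ELn u; have [q qu pqx] := Ex.
  have /andP[pA pB] := pAB q.
  rewrite (le_trans pA (pL _ _ qu)) /=.
  by apply: ge_sup => // _ [r _ <-]; case/andP: (pAB r).
exists [set u | L u < H u]; split.
  have ex u : exists q : rat, L u < H u -> L u < ratr q < H u.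
    have [/ratlt[q hq]|] := ltP (L u) (H u); first by exists q.
    by exists 0.
  have [r rP] := choice ex.
  apply/countable_injP; exists (fun u => pickle (r u)) => u v.
  rewrite !inE /= => uN vN /(pcan_inj pickleK) ruv.
  have /andP[u1 u2] := rP _ uN; have /andP[v1 v2] := rP _ vN.
  have [uv|vu|//] := ltgtP u v.
  - have := lt_le_trans u2 (HL _ _ uv); rewrite ruv => /(lt_trans v1).
    by rewrite ltxx.
  - have := lt_le_trans v2 (HL _ _ vu); rewrite -ruv => /(lt_trans u1).
    by rewrite ltxx.
move=> u /= /negP; rewrite -leNgt => HLu.
have LHu : L u = H u by apply/eqP; rewrite eq_le LH HLu.
apply/cvgrPdist_lt => e e0.
have [_ [q /= qu <-] hq] := sup_adherent e0 (conj (ELn u) (ELub u)).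
have [_ [r /= ru <-] hr] := inf_adherent e0 (conj (EHn u) (EHlb u)).
have /cvgrPdist_lt cq := pcvg q; have /cvgrPdist_lt cr := pcvg r.
have e1 : 0 < p q - (L u - e) by rewrite subr_gt0.
have e2 : 0 < H u + e - p r by rewrite subr_gt0.
near=> n.
have h1 : `|p q - T (phi n) (ratr q)| < p q - (L u - e) by near: n; exact: cq.
have h2 : `|p r - T (phi n) (ratr r)| < H u + e - p r by near: n; exact: cr.
have h3 := Thomo (phi n) (ltW qu); have h4 := Thomo (phi n) (ltW ru).
move: h1 h2; rewrite !ltr_norml => /andP[_ h1] /andP[h2 _].
rewrite -LHu in h2; apply/andP; split; lra.
Unshelve. all: by end_near. Qed.

End Selection.

(** * From convergent discrete Cauchy transforms to a limit law *)

Section ProbabilityLimit.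
Variable R : realType.
Local Notation P := (uniform_prob (@ltr01 R)).

Lemma cint_ae_eq d (T : measurableType d) (mu : {measure set T -> \bar R})
    (f g : T -> R[i]) :
  cmeasurable setT f -> cmeasurable setT g -> {ae mu, forall x, f x = g x} ->
  cint mu setT f = cint mu setT g.
Proof.
move=> [f1 f2] [g1 g2] fg.
apply: complex_eq; rewrite /= /Rintegral; congr fine; apply: ae_eq_integral => //;
  try exact/measurable_EFinP;
  by apply: filterS fg => x + _ => ->.
Qed.

Lemma normc_cvg_unique (u : nat -> R[i]) (a b : R[i]) :
  normc (u n - a) @[n --> \oo] --> (0 : R) ->
  normc (u n - b) @[n --> \oo] --> (0 : R) -> a = b.
Proof.
move=> ua ub; apply/eqP; rewrite -subr_eq0; apply/eqP/eq0_normc/eqP.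
rewrite eq_le normc_ge0 andbT.
have h : normc (u n - a) + normc (u n - b) @[n --> \oo] --> (0 : R).
  by rewrite -[X in _ --> X]addr0; exact: cvgD.
apply: (ler_cvg_to (cvg_cst _) h); apply: nearW => n.
rewrite -(normcN (u n - a)) opprB addrC.
by rewrite (le_trans _ (le_normcD _ _)) // addrC addrA subrK.
Qed.

Lemma cmeasurable_fraction d (T : measurableType d) (X : T -> R) (w : R[i]) :
  measurable_fun setT X -> cmeasurable setT (fun x => (w - (X x)%:C)^-1).
Proof.
move=> mX; apply: cmeasurableV => //; apply: cmeasurableB; last exact: cmeasurableR.
exact: cmeasurable_cst.
Qed.

Lemma Im_upper_sub (w : R[i]) (x : R) : complex.Im (w - x%:C) = complex.Im w.
Proof. by rewrite cImD cImN /= oppr0 addr0. Qed.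

Lemma normc_fraction_le (w : R[i]) (x : R) : 0 < complex.Im w ->
  normc (w - x%:C)^-1 <= (complex.Im w)^-1.
Proof.
move=> w0; rewrite normcV lef_pV2 ?posrE //; last first.
  by rewrite normc_gt0 upper_subR_neq0.
by rewrite -[leLHS](Im_upper_sub w x) (le_trans (ler_norm _)) // normc_Im.
Qed.

Lemma cint_distribution d (T : measurableType d) (Q : probability T R)
    (X : {RV Q >-> R}) (f : R -> R[i]) (M : R) :
  cmeasurable setT f -> (forall x, normc (f x) <= M) ->
  cint (distribution Q X) setT f = cint Q setT (f \o X).
Proof.
move=> mf bf; have [f1 f2] := mf.
have mX : measurable_fun setT X by exact: measurable_funPT.
have [i1 i2] : cintegrable Q setT (f \o X).
  apply: (@cintegrable_bdd _ _ _ Q _ M); last by move=> x; exact: bf.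
  by split; [exact: (measurableT_comp f1 mX)|exact: (measurableT_comp f2 mX)].
by apply: complex_eq; rewrite /= /Rintegral integral_distribution //;
  exact/measurable_EFinP.
Qed.

(* [T] is the arctangent of the quantile function of [l]: its values stay in a compact
   interval, so that Helly's theorem applies before any tightness is known. *)
Lemma exists_quantile_space : exists Q : probability R R,
  (forall N : set R, countable N -> Q N = 0%E) /\
  forall l : seq (R * R), weights_ge0 l -> \sum_(q <- l) q.1 = 1 ->
  exists T : R -> R, [/\ {homo T : u v / u <= v},
    forall u, - (pi / 2) <= T u <= pi / 2 &
    forall w, 0 < complex.Im w -> cint Q setT (frac_tan w \o T) = dcauchy l w].
Proof.
pose U : probability (measurableTypeR R) R := P.
have mid : measurable_fun setT (idfun : measurableTypeR R -> R) by exact: measurable_id.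
pose X : {RV U >-> R} :=
  MeasurableFun.Pack (MeasurableFun.Class (isMeasurableFun.Build _ _ _ _ _ mid)).
exists (distribution U X); split; last first.
  move=> l l0 l1; have [T [Th TI Tl]] := exists_atan_quantile l0 l1.
  exists T; split => // w w0; rewrite -Tl //.
  apply: (@cint_distribution _ _ U X (frac_tan w \o T) (complex.Im w)^-1).
    by apply: cmeasurable_frac_tan_comp; exact: nondecreasing_measurable.
  by move=> x; exact: frac_tan_bound.
move=> N cN; have /null_content_dominatesP := dominates_uniform_prob (@ltr01 R).
by apply; [exact: countable_measurable|exact: countable_lebesgue_measure0].
Qed.

(** [W] pairs points with prescribed limits, so convergence is required only where it is known. The
    last hypothesis is the tightness condition; the law is that of tan L, with L the Helly limit of
    the angular quantile functions. *)
Lemma discrete_probability_limit (s : nat -> seq (R * R)) (W : R[i] -> R[i] -> Prop) :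
  (forall k, weights_ge0 (s k)) -> (forall k, \sum_(q <- s k) q.1 = 1) ->
  (forall w z, W w z -> 0 < complex.Im w /\
     normc (dcauchy (s k) w - z) @[k --> \oo] --> (0 : R)) ->
  (forall e, 0 < e -> exists w z, W w z /\ 1 - e < complex.Im w * normc z) ->
  exists nu : probability R R, forall w z, W w z -> Defs.cauchy nu w = z.
Proof.
move=> s0 s1 sW eW.
have [Q [QN QT]] := exists_quantile_space.
have [T TP] := choice (fun k => QT _ (s0 k) (s1 k)).
have Thomo k : {homo T k : u v / u <= v} by case: (TP k).
have TI k u : - (pi / 2) <= T k u <= pi / 2 by case: (TP k).
have [phi [L [phin Lhomo _ [N [cN TL]]]]] := helly_selection TI Thomo.
have mT k : measurable_fun setT (T k) by exact: nondecreasing_measurable.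
have mL : measurable_fun setT L by exact: nondecreasing_measurable.
have aeN : {ae Q, forall u, T (phi n) u @[n --> \oo] --> L u}.
  exists N; split.
  - exact: countable_measurable.
  - exact: QN.
  - by move=> u /= h; apply: contrapT => /TL.
have mfL w : cmeasurable setT (frac_tan w \o L) by exact: cmeasurable_frac_tan_comp.
have mfT w n : cmeasurable setT (frac_tan w \o T (phi n)).
  exact: cmeasurable_frac_tan_comp.
have lim w : 0 < complex.Im w ->
    normc (dcauchy (s (phi n)) w - cint Q setT (frac_tan w \o L)) @[n --> \oo] --> (0 : R).
  move=> w0.
  have -> : (fun n => normc (dcauchy (s (phi n)) w - cint Q setT (frac_tan w \o L))) =
      (fun n => normc (cint Q setT (frac_tan w \o T (phi n)) - cint Q setT (frac_tan w \o L))).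
    by apply/funext => n; case: (TP (phi n)) => _ _ ->.
  apply: (@cint_dominated_cvg _ _ _ Q setT (fun n => frac_tan w \o T (phi n))
      _ (cst (complex.Im w)^-1)) => //.
  - exact: finite_measure_integrable_cst.
  - by move=> n x _; exact: frac_tan_bound.
  - by move=> x _; exact: frac_tan_bound.
  apply: filterS aeN => u Tu _.
  have h : frac_tan_cst w ^+ 2 * `|T (phi n) u - L u| @[n --> \oo] --> (0 : R).
    rewrite -[X in _ --> X](mulr0 (frac_tan_cst w ^+ 2)); apply: cvgMr.
    by apply/norm_cvg0P; rewrite -[X in _ --> X](subrr (L u)); exact: cvgB Tu (cvg_cst _).
  apply: (squeeze_cvgr _ (cvg_cst 0) h); apply: nearW => n.
  by rewrite normc_ge0 /= frac_tan_dist.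
have phioo : phi n @[n --> \oo] --> \oo.
  by apply/cvgnyPge => A; exists A => // n /= An; exact: leq_trans (phin n).
have IW w z : W w z -> cint Q setT (frac_tan w \o L) = z.
  move=> /sW[w0 cz]; apply: (normc_cvg_unique (lim w w0)).
  exact: (@cvg_comp _ _ _ phi (fun k => normc (dcauchy (s k) w - z)) _ _ _ phioo cz).
pose Z := [set u | cos (L u) = 0].
have mcL : measurable_fun setT (fun u => cos (L u)).
  by apply: (measurableT_comp _ mL); exact: continuous_measurable_fun (@continuous_cos R).
have msL : measurable_fun setT (fun u => sin (L u)).
  by apply: (measurableT_comp _ mL); exact: continuous_measurable_fun (@continuous_sin R).
have mZ : measurable Z.
  by have := mcL measurableT [set 0] (measurable_set1 _); rewrite setTI.
(* [Z] is the mass that escapes to infinity. The kernel vanishes there, so Im w |z| <= 1 - Q Z for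
   every pair of [W]; the tightness hypothesis with e = Q Z would give the opposite strict
   inequality. *)
have QZ0 : Q Z = 0%E.
  have QZfin : Q Z \is a fin_num by exact: fin_num_measure.
  have [//|QZn] := eqVneq (Q Z) 0%E.
  have dpos : 0 < fine (Q Z).
    by rewrite fine_gt0 // lt0e QZn measure_ge0 /= ltey_eq QZfin.
  have [w [z [Wwz]]] := eW _ dpos.
  rewrite -(IW _ _ Wwz); have [w0 _] := sW _ _ Wwz.
  have ig : Q.-integrable setT (EFin \o (fun u => (complex.Im w)^-1 * \1_(~` Z) u)).
    apply: (integrableZl measurableT (complex.Im w)^-1 (f := EFin \o \1_(~` Z))).
    by apply: integrable_indic; exact: measurableC.
  have := @normc_cint_le _ _ _ Q setT (frac_tan w \o L) _ measurableT _ ig.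
  have -> : Rintegral Q setT (fun u => (complex.Im w)^-1 * \1_(~` Z) u) =
      (complex.Im w)^-1 * (1 - fine (Q Z)).
    rewrite RintegralZl //; last by apply: integrable_indic; exact: measurableC.
    congr (_ * _); rewrite /Rintegral integral_indic //=; last exact: measurableC.
    rewrite setIT probability_setC // fineB //.
  move=> h h1; exfalso; move: h1; apply/negP; rewrite -leNgt.
  rewrite mulrC -ler_pdivlMr // mulrC; apply: h => [|u _].
    by apply: (@cintegrable_bdd _ _ _ Q _ (complex.Im w)^-1) => // u; exact: frac_tan_bound.
  rewrite indicE; have [uZ|uZ] := boolP (u \in ~` Z).
    by rewrite mulr1 frac_tan_bound.
  rewrite mulr0 /= /frac_tan; move: uZ; rewrite notin_setE /= => /contrapT ->.
  by rewrite mul0r normc0.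
have mX : measurable_fun setT (fun u => tan (L u)).
  by apply: measurable_funM => //; exact: measurable_funV.
pose X : {RV Q >-> R} :=
  MeasurableFun.Pack (MeasurableFun.Class (isMeasurableFun.Build _ _ _ _ _ mX)).
exists (distribution Q X) => w z Wwz.
have [w0 _] := sW _ _ Wwz.
rewrite /Defs.cauchy (@cint_distribution _ _ Q X (fun x => (w - x%:C)^-1) (complex.Im w)^-1);
  last 2 first.
- exact: (cmeasurable_fraction w (@measurable_id _ _ _)).
- by move=> x; exact: normc_fraction_le.
rewrite -(IW _ _ Wwz); apply: cint_ae_eq => //.
  exact: (cmeasurable_fraction w mX).
exists Z; split => // u /= h; apply: contrapT => /eqP cu; apply: h.
by rewrite frac_tan_tan.
Qed.

End ProbabilityLimit.

(** * The free Levy-Khintchine transform *)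

Import HBSimple HBNNSimple.

Section SimpleIntegral.
Context d (T : measurableType d) (R : realType)
  (mu : {finite_measure set T -> \bar R}).

Lemma cintegrable_sum (I : Type) (r : seq I) (F : I -> T -> R[i]) :
  (forall i, cintegrable mu setT (F i)) ->
  cintegrable mu setT (fun x => \sum_(i <- r) F i x) /\
  cint mu setT (fun x => \sum_(i <- r) F i x) = \sum_(i <- r) cint mu setT (F i).
Proof.
move=> iF; elim: r => [|i r [IH1 IH2]].
  have e : (fun x : T => \sum_(i <- [::]) F i x) = cst 0 by apply/funext => x; rewrite big_nil.
  rewrite e big_nil cint_cst // mul0r; split => //.
  apply: (@cintegrable_bdd _ _ _ mu _ 0); first exact: cmeasurable_cst.
  by move=> x; rewrite normc0.
have e : (fun x : T => \sum_(j <- i :: r) F j x) = (fun x => F i x + \sum_(j <- r) F j x).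
  by apply/funext => x; rewrite big_cons.
rewrite e big_cons -IH2 cintD //; split => //; exact: cintegrableD.
Qed.

Lemma cint_simple (h : T -> R) (r : seq R) (G : R -> R[i]) :
  measurable_fun setT h -> uniq r -> (forall x, h x \in r) ->
  cint mu setT (G \o h) = \sum_(v <- r) (fine (mu (h @^-1` [set v])))%:C * G v.
Proof.
move=> mh ur hr.
have mhv v : measurable (h @^-1` [set v]).
  by rewrite -[X in measurable X]setTI; exact: mh.
have iF v : cintegrable mu setT (fun x => G v * (\1_(h @^-1` [set v]) x)%:C).
  apply: (@cintegrable_bdd _ _ _ mu _ (normc (G v))).
    apply: cmeasurableM; first exact: cmeasurable_cst.
    by apply: cmeasurableR; exact: measurable_indic.
  move=> x; rewrite normcM normcR ler_piMr ?normc_ge0 // indicE.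
  by case: (_ \in _); rewrite ?normr1 ?normr0.
have [_ e] := cintegrable_sum r iF.
rewrite (_ : G \o h = fun x => \sum_(v <- r) G v * (\1_(h @^-1` [set v]) x)%:C).
  rewrite e; apply: eq_bigr => v _.
  have i1 : cintegrable mu setT (fun x => (\1_(h @^-1` [set v]) x)%:C : R[i]).
    apply: (@cintegrable_bdd _ _ _ mu _ 1).
      by apply: cmeasurableR; exact: measurable_indic.
    by move=> x; rewrite normcR indicE; case: (_ \in _); rewrite ?normr1 ?normr0.
  rewrite cintZ // cint_real mulrC; congr (_%:C * _).
  by rewrite /Rintegral integral_indic // setIT.
apply/funext => x /=; rewrite (bigD1_seq (h x)) //= big1 ?addr0.
  by rewrite indicE mem_set // mulr1.
by move=> v vh; rewrite indicE memNset ?mulr0 // => /= hv; rewrite hv eqxx in vh.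
Qed.

End SimpleIntegral.

(** Difference of the monotone approximations of the positive and negative parts, one of which
    vanishes at each point. The bound |h k x| <= |x| lets [kh_weight], monotone in |x|, control all
    approximants at once. *)
Lemma simple_approximation (R : realType) : exists h : nat -> R -> R,
  [/\ forall k, measurable_fun setT (h k),
      forall k x, `|h k x| <= `|x|,
      forall k, exists r : seq R, uniq r /\ forall x, h k x \in r &
      forall x, h k x @[k --> \oo] --> x].
Proof.
have mid : measurable_fun setT (EFin : R -> \bar R).
  by apply/measurable_EFinP; exact: measurable_id.
pose f := nnsfun_approx measurableT (measurable_funepos mid).
pose g := nnsfun_approx measurableT (measurable_funeneg mid).
have h0p : forall y : R, setT y -> (0 <= (EFin : R -> \bar R)^\+ y)%E.
  by move=> y _; exact: funepos_ge0.
have h0n : forall y : R, setT y -> (0 <= (EFin : R -> \bar R)^\- y)%E.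
  by move=> y _; exact: funeneg_ge0.
have fle k x : f k x <= Num.max x 0.
  rewrite -lee_fin /f nnsfun_approxE; apply: le_trans (le_approx k h0p (I : setT x)) _.
  by rewrite funeposE EFin_max.
have gle k x : g k x <= Num.max (- x) 0.
  rewrite -lee_fin /g nnsfun_approxE; apply: le_trans (le_approx k h0n (I : setT x)) _.
  by rewrite funenegE EFin_max.
exists (fun k x => f k x - g k x); split.
- by move=> k; apply: measurable_funB; exact: measurable_funPT.
- move=> k x.
  have f0 : 0 <= f k x by exact: fun_ge0.
  have g0 : 0 <= g k x by exact: fun_ge0.
  have := fle k x; have := gle k x.
  have [x0|x0] := leP 0 x.
    rewrite (ger0_norm x0) [Num.max _ _](max_idPr _) ?oppr_le0 // => h1 h2.
    have -> : g k x = 0 by apply/eqP; rewrite eq_le h1.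
    by rewrite subr0 ger0_norm.
  rewrite (ltr0_norm x0) [Num.max _ _](max_idPl _) ?oppr_ge0 ?(ltW x0) // => h1 h2.
  have -> : f k x = 0 by apply/eqP; rewrite eq_le h2.
  by rewrite sub0r normrN ger0_norm.
- move=> k.
  have /finite_seqP[r1 h1] := fimfunP (f k).
  have /finite_seqP[r2 h2] := fimfunP (g k).
  exists (undup [seq u - v | u <- r1, v <- r2]); split; first exact: undup_uniq.
  move=> x; rewrite mem_undup; apply/allpairsP; exists (f k x, g k x); split => //=.
    have : range (f k) (f k x) by exists x.
    by rewrite h1.
  have : range (g k) (g k x) by exists x.
  by rewrite h2.
move=> x.
have fx : f k x @[k --> \oo] --> Num.max x 0.
  have h := cvg_nnsfun_approx measurableT (measurable_funepos mid) h0p (I : setT x).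
  by move: h; rewrite funeposE -EFin_max => /fine_cvg.
have gx : g k x @[k --> \oo] --> Num.max (- x) 0.
  have h := cvg_nnsfun_approx measurableT (measurable_funeneg mid) h0n (I : setT x).
  by move: h; rewrite funenegE -EFin_max => /fine_cvg.
have e : Num.max x 0 - Num.max (- x) 0 = x.
  by rewrite /Num.max; case: ifP; case: ifP; lra.
by rewrite -[X in _ --> X]e; exact: cvgB.
Qed.

(** * The Khintchine kernel and its size on cones *)

Section KhintchineTransform.
Variable R : realType.
Variables (a : R) (m : {finite_measure set R -> \bar R}).
Implicit Types (h : R -> R) (z u v w : R[i]).

Definition kh_kernel z (x : R) : R[i] := (1 + z * x%:C) / (z - x%:C).

(** [h] displaces the atoms of m: [idfun] gives V, a finitely valued [h] gives a discrete
    approximation of V. *)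
Definition kh_transform h z : R[i] := a%:C + cint m setT (fun x => kh_kernel z (h x)).

(** Drift x plus nonnegative mass 1 + x^2 at x: the form that turns a discrete m into a [dcauchy],
    and the one for increments in z. *)
Lemma kh_kernelE z x : 0 < complex.Im z ->
  kh_kernel z x = x%:C + (1 + x%:C ^+ 2) / (z - x%:C).
Proof.
move=> z0; have zx := upper_subR_neq0 x z0.
apply: (mulIf zx); rewrite /kh_kernel mulfVK // mulrDl mulfVK //; ring.
Qed.

(** Here x occurs only in the bounded fraction 1 / (z - x), whence bounds uniform in x and the
    increments in x. *)
Lemma kh_kernelE2 z x : 0 < complex.Im z ->
  kh_kernel z x = - z + (1 + z ^+ 2) / (z - x%:C).
Proof.
move=> z0; have zx := upper_subR_neq0 x z0.
apply: (mulIf zx); rewrite /kh_kernel mulfVK // mulrDl mulfVK //; ring.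
Qed.

Lemma kh_kernelB u v x : 0 < complex.Im u -> 0 < complex.Im v ->
  kh_kernel u x - kh_kernel v x =
  (1 + x%:C ^+ 2) * ((u - x%:C)^-1 * (v - x%:C)^-1) * (v - u).
Proof.
move=> u0 v0; have ux := upper_subR_neq0 x u0; have vx := upper_subR_neq0 x v0.
rewrite !kh_kernelE //.
apply: (mulIf ux); apply: (mulIf vx).
rewrite [RHS](_ : _ = (1 + x%:C ^+ 2) * (v - u) * (((u - x%:C)^-1 * (u - x%:C)) * ((v - x%:C)^-1 * (v - x%:C)))); last by ring.
rewrite !mulVf // !mulr1.
rewrite [LHS](_ : _ = (1 + x%:C ^+ 2) * (((u - x%:C)^-1 * (u - x%:C)) * (v - x%:C) - (u - x%:C) * ((v - x%:C)^-1 * (v - x%:C)))); last by ring.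
rewrite !mulVf // mulr1 mul1r; ring.
Qed.

Lemma kh_kernelBr z x y : 0 < complex.Im z ->
  kh_kernel z x - kh_kernel z y =
  (1 + z ^+ 2) * ((z - x%:C)^-1 * (z - y%:C)^-1) * (x%:C - y%:C).
Proof.
move=> z0; have zx := upper_subR_neq0 x z0; have zy := upper_subR_neq0 y z0.
rewrite !kh_kernelE2 //.
apply: (mulIf zx); apply: (mulIf zy).
rewrite [RHS](_ : _ = (1 + z ^+ 2) * (x%:C - y%:C) * (((z - x%:C)^-1 * (z - x%:C)) * ((z - y%:C)^-1 * (z - y%:C)))); last by ring.
rewrite !mulVf // !mulr1.
rewrite [LHS](_ : _ = (1 + z ^+ 2) * (((z - x%:C)^-1 * (z - x%:C)) * (z - y%:C) - (z - x%:C) * ((z - y%:C)^-1 * (z - y%:C)))); last by ring.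
rewrite !mulVf // mulr1 mul1r; ring.
Qed.

Lemma normc_kh_kernel_le z x : 0 < complex.Im z ->
  normc (kh_kernel z x) <= normc z + (1 + normc z ^+ 2) / complex.Im z.
Proof.
move=> z0; rewrite kh_kernelE2 // (le_trans (le_normcD _ _)) // normcN lerD2l.
rewrite normcM ler_pM ?normc_ge0 // ?normc_fraction_le //.
by rewrite (le_trans (le_normcD _ _)) // normc1 normcX.
Qed.

Lemma cmeasurable_kh_kernel h z : measurable_fun setT h ->
  cmeasurable setT (fun x => kh_kernel z (h x)).
Proof.
move=> mh; apply: cmeasurableM; last exact: cmeasurable_fraction.
apply: cmeasurableD; first exact: cmeasurable_cst.
by apply: cmeasurableM; [exact: cmeasurable_cst|exact: cmeasurableR].
Qed.

Lemma cintegrable_kh_kernel h z : measurable_fun setT h -> 0 < complex.Im z ->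
  cintegrable m setT (fun x => kh_kernel z (h x)).
Proof.
move=> mh z0.
apply: (@cintegrable_bdd _ _ _ m _ (normc z + (1 + normc z ^+ 2) / complex.Im z)).
  exact: cmeasurable_kh_kernel.
by move=> x; exact: normc_kh_kernel_le.
Qed.

Lemma kh_transform_cvg (h_ : nat -> R -> R) h z : (forall k, measurable_fun setT (h_ k)) ->
  measurable_fun setT h -> (forall x, h_ k x @[k --> \oo] --> h x) ->
  0 < complex.Im z ->
  normc (kh_transform (h_ k) z - kh_transform h z) @[k --> \oo] --> (0 : R).
Proof.
move=> mh_ mh hh z0.
have e k : kh_transform (h_ k) z - kh_transform h z =
    cint m setT (fun x => kh_kernel z (h_ k x)) - cint m setT (fun x => kh_kernel z (h x)).
  by rewrite /kh_transform opprD addrACA subrr add0r.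
under eq_fun do rewrite e.
apply: (@cint_bdd_cvg _ _ _ m (fun k x => kh_kernel z (h_ k x)) _
  (normc z + (1 + normc z ^+ 2) / complex.Im z)).
- by move=> k; exact: cmeasurable_kh_kernel.
- exact: cmeasurable_kh_kernel.
- by move=> k x; exact: normc_kh_kernel_le.
- by move=> x; exact: normc_kh_kernel_le.
move=> x; pose K := normc (1 + z ^+ 2) * ((complex.Im z)^-1 * (complex.Im z)^-1).
have hK : K * `|h_ k x - h x| @[k --> \oo] --> (0 : R).
  rewrite -[X in _ --> X](mulr0 K); apply: cvgMr.
  by apply/norm_cvg0P; rewrite -[X in _ --> X](subrr (h x)); exact: cvgB (hh x) (cvg_cst _).
apply: (squeeze_cvgr _ (cvg_cst 0) hK); apply: nearW => k.
rewrite normc_ge0 /= kh_kernelBr // normcM -rmorphB normcR ler_wpM2r //.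
rewrite normcM ler_wpM2l ?normc_ge0 // normcM.
by rewrite ler_pM ?normc_ge0 // normc_fraction_le.
Qed.

(* [kh_weight Y x] controls the kernels on the cone [|Re u| <= 2 Im u], [Im u > Y]. *)
Definition kh_weight (Y x : R) : R := Num.sqrt ((1 + x ^+ 2) / (Y ^+ 2 + x ^+ 2)).

(** Aperture 2 leaves room around the cone of aperture 1 from which z is taken, so that z + V z and
    all iterates stay inside. *)
Definition wide_cone (Y : R) : set R[i] :=
  [set u | Y < complex.Im u /\ `|complex.Re u| <= 2 * complex.Im u].

Lemma kh_weight_le1 Y x : 1 <= Y -> kh_weight Y x <= 1.
Proof.
move=> Y1; rewrite -sqrtr1 ler_wsqrtr //.
have p : 0 < Y ^+ 2 + x ^+ 2.
  by rewrite ltr_wpDr ?sqr_ge0 // exprn_gt0 // (lt_le_trans ltr01).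
by rewrite ler_pdivrMr // mul1r lerD2r exprn_ege1.
Qed.

Lemma kh_weight_homo Y x y : 1 <= Y -> `|x| <= `|y| -> kh_weight Y x <= kh_weight Y y.
Proof.
move=> Y1 xy; rewrite ler_wsqrtr //.
have p (t : R) : 0 < Y ^+ 2 + t ^+ 2.
  by rewrite ltr_wpDr ?sqr_ge0 // exprn_gt0 // (lt_le_trans ltr01).
have xy2 : x ^+ 2 <= y ^+ 2 by rewrite -(real_normK (num_real x)) -(real_normK (num_real y)) lerXn2r ?nnegrE.
rewrite ler_pdivrMr // mulrAC ler_pdivlMr //.
have Y2 : 1 <= Y ^+ 2 by exact: exprn_ege1.
move: xy2 Y2; move: (x ^+ 2) (y ^+ 2) (Y ^+ 2) => X Z W h1 h2; nra.
Qed.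

(** With u = r + is, x^2 <= 2 (x - r)^2 + 2 r^2 and r^2 <= 4 s^2 account for 8 s^2; Y^2 <= s^2
    supplies the ninth. *)
Lemma wide_cone_dist Y u x : 0 < Y -> wide_cone Y u ->
  Y ^+ 2 + x ^+ 2 <= 9 * normc (u - x%:C) ^+ 2.
Proof.
move=> Y0 [Yu Ru]; rewrite normc_sqr !(cReD,cReN,cImD,cImN) /= oppr0 addr0.
move: Yu Ru; move: (complex.Re u) (complex.Im u) => r s Yu; rewrite ler_norml => /andP[r1 r2].
have h1 : Y ^+ 2 <= s ^+ 2 by rewrite lerXn2r ?nnegrE // ltW // (lt_trans Y0).
have h2 : r ^+ 2 <= 4 * s ^+ 2 by nra.
have h3 : 0 <= (x - 2 * r) ^+ 2 by exact: sqr_ge0.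
have h4 : 0 <= (r - x) ^+ 2 by exact: sqr_ge0.
nra.
Qed.

Lemma wide_cone_inv_le Y u x : 0 < Y -> wide_cone Y u ->
  Num.sqrt (1 + x ^+ 2) * normc (u - x%:C)^-1 <= 3 * kh_weight Y x.
Proof.
move=> Y0 uY; have := wide_cone_dist x Y0 uY; rewrite normcV.
have d0 : 0 < normc (u - x%:C).
  by rewrite normc_gt0 upper_subR_neq0 //; case: uY => /(lt_trans Y0).
have p : 0 < Y ^+ 2 + x ^+ 2 by rewrite ltr_wpDr ?sqr_ge0 // exprn_gt0.
move=> h; rewrite /kh_weight sqrtrM; last by rewrite addr_ge0 ?sqr_ge0.
rewrite mulrCA ler_wpM2l ?sqrtr_ge0 //.
rewrite sqrtrV ?(ltW p) // -[_^-1]mul1r ler_pdivrMr // mulrAC ler_pdivlMr ?sqrtr_gt0 //.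
rewrite mul1r -(@ler_sqr R) ?nnegrE ?sqrtr_ge0 ?mulr_ge0 ?normc_ge0 //.
by rewrite sqr_sqrtr ?(ltW p) // exprMn (le_trans h) // -natrX.
Qed.

Lemma normc_1D_mul_le z x :
  normc (1 + z * x%:C) <= Num.sqrt (1 + normc z ^+ 2) * Num.sqrt (1 + x ^+ 2).
Proof.
rewrite -(@ler_sqr R) ?nnegrE ?normc_ge0 ?mulr_ge0 ?sqrtr_ge0 //.
rewrite exprMn !sqr_sqrtr ?addr_ge0 ?sqr_ge0 // !normc_sqr.
case: z => r s /=.
have : 0 <= (r - x) ^+ 2 by exact: sqr_ge0.
nra.
Qed.

Lemma normc_kh_kernel_wide Y u x : 1 <= Y -> wide_cone Y u ->
  normc (kh_kernel u x) <= 5 * normc u * kh_weight Y x.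
Proof.
move=> Y1 uY; have Y0 : 0 < Y by exact: lt_le_trans ltr01 Y1.
have u1 : 1 <= normc u.
  by case: uY => Yu _; rewrite (le_trans Y1) // (le_trans (ltW Yu)) // (le_trans (ler_norm _)) // normc_Im.
have h1 := normc_1D_mul_le u x; have h2 := wide_cone_inv_le x Y0 uY.
(* Since |u| >= 1 the root is at most sqrt 2 |u|; 5 / 3 is a rational bound for sqrt 2 that turns
   the factor 3 below into 5. *)
have h3 : Num.sqrt (1 + normc u ^+ 2) <= 5 / 3 * normc u.
  rewrite -(@ler_sqr R) ?nnegrE ?mulr_ge0 ?sqrtr_ge0 ?normc_ge0 //.
  by rewrite sqr_sqrtr ?addr_ge0 ?sqr_ge0 //; nra.
rewrite normcM (le_trans (ler_wpM2r (normc_ge0 _) h1)) // -[leLHS]mulrA.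
rewrite (le_trans (ler_wpM2l (sqrtr_ge0 _) h2)) //.
have k0 : 0 <= kh_weight Y x by exact: sqrtr_ge0.
rewrite (le_trans (ler_wpM2r _ h3)) ?mulr_ge0 //.
by rewrite [leLHS](_ : _ = 5 * normc u * kh_weight Y x) //; field.
Qed.

Lemma normc_kh_kernelB_wide Y u v x : 1 <= Y -> wide_cone Y u -> wide_cone Y v ->
  normc (kh_kernel u x - kh_kernel v x) <= 9 * normc (u - v) * kh_weight Y x.
Proof.
move=> Y1 uY vY; have Y0 : 0 < Y by exact: lt_le_trans ltr01 Y1.
have u0 : 0 < complex.Im u by case: uY => h _; exact: lt_trans h.
have v0 : 0 < complex.Im v by case: vY => h _; exact: lt_trans h.
rewrite kh_kernelB // normcM (normcBC v).
rewrite [leRHS](_ : _ = 9 * kh_weight Y x * normc (u - v)); last by ring.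
rewrite ler_wpM2r ?normc_ge0 //.
have -> : (1 + x%:C ^+ 2 : R[i]) = (Num.sqrt (1 + x ^+ 2) * Num.sqrt (1 + x ^+ 2))%:C.
  by rewrite -expr2 sqr_sqrtr ?addr_ge0 ?sqr_ge0 // rmorphD rmorphXn.
rewrite normcM normcR ger0_norm ?mulr_ge0 ?sqrtr_ge0 // normcM mulrACA.
have h1 := wide_cone_inv_le x Y0 uY; have h2 := wide_cone_inv_le x Y0 vY.
have k0 : 0 <= kh_weight Y x by exact: sqrtr_ge0.
have k1 := kh_weight_le1 x Y1.
rewrite (le_trans (ler_pM _ _ h1 h2)) ?mulr_ge0 ?sqrtr_ge0 ?normc_ge0 //.
nra.
Qed.

Lemma measurable_kh_weight Y : measurable_fun setT (kh_weight Y).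
Proof.
apply: (@measurableT_comp _ _ _ _ _ _ (@Num.sqrt R)).
  exact: continuous_measurable_fun (@sqrt_continuous R).
apply: measurable_funM; first by apply: measurable_funD => //; exact: measurable_funX.
by apply: measurable_funV => //; apply: measurable_funD => //; exact: measurable_funX.
Qed.

Lemma integrable_kh_weight Y : 1 <= Y -> m.-integrable setT (EFin \o kh_weight Y).
Proof.
move=> Y1; apply: (le_integrable measurableT _ _ (integrable_cst_fin m 1)).
  by apply/measurable_EFinP; exact: measurable_kh_weight.
move=> x _ /=; rewrite lee_fin normr1 ger0_norm ?sqrtr_ge0 //.
exact: kh_weight_le1.
Qed.

(** Dominated convergence: the weight is at most 1 and at most sqrt (1 + x^2) / Y, so only the
    finiteness of m matters. *)
Lemma Rintegral_kh_weight_cvg0 :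
  Rintegral m setT (kh_weight n.+1%:R) @[n --> \oo] --> (0 : R).
Proof.
have n1 n : 1 <= n.+1%:R :> R by rewrite ler1n.
have h := @cint_bdd_cvg _ _ _ m (fun n x => (kh_weight n.+1%:R x)%:C) (cst 0) 1.
have e n : Rintegral m setT (kh_weight n.+1%:R) =
    normc (cint m setT (fun x => (kh_weight n.+1%:R x)%:C) - cint m setT (cst 0)).
  rewrite cint_real cint_cst // mul0r subr0 normcR ger0_norm //.
  by apply: Rintegral_ge0 => x _; exact: sqrtr_ge0.
under eq_fun do rewrite e.
apply: h.
- by move=> n; apply: cmeasurableR; exact: measurable_kh_weight.
- exact: cmeasurable_cst.
- move=> n x; rewrite normcR ger0_norm ?sqrtr_ge0 //; exact: kh_weight_le1.
- by move=> x; rewrite normc0.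
move=> x; pose K := Num.sqrt (1 + x ^+ 2).
have hK : K * (n.+1%:R)^-1 @[n --> \oo] --> (0 : R).
  by rewrite -[X in _ --> X](mulr0 K); apply: cvgMr; exact: cvg_harmonic.
apply: (squeeze_cvgr _ (cvg_cst 0) hK); apply: nearW => n.
apply/andP; split; first exact: normc_ge0.
rewrite /cst subr0 normcR ger0_norm ?sqrtr_ge0 //.
rewrite /kh_weight sqrtrM ?addr_ge0 ?sqr_ge0 // ler_wpM2l ?sqrtr_ge0 //.
rewrite sqrtrV ?addr_ge0 ?sqr_ge0 // lef_pV2 ?posrE ?sqrtr_gt0 ?ltr0n //; last first.
  by rewrite ltr_wpDr ?sqr_ge0 // exprn_gt0.
by rewrite -[leLHS](ger0_norm (ler0n _ _)) -sqrtr_sqr ler_wsqrtr // lerDl sqr_ge0.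
Qed.

(** One threshold [Y] serves every [h] with |h x| <= |x|, because only the integral of [kh_weight Y]
    enters. This uniformity lets the approximant change at each step of the iteration. *)
Lemma kh_transform_small e : 0 < e -> exists Y : R, 1 <= Y /\
  forall h, measurable_fun setT h -> (forall x, `|h x| <= `|x|) ->
  (forall u, wide_cone Y u -> normc (kh_transform h u) <= e * normc u) /\
  (forall u v, wide_cone Y u -> wide_cone Y v ->
     normc (kh_transform h u - kh_transform h v) <= e * normc (u - v)).
Proof.
(* With the weight integral below e / 10, the factor 5 costs e / 2 and leaves e / 2 for the drift,
   while the factor 9 stays below e. *)
move=> e0; have e20 : 0 < e / 10 by rewrite divr_gt0.
have /cvgrPdist_lt/(_ _ e20)[N _ hN] := Rintegral_kh_weight_cvg0.
(* The second entry gives |a| <= (e / 2) Y, and Y <= |u| on the cone. *)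
pose N' := maxn N (Num.truncn (2 * `|a| / e)).+1.
have N1 : 1 <= N'.+1%:R :> R by rewrite ler1n.
exists N'.+1%:R; split => // h mh hx.
set Y := N'.+1%:R in N1 *.
set Th := Rintegral m setT (kh_weight Y).
have Th0 : 0 <= Th by apply: Rintegral_ge0 => x _; exact: sqrtr_ge0.
have ThE : Th <= e / 10.
  have := hN N' (leq_maxl _ _); rewrite /= sub0r normrN -/Y -/Th => /ltW.
  by rewrite ger0_norm.
have aY : `|a| <= e / 2 * Y.
  have : 2 * `|a| / e <= Y.
    rewrite (le_trans (ltW (truncnS_gt _))) // ler_nat.
    exact: leq_trans (leq_maxr N _) (leqnSn _).
  by rewrite ler_pdivrMr // => h1; lra.
have ik c : m.-integrable setT (EFin \o (fun x => c * kh_weight Y x)).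
  exact: (integrableZl measurableT c (integrable_kh_weight N1)).
have Y0 : 0 < Y by exact: lt_le_trans ltr01 N1.
split=> [u uY|u v uY vY].
  have u0 : 0 < complex.Im u by case: uY => ? _; exact: lt_trans Y0 _.
  have uY' : Y <= normc u.
    by case: uY => Yu _; rewrite (le_trans (ltW Yu)) // (le_trans (ler_norm _)) // normc_Im.
  rewrite (le_trans (le_normcD _ _)) // normcR.
  have h1 : normc (cint m setT (fun x => kh_kernel u (h x))) <= 5 * normc u * Th.
    rewrite -RintegralZl //; last exact: integrable_kh_weight.
    apply: normc_cint_le => //; first exact: cintegrable_kh_kernel.
    move=> x _; rewrite (le_trans (normc_kh_kernel_wide _ N1 uY)) //.
    by rewrite ler_wpM2l ?mulr_ge0 ?normc_ge0 // kh_weight_homo.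
  have h2 : e / 2 * Y <= e / 2 * normc u by rewrite ler_wpM2l // divr_ge0 // ltW.
  have h3 : 5 * normc u * Th <= 5 * normc u * (e / 10).
    by rewrite ler_wpM2l // mulr_ge0 ?normc_ge0.
  lra.
have u0 : 0 < complex.Im u by case: uY => ? _; exact: lt_trans Y0 _.
have v0 : 0 < complex.Im v by case: vY => ? _; exact: lt_trans Y0 _.
rewrite /kh_transform opprD addrACA subrr add0r -cintB //; try exact: cintegrable_kh_kernel.
have h1 : normc (cint m setT (fun x => kh_kernel u (h x) - kh_kernel v (h x))) <=
    9 * normc (u - v) * Th.
  rewrite -RintegralZl //; last exact: integrable_kh_weight.
  apply: normc_cint_le => //.
    by apply: cintegrableB => //; exact: cintegrable_kh_kernel.
  move=> x _; rewrite (le_trans (normc_kh_kernelB_wide _ N1 uY vY)) //.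
  by rewrite ler_wpM2l ?mulr_ge0 ?normc_ge0 // kh_weight_homo.
have h3 : 9 * normc (u - v) * Th <= 9 * normc (u - v) * (e / 10).
  by rewrite ler_wpM2l // mulr_ge0 ?normc_ge0.
rewrite (le_trans h1) // (le_trans h3) //.
have := normc_ge0 (u - v); move: (normc _) => b b0; nra.
Qed.

End KhintchineTransform.

(** * The iteration through discrete laws *)

Section FreeLevyKhintchine.
Variable R : realType.
Implicit Types (s : seq (R * R)) (u v w z : R[i]).

(** For nonnegative weights, the reciprocal of the Cauchy transform of a discrete law, by
    [inv_linear_sub_dcauchy]. *)
Definition dF (b : R) s w : R[i] := w - b%:C - dcauchy s w.

Lemma Im_dF b s w : weights_ge0 s -> 0 < complex.Im w ->
  complex.Im w <= complex.Im (dF b s w).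
Proof.
move=> s0 w0; rewrite /dF !cImD !cImN /= oppr0 addr0 lerDl oppr_ge0.
exact: Im_dcauchy_le0.
Qed.

Lemma dcauchy_cat s1 s2 w : dcauchy (s1 ++ s2) w = dcauchy s1 w + dcauchy s2 w.
Proof. by rewrite /dcauchy big_cat. Qed.

Lemma dcauchy_scale (c : R) s w :
  dcauchy [seq (c * q.1, q.2) | q <- s] w = c%:C * dcauchy s w.
Proof.
rewrite /dcauchy big_map mulr_sumr; apply: eq_bigr => q _ /=.
by rewrite rmorphM /= mulrA.
Qed.

(** A fraction 1 / (F - x) with F = [dF b s w] is the reciprocal of [dF (b + x) s w], to which
    [inv_linear_sub_dcauchy] applies. This closure keeps the iteration among discrete transforms. *)
Lemma dcauchy_comp_dF b s t : weights_ge0 s -> weights_ge0 t ->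
  exists s', weights_ge0 s' /\
    forall w, 0 < complex.Im w -> dcauchy t (dF b s w) = dcauchy s' w.
Proof.
move=> s0; elim: t => [|q t IH] /=.
  by exists [::]; split => // w _; rewrite /dcauchy !big_nil.
move=> /andP[q0 /IH[s1 [s10 h1]]].
have [s2 [s20 _ h2]] := inv_linear_sub_dcauchy (b + q.2) s0.
exists ([seq (q.1 * r.1, r.2) | r <- s2] ++ s1); split.
  rewrite /weights_ge0 all_cat; apply/andP; split => //.
  by apply/allP => _ /mapP[r rs ->] /=; rewrite mulr_ge0 //; exact: (allP s20).
move=> w w0; rewrite dcauchy_cat dcauchy_scale -h1 // -h2 //.
rewrite {1}/dcauchy big_cons; congr (_ * _^-1 + _).
by rewrite /dF rmorphD /=; ring.
Qed.

Variables (a : R) (m : {finite_measure set R -> \bar R}).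

Lemma kh_transform_simple (h : R -> R) (r : seq R) :
  measurable_fun setT h -> uniq r -> (forall x, h x \in r) ->
  exists b t, weights_ge0 t /\
    forall z, 0 < complex.Im z -> kh_transform a m h z = b%:C + dcauchy t z.
Proof.
move=> mh ur hr; pose p (v : R) := fine (m (h @^-1` [set v])).
have p0 (v : R) : 0 <= p v by rewrite fine_ge0.
exists (a + \sum_(y <- r) p y * y), [seq (p y * (1 + y ^+ 2), y) | y <- r]; split.
  by apply/allP => _ /mapP[v _ ->] /=; rewrite mulr_ge0 // addr_ge0 // sqr_ge0.
move=> z z0; rewrite /kh_transform.
rewrite -[X in cint _ _ X]/((kh_kernel z) \o h) (@cint_simple _ _ _ m h r) //.
rewrite rmorphD /= -addrA rmorph_sum /= /dcauchy big_map -big_split /=.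
congr (_ + _); apply: eq_bigr => v _.
rewrite kh_kernelE // -/(p v) mulrDr !rmorphM /= rmorphD rmorphXn /=; congr (_ + _).
by rewrite mulrA.
Qed.

(** Once d is below eps / 4, the repeatedly halved errors add up to at most eps / 2, next to a
    geometric term from the starting value. *)
Lemma half_recursion_cvg0 (e d : nat -> R) : (forall k, 0 <= e k) ->
  d k @[k --> \oo] --> (0 : R) -> (forall k, e k.+1 <= d k + 2^-1 * e k) ->
  e k @[k --> \oo] --> (0 : R).
Proof.
move=> e0 d0 he; apply/cvgrPdist_lt => eps eps0.
have e4 : 0 < eps / 4 by rewrite divr_gt0.
have /cvgrPdist_lt/(_ _ e4)[N _ hN] := d0.
have hj j : e (N + j)%N <= eps / 2 + e N * (2^-1) ^+ j.
  elim: j => [|j IH]; first by rewrite addn0 expr0 mulr1 lerDr divr_ge0 // ltW.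
  rewrite addnS (le_trans (he _)) //.
  have := hN (N + j)%N (leq_addr _ _); rewrite /= sub0r normrN => /(le_lt_trans (ler_norm _)) h.
  rewrite exprS; move: IH h; rewrite [e N * (_ * _)]mulrCA; move: (e N * _) => x; lra.
have g0 : e N * (2^-1) ^+ j @[j --> \oo] --> (0 : R).
  rewrite -[X in _ --> X](mulr0 (e N)); apply: cvgMr; apply: cvg_expr.
  by rewrite ger0_norm ?invr_ge0 // invf_lt1 // ltr1n.
have e2 : 0 < eps / 2 by rewrite divr_gt0.
have /cvgrPdist_lt/(_ _ e2)[M _ hM] := g0.
exists (N + M)%N => // n /= Mn.
rewrite sub0r normrN ger0_norm //.
have Nn : (N <= n)%N by rewrite (leq_trans (leq_addr _ _) Mn).
rewrite -(subnKC Nn) (le_lt_trans (hj _)) //.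
have := hM (n - N)%N; rewrite /= sub0r normrN leq_subRL // => /(_ Mn) /(le_lt_trans (ler_norm _)).
by move: (e N * _) => x; lra.
Qed.

(** The approximation index advances together with the iteration, so a single sequence of discrete
    laws results and no double limit has to be taken. *)
Definition fixpoint_orbit (h : nat -> R -> R) w : nat -> R[i] :=
  fix orbit k := if k is k'.+1 then w - kh_transform a m (h k') (orbit k') else w.

(** [b] and [s] are found before w: for each k one discrete law serves all points, as
    [discrete_probability_limit] requires. *)
Lemma fixpoint_orbit_dF (h : nat -> R -> R) :
  (forall k, measurable_fun setT (h k)) ->
  (forall k, exists r : seq R, uniq r /\ forall x, h k x \in r) ->
  forall k, exists b s, weights_ge0 s /\
    forall w, 0 < complex.Im w -> fixpoint_orbit h w k = dF b s w.
Proof.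
move=> mh hr; elim=> [|k [b [s [s0 IH]]]].
  exists 0, [::]; split => // w _.
  by rewrite /= /dF /dcauchy big_nil !subr0.
have [r [ur hxr]] := hr k.
have [c [t [t0 ht]]] := kh_transform_simple (mh k) ur hxr.
have [s' [s'0 hs']] := dcauchy_comp_dF b s0 t0.
exists c, s'; split => // w w0.
rewrite /= -/(fixpoint_orbit h w k) IH // ht; last exact: lt_le_trans (Im_dF b s0 w0).
by rewrite hs' // /dF opprD addrA.
Qed.

(** On the cone of aperture 1, |z| <= (3/2) Im z, so u moves by at most (3/16) Im z: then Im u >=
    (13/16) Im z > Y, and |Re u| < (19/16) Im z stays below twice Im u. *)
Lemma cone_ball (Y : R) z u : 0 < Y -> cone 1 (2 * Y) z ->
  normc (u - z) <= 8^-1 * normc z -> cone 2 Y u.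
Proof.
move=> Y0 [z1 z2] uz; rewrite mul1r in z2.
have nz : normc z <= 3 / 2 * complex.Im z.
  have z0 : 0 < complex.Im z by rewrite (lt_trans _ z1) // mulr_gt0.
  rewrite -(@ler_sqr R) ?nnegrE ?normc_ge0 ?mulr_ge0 ?(ltW z0) // normc_sqr.
  move: z2 z0; rewrite ltr_norml; move: (complex.Re z) (complex.Im z) => r s /andP[r1 r2] s0.
  nra.
have := normc_Im (u - z); have := normc_Re (u - z).
rewrite cReD cReN cImD cImN; move: z1 z2 nz uz; rewrite /cone /=.
move: (normc (u - z)) (normc z) => A B.
move: (complex.Re z) (complex.Im z) (complex.Re u) (complex.Im u) => zr zi ur ui.
rewrite !ler_norml ltr_norml => z1 /andP[z2 z3] h1 h2 /andP[h3 h4] /andP[h5 h6].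
rewrite ltr_norml; split; last (apply/andP; split); lra.
Qed.

Lemma wide_cone_ball (Y : R) z u : 0 < Y -> cone 1 (2 * Y) z ->
  normc (u - z) <= 8^-1 * normc z -> wide_cone Y u.
Proof. by move=> Y0 zY /(cone_ball Y0 zY)[u1 /ltW u2]. Qed.

(* The existence half of the free Levy-Khintchine theorem: [1 / z] is the limit along
   discrete laws of their Cauchy transforms at [z + V z]. *)
Theorem free_levy_khintchine_exists : exists (nu : probability R R) (Y : R), 0 < Y /\
  forall z, cone 1 Y z -> Defs.cauchy nu (z + kh_transform a m idfun z) = z^-1.
Proof.
have [h [mh hle hr hcvg]] := simple_approximation R.
(* If |F - z| <= |z| / 8, the next distance is at most (1 + 9/8) |z| / 32 < |z| / 8, so the orbit
   stays in the ball; and 1/32 is below the ratio 1/2 of [half_recursion_cvg0]. *)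
have e32 : (0 : R) < 32^-1 by rewrite invr_gt0.
have [Y [Y1 hY]] := kh_transform_small a m e32.
have Y0 : 0 < Y by exact: lt_le_trans ltr01 Y1.
pose V := kh_transform a m idfun.
have mid : measurable_fun setT (idfun : R -> R) by exact: measurable_id.
have [V1 V2] := hY idfun mid (fun x => lexx _).
have orb := fixpoint_orbit_dF mh hr.
have /choice[bs hbs] : forall k, exists bs : R * seq (R * R), weights_ge0 bs.2 /\
    forall w, 0 < complex.Im w -> fixpoint_orbit h w k = dF bs.1 bs.2 w.
  by move=> k; have [b [s hs]] := orb k; exists (b, s).
have [l hl] := choice (fun k => inv_linear_sub_dcauchy (bs k).1 (proj1 (hbs k))).
have cone_wide z : cone 1 (2 * Y) z -> wide_cone Y z.
  by move=> zY; apply: (wide_cone_ball Y0 zY); rewrite subrr normc0 mulr_ge0 ?normc_ge0.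
have wide_Im z : wide_cone Y z -> 0 < complex.Im z.
  by move=> [zY _]; exact: lt_trans zY.
have Vz z : cone 1 (2 * Y) z -> normc (V z) <= 32^-1 * normc z.
  by move=> zY; apply: V1; exact: cone_wide.
have wz z : cone 1 (2 * Y) z -> wide_cone Y (z + V z).
  move=> zY; apply: (wide_cone_ball Y0 zY); rewrite addrAC subrr add0r.
  by rewrite (le_trans (Vz _ zY)) //; have := normc_ge0 z; lra.
have lim z : cone 1 (2 * Y) z ->
    normc (fixpoint_orbit h (z + V z) k - z) @[k --> \oo] --> (0 : R).
  move=> zY; set F := fixpoint_orbit h (z + V z).
  have FB k : normc (F k - z) <= 8^-1 * normc z.
    elim: k => [|k IH].
      rewrite /F /= addrAC subrr add0r.
      by rewrite (le_trans (Vz _ zY)) //; have := normc_ge0 z; lra.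
    have Fw := wide_cone_ball Y0 zY IH.
    have [W1 _] := hY _ (mh k) (hle k).
    rewrite /F /= -/(F k) addrAC [_ + V z]addrC addrK.
    rewrite (le_trans (normcB _ _)) //.
    have := W1 _ Fw; have := Vz _ zY.
    have := normc_sub_ge (F k) z; have := normc_ge0 z; lra.
  pose d k := normc (V z - kh_transform a m (h k) z).
  apply: (@half_recursion_cvg0 _ d) => [k||k]; first exact: normc_ge0.
    have -> : d = fun k => normc (kh_transform a m (h k) z - kh_transform a m idfun z).
      by apply/funext => k; rewrite /d normcBC.
    exact: kh_transform_cvg (wide_Im _ (cone_wide _ zY)).
  have Fw := wide_cone_ball Y0 zY (FB k).
  have [_ W2] := hY _ (mh k) (hle k).
  rewrite /F /= -/(F k) addrAC [_ + V z]addrC addrK.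
  (* The new error is the approximation error of V at z, which tends to 0, plus an increment of the
     k-th transform, contracted by 1/32. *)
  have -> : V z - kh_transform a m (h k) (F k) = (V z - kh_transform a m (h k) z) +
      (kh_transform a m (h k) z - kh_transform a m (h k) (F k)).
    by rewrite addrA subrK.
  rewrite (le_trans (le_normcD _ _)) // lerD2l.
  rewrite (le_trans (W2 _ _ (cone_wide _ zY) Fw)) // normcBC.
  by have := normc_ge0 (F k - z); lra.
pose W w x := exists z, [/\ cone 1 (2 * Y) z, w = z + V z & x = z^-1].
have [nu hnu] : exists nu : probability R R, forall w x, W w x -> Defs.cauchy nu w = x.
  apply: (@discrete_probability_limit _ l W).
  - by move=> k; case: (hl k).
  - by move=> k; case: (hl k).
  - move=> w x [z [zY -> ->]]; have w0 := wide_Im _ (wz _ zY); split => //.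
    have z0 : z != 0.
      by apply: contraTneq (wide_Im _ (cone_wide _ zY)) => ->; rewrite ltxx.
    have nz0 : 0 < normc z by rewrite normc_gt0.
    have e k : dcauchy (l k) (z + V z) = (fixpoint_orbit h (z + V z) k)^-1.
      by have [_ _ <- //] := hl k; have [_ ->] := hbs k.
    have hK : (complex.Im (z + V z))^-1 * (normc z)^-1 *
        normc (fixpoint_orbit h (z + V z) k - z) @[k --> \oo] --> (0 : R).
      rewrite -[X in _ --> X](mulr0 ((complex.Im (z + V z))^-1 * (normc z)^-1)).
      by apply: cvgMr; exact: lim.
    apply: (squeeze_cvgr _ (cvg_cst 0) hK); apply: nearW => k.
    rewrite normc_ge0 e /=; set F := fixpoint_orbit _ _ _.
    have FI : complex.Im (z + V z) <= complex.Im F.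
      by rewrite /F; have [s0 ->] := hbs k; rewrite // Im_dF.
    have F0 : F != 0.
      by apply: contraTneq (lt_le_trans w0 FI) => ->; rewrite ltxx.
    have -> : F^-1 - z^-1 = F^-1 * z^-1 * (z - F).
      rewrite mulrBr mulfVK // mulrAC mulVf // mul1r; ring.
    rewrite normcM normcM !normcV (normcBC z) ler_wpM2r ?normc_ge0 //.
    rewrite ler_wpM2r ?invr_ge0 ?normc_ge0 // lef_pV2 ?posrE ?normc_gt0 //.
    by rewrite (le_trans FI) // (le_trans (ler_norm _)) // normc_Im.
  - move=> e e0.
    have e20 : 0 < e / 2 by rewrite divr_gt0.
    have [Y' [Y'1 hY']] := kh_transform_small a m e20.
    have [V1' _] := hY' idfun mid (fun x => lexx _).
    (* Tightness is read at z = iy, high enough for both cones: |V z| <= (e / 2) y gives Im (z + V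
       z) / |z| >= 1 - e / 2. *)
    pose y := 2 * Y + Y'.
    have y0 : 0 < y by rewrite /y; lra.
    pose z : R[i] := 0 +i* y.
    have nz : normc z = y by rewrite /= expr0n /= add0r sqrtr_sqr ger0_norm // ltW.
    have zY : cone 1 (2 * Y) z.
      by split; rewrite /= ?normr0 ?mul1r // /y; lra.
    have zY' : wide_cone Y' z.
      by split; rewrite /= ?normr0 ?mulr_ge0 ?(ltW y0) // /y; lra.
    exists (z + V z), z^-1; split; first by exists z.
    rewrite normcV nz ltr_pdivlMr //.
    have := V1' _ zY'; rewrite nz => h1.
    have := le_trans (normc_Im (V z)) h1; rewrite ler_norml => /andP[h2 _].
    have ey : 0 < e * y by rewrite mulr_gt0.
    rewrite cImD; move: h2; move: (complex.Im (V z)) => iv h2.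
    by rewrite [complex.Im z]/=; lra.
exists nu, (2 * Y); split; first by rewrite mulr_gt0.
by move=> z zY; apply: hnu; exists z.
Qed.

End FreeLevyKhintchine.

Section FiniteScale.
Context d (T : measurableType d) (R : realType).
Variables (k : {nonneg R}) (m : {finite_measure set T -> \bar R}).

(** A named copy of [mscale] to which the finite-measure structure is attached. *)
Definition finite_mscale : set T -> \bar R := mscale k m.

HB.instance Definition _ := Measure.on finite_mscale.

Let finite_mscale_fin : fin_num_fun finite_mscale.
Proof.
by move=> A mA; rewrite /finite_mscale /mscale fin_numM // fin_num_measure.
Qed.

HB.instance Definition _ := Measure_isFinite.Build _ _ _ finite_mscale finite_mscale_fin.

Lemma Rintegral_mscale (f : T -> R) : m.-integrable setT (EFin \o f) ->
  Rintegral finite_mscale setT f = k%:num * Rintegral m setT f.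
Proof.
move=> If; have mf := measurable_int m If.
have fp := integral_funepos_lt_pinfty measurableT If.
have fn := integral_funeneg_lt_pinfty measurableT If.
have fp' : (\int[m]_x (EFin \o f)^\+ x)%E \is a fin_num.
  by rewrite ge0_fin_numE // integral_ge0.
have fn' : (\int[m]_x (EFin \o f)^\- x)%E \is a fin_num.
  by rewrite ge0_fin_numE // integral_ge0.
rewrite /Rintegral integralE [in RHS]integralE.
rewrite !ge0_integral_mscale //; last 2 first.
- exact: measurable_funeneg.
- exact: measurable_funepos.
have h (A B : \bar R) : A \is a fin_num -> B \is a fin_num ->
    fine (k%:num%:E * A - k%:num%:E * B)%E = k%:num * fine (A - B)%E.
  by move=> /fineK <- /fineK <-; rewrite -!EFinM -!EFinB /= mulrBr.
exact: h fp' fn'.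
Qed.

Lemma cint_mscale (f : T -> R[i]) : cintegrable m setT f ->
  cint finite_mscale setT f = (k%:num)%:C * cint m setT f.
Proof.
move=> [f1 f2]; apply: complex_eq; rewrite ?cReM ?cImM /= mul0r ?subr0 ?addr0;
  exact: Rintegral_mscale.
Qed.

End FiniteScale.

Section ComplexDerivative.
Variable R : realType.
Implicit Types (z h : R[i]).

(** Real tolerances and no quotient: h = 0 is allowed, and remainders are estimated by [normc]
    alone. *)
Definition cderiv (f : R[i] -> R[i]) z (d : R[i]) := forall e : R, 0 < e ->
  exists2 r : R, 0 < r &
    forall h, normc h < r -> normc (f (z + h) - f z - d * h) <= e * normc h.

Lemma derivable_cderiv (f : R[i] -> R[i]) z :
  derivable (f : R[i]^o -> R[i]^o) z 1 <-> exists d, cderiv f z d.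
Proof.
split=> [/cvg_ex[d /cvgrPdist_lt hd]|[d hd]].
  exists d => e e0; have e0C : 0 < e%:C by rewrite ltcR.
  have /nbhs_ballP[r r0 hr] := hd _ e0C.
  (* In the order of [R[i]] a positive element is real, so the radius is the image of its real
     part. *)
  have rE : r = (complex.Re r)%:C.
    by move: r0; rewrite /= ltcE => /andP[/eqP/= ir _]; apply: complex_eq.
  exists (complex.Re r); first by rewrite -ltcR -rE.
  move=> h hr'; have [->|h0] := eqVneq h 0.
    by rewrite addr0 subrr mulr0 subr0 !normc0 mulr0.
  have := hr h; rewrite /ball /= sub0r normrN.
  rewrite rE normE ltcR => /(_ hr' h0).
  rewrite normE ltcR => /ltW hle.
  rewrite -ler_pdivrMr ?normc_gt0 //.
  rewrite (le_trans _ hle) // -normcV -normcM normcBC.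
  rewrite le_eqVlt; apply/orP; left; apply/eqP; congr normc.
  rewrite /GRing.scale /= mulr1 [h + z]addrC mulrBl -[d * h / h]mulrA divff // mulr1.
  by rewrite mulrC.
apply/cvg_ex; exists d; apply/cvgrPdist_lt => e e0.
have eE : e = (complex.Re e)%:C.
  by move: e0; rewrite ltcE => /andP[/eqP/= ir _]; apply: complex_eq.
have e0' : 0 < complex.Re e by rewrite -ltcR -eE.
have e20 : 0 < complex.Re e / 2 by rewrite divr_gt0.
have [r r0 hr] := hd _ e20.
apply/nbhs_ballP; exists r%:C; first by rewrite /= ltcR.
move=> h; rewrite /ball /= sub0r normrN normE ltcR => /hr hh h0.
rewrite eE normE ltcR.
have : normc (f (z + h) - f z - d * h) / normc h <= complex.Re e / 2.
  by rewrite ler_pdivrMr ?normc_gt0.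
move=> hle; have hlt : normc (f (z + h) - f z - d * h) / normc h < complex.Re e.
  by rewrite (le_lt_trans hle) // ltr_pdivrMr // ltr_pMr // ltr1n.
apply: le_lt_trans hlt; rewrite -normcV -normcM normcBC le_eqVlt; apply/orP; left.
apply/eqP; congr normc.
rewrite /GRing.scale /= mulr1 [h + z]addrC mulrBl -[d * h / h]mulrA divff // mulr1.
by rewrite mulrC.
Qed.

End ComplexDerivative.

Section KhintchineTransformMore.
Variable R : realType.
Implicit Types (u v w z : R[i]).

Lemma normc_x_fraction_le z (x : R) : 0 < complex.Im z ->
  normc (x%:C / (z - x%:C)) <= 1 + normc z / complex.Im z.
Proof.
move=> z0; have zx := upper_subR_neq0 x z0.
have -> : x%:C / (z - x%:C) = z / (z - x%:C) - 1.
  by apply: (mulIf zx); rewrite mulrBl !mulfVK // mul1r; ring.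
rewrite (le_trans (normcB _ _)) // normc1 addrC lerD2l normcM ler_wpM2l ?normc_ge0 //.
exact: normc_fraction_le.
Qed.

(** The first-order remainder of the kernel is exactly -D x h^2 / (z + h - x), with D its derivative
    in z; it is O(|h|^2) uniformly in x and can be integrated against the finite measure. *)
Lemma cderiv_kh_transform (a : R) (m : {finite_measure set R -> \bar R}) z :
  0 < complex.Im z -> exists d, cderiv (kh_transform a m idfun) z d.
Proof.
move=> z0; pose D x : R[i] := - ((1 + x%:C ^+ 2) * ((z - x%:C)^-1 * (z - x%:C)^-1)).
(* The two terms bound 1 / (z - x)^2 and (x / (z - x))^2, whose sum is -D x. *)
pose C := (complex.Im z)^-1 ^+ 2 + (1 + normc z / complex.Im z) ^+ 2.
have Iz0 : 0 <= (complex.Im z)^-1 by rewrite invr_ge0 ltW.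
have DC x : normc (D x) <= C.
  rewrite normcN mulrDl mul1r (le_trans (le_normcD _ _)) // lerD //.
    by rewrite normcM expr2 ler_pM ?normc_ge0 // normc_fraction_le.
  have -> : x%:C ^+ 2 * ((z - x%:C)^-1 / (z - x%:C)) = (x%:C / (z - x%:C)) ^+ 2 by ring.
  rewrite normcX lerXn2r ?nnegrE ?normc_ge0 //.
    by rewrite addr_ge0 ?mulr_ge0 ?normc_ge0.
  exact: normc_x_fraction_le.
have mD : cmeasurable setT D.
  apply: cmeasurableN; apply: cmeasurableM.
    apply: cmeasurableD; first exact: cmeasurable_cst.
    under eq_fun do rewrite -rmorphXn; apply: cmeasurableR; exact: measurable_funX.
  by apply: cmeasurableM; exact: (cmeasurable_fraction z (@measurable_id _ _ _)).
have iD := cintegrable_bdd m mD DC.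
have mid : measurable_fun setT (idfun : R -> R) by exact: measurable_id.
exists (cint m setT D) => e e0.
pose K := C * (2 * (complex.Im z)^-1) * fine (m setT).
have K0 : 0 <= K.
  rewrite !mulr_ge0 // ?fine_ge0 //.
  by rewrite (le_trans (normc_ge0 _) (DC 0)).
exists (Num.min (complex.Im z / 2) (e / (K + 1))).
  by rewrite lt_min !divr_gt0 // ltr_wpDl.
move=> h; rewrite lt_min => /andP[h1 h2].
have zh : complex.Im z / 2 <= complex.Im (z + h).
  have := normc_Im h; rewrite ler_norml cImD => /andP[h3 _]; lra.
have zh0 : 0 < complex.Im (z + h) by rewrite (lt_le_trans _ zh) // divr_gt0.
rewrite /kh_transform opprD addrACA subrr add0r.
rewrite -cintB //; try exact: cintegrable_kh_kernel.
rewrite mulrC -cintZ // -cintB //; last 2 first.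
- by apply: cintegrableB => //; exact: cintegrable_kh_kernel.
- exact: cintegrableZ.
have bd x : normc (kh_kernel (z + h) (idfun x) - kh_kernel z (idfun x) - h * D x) <=
    C * (2 * (complex.Im z)^-1) * normc h ^+ 2.
  have zx := upper_subR_neq0 x z0; have zhx := upper_subR_neq0 x zh0.
  have -> : kh_kernel (z + h) (idfun x) - kh_kernel z (idfun x) - h * D x =
      - D x * (z + h - x%:C)^-1 * h ^+ 2.
    rewrite kh_kernelB // /D; apply: (mulIf zhx).
    rewrite [RHS](_ : _ = (1 + x%:C ^+ 2) * ((z - x%:C)^-1 / (z - x%:C)) * ((z + h - x%:C)^-1 * (z + h - x%:C)) * h ^+ 2); last by ring.
    rewrite [LHS](_ : _ = (1 + x%:C ^+ 2) * (z - x%:C)^-1 * ((z + h - x%:C)^-1 * (z + h - x%:C)) * (- h) + h * (1 + x%:C ^+ 2) * (z - x%:C)^-1 * ((z - x%:C)^-1 * (z - x%:C)) + h ^+ 2 * (1 + x%:C ^+ 2) * (z - x%:C)^-1 * (z - x%:C)^-1); last by ring.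
    by rewrite !mulVf // !mulr1; ring.
  rewrite normcM normcX ler_wpM2r ?exprn_ge0 ?normc_ge0 // normcM normcN.
  rewrite ler_pM ?normc_ge0 // (le_trans (normc_fraction_le _ zh0)) //.
  by rewrite -[leRHS]invrK invfM invrK lef_pV2 ?posrE ?mulr_gt0 ?invr_gt0 // mulrC.
apply: (@le_trans _ _ (C * (2 * (complex.Im z)^-1) * normc h ^+ 2 * fine (m setT))).
  apply: normc_cint_bdd => //; apply: cmeasurableB.
    by apply: cmeasurableB; exact: cmeasurable_kh_kernel.
  by apply: cmeasurableM => //; exact: cmeasurable_cst.
rewrite [leLHS](_ : _ = K * normc h * normc h); last by rewrite /K; ring.
rewrite ler_wpM2r ?normc_ge0 //.
move: h2; rewrite ltr_pdivlMr ?ltr_wpDl // => h2.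
by have := normc_ge0 h; lra.
Qed.

(* [w1 w2 / ((w1 - x) (w2 - x))] tends to [1] on a Stolz cone at infinity, so its
   integral, which is the difference quotient of the Cauchy transform up to a
   nonzero factor, does not vanish. *)
Lemma Ftr_injective_cone (nu : probability R R) : exists2 Y : R, 0 < Y &
  forall w1 w2, wide_cone Y w1 -> wide_cone Y w2 -> Ftr nu w1 = Ftr nu w2 -> w1 = w2.
Proof.
(* w1 w2 P - 1 has the form X1 X2 + X1 + X2 with |Xi| at most 3 times the weight, hence at most 9 +
   3 + 3 times the weight. Its integral is then below 1 in modulus, which is impossible if P
   integrates to 0. *)
have e15 : 0 < 15^-1 :> R by rewrite invr_gt0.
have /cvgrPdist_lt/(_ _ e15)[N _ hN] := @Rintegral_kh_weight_cvg0 R nu.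
have := hN N (leqnn N); rewrite /= sub0r normrN => /(le_lt_trans (ler_norm _)).
set Y : R := N.+1%:R => hY.
have Y1 : 1 <= Y by rewrite ler1n.
have Y0 : 0 < Y by exact: lt_le_trans ltr01 Y1.
exists Y => // w1 w2 w1Y w2Y /invr_inj G12.
have w10 : 0 < complex.Im w1 by case: w1Y => + _; exact: lt_trans.
have w20 : 0 < complex.Im w2 by case: w2Y => + _; exact: lt_trans.
have mf w : cmeasurable setT (fun x : R => (w - x%:C)^-1).
  exact: (cmeasurable_fraction w (@measurable_id _ _ _)).
have If w : 0 < complex.Im w -> cintegrable nu setT (fun x : R => (w - x%:C)^-1).
  move=> w0; apply: (@cintegrable_bdd _ _ _ nu _ (complex.Im w)^-1) => // x.
  exact: normc_fraction_le.
pose P x : R[i] := (w1 - x%:C)^-1 * (w2 - x%:C)^-1.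
have mP : cmeasurable setT P by exact: cmeasurableM.
have IP : cintegrable nu setT P.
  apply: (@cintegrable_bdd _ _ _ nu _ ((complex.Im w1)^-1 * (complex.Im w2)^-1)) => // x.
  by rewrite normcM ler_pM ?normc_ge0 // normc_fraction_le.
have E : (w2 - w1) * cint nu setT P = 0.
  rewrite -cintZ //.
  rewrite (@eq_cint _ _ _ _ _ _ (fun x : R => (w1 - x%:C)^-1 - (w2 - x%:C)^-1)).
    rewrite cintB; [|by []|exact: If|exact: If].
    by move: G12; rewrite /Defs.cauchy => ->; rewrite subrr.
  move=> x _; have x1 := upper_subR_neq0 x w10; have x2 := upper_subR_neq0 x w20.
  apply: (mulIf x1); apply: (mulIf x2); rewrite /P.
  rewrite [LHS](_ : _ = (w2 - w1) * ((w1 - x%:C)^-1 * (w1 - x%:C)) * ((w2 - x%:C)^-1 * (w2 - x%:C))); last by ring.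
  rewrite [RHS](_ : _ = ((w1 - x%:C)^-1 * (w1 - x%:C)) * (w2 - x%:C) - ((w2 - x%:C)^-1 * (w2 - x%:C)) * (w1 - x%:C)); last by ring.
  by rewrite !mulVf //; ring.
have [/eqP|P0] := eqVneq (cint nu setT P) 0; last first.
  by move/eqP: E; rewrite mulf_eq0 (negPf P0) orbF subr_eq0 => /eqP.
move=> /eqP P0; exfalso.
have kh0 x : 0 <= kh_weight Y x by exact: sqrtr_ge0.
have xle w x : wide_cone Y w -> normc (x%:C / (w - x%:C)) <= 3 * kh_weight Y x.
  move=> wY; rewrite normcM normcR (le_trans _ (wide_cone_inv_le x Y0 wY)) //.
  rewrite ler_wpM2r ?normc_ge0 // -sqrtr_sqr ler_wsqrtr // lerDr //.
have bd x : normc (w1 * w2 * P x - 1) <= 15 * kh_weight Y x.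
  have x1 := upper_subR_neq0 x w10; have x2 := upper_subR_neq0 x w20.
  have -> : w1 * w2 * P x - 1 = (x%:C / (w1 - x%:C)) * (x%:C / (w2 - x%:C)) +
      (x%:C / (w1 - x%:C) + x%:C / (w2 - x%:C)).
    apply: (mulIf x1); apply: (mulIf x2); rewrite /P.
    rewrite [LHS](_ : _ = w1 * w2 * ((w1 - x%:C)^-1 * (w1 - x%:C)) * ((w2 - x%:C)^-1 * (w2 - x%:C)) - (w1 - x%:C) * (w2 - x%:C)); last by ring.
    rewrite [RHS](_ : _ = x%:C ^+ 2 * ((w1 - x%:C)^-1 * (w1 - x%:C)) * ((w2 - x%:C)^-1 * (w2 - x%:C)) + x%:C * ((w1 - x%:C)^-1 * (w1 - x%:C)) * (w2 - x%:C) + x%:C * ((w2 - x%:C)^-1 * (w2 - x%:C)) * (w1 - x%:C)); last by ring.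
    by rewrite !mulVf //; ring.
  have s := le_normcD (x%:C / (w1 - x%:C)) (x%:C / (w2 - x%:C)).
  rewrite (le_trans (le_normcD _ _)) // normcM.
  move: s (xle _ x w1Y) (xle _ x w2Y) (kh_weight_le1 x Y1) (kh0 x).
  have := normc_ge0 (x%:C / (w1 - x%:C)); have := normc_ge0 (x%:C / (w2 - x%:C)).
  move: (normc (_ + _)) (normc (x%:C / (w1 - x%:C))) (normc (x%:C / (w2 - x%:C))).
  move: (kh_weight Y x) => k s n1 n2 n20 n10 sle h1 h2 k1 k0; nra.
have ik : nu.-integrable setT (EFin \o (fun x => 15 * kh_weight Y x)).
  exact: (integrableZl measurableT 15 (integrable_kh_weight nu Y1)).
have I1 : cintegrable nu setT (cst (1 : R[i])).
  apply: (@cintegrable_bdd _ _ _ nu _ 1); first exact: cmeasurable_cst.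
  by move=> x; rewrite normc1.
have : normc (cint nu setT (fun x => w1 * w2 * P x - 1)) <= 15 * Rintegral nu setT (kh_weight Y).
  rewrite -RintegralZl //; last exact: integrable_kh_weight.
  apply: normc_cint_le => //; apply: cintegrableB => //; exact: cintegrableZ.
rewrite cintB //; last exact: cintegrableZ.
have c1 : cint nu setT (cst (1 : R[i])) = 1.
  by rewrite cint_cst // mul1r (_ : fine _ = 1) // [LHS](congr1 fine (probability_setT nu)).
rewrite cintZ // P0 mulr0 sub0r normcN c1 normc1.
lra.
Qed.

Variables (a : R) (m : {finite_measure set R -> \bar R}).
Local Notation V := (kh_transform a m idfun).

Lemma kh_transform_cone (Y : R) : 0 < Y -> exists2 Y' : R, Y <= Y' &
  forall z, cone 1 Y' z -> cone 2 Y (z + V z).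
Proof.
move=> Y0; have e8 : 0 < 8^-1 :> R by rewrite invr_gt0.
have mid : measurable_fun setT (idfun : R -> R) by exact: measurable_id.
have [Z [Z1 hZ]] := kh_transform_small a m e8.
have [V1 _] := hZ idfun mid (fun x => lexx _).
exists (2 * (Y + Z)); first by lra.
move=> z [z1 z2]; rewrite mul1r in z2.
have z0 : 0 < complex.Im z by lra.
apply: (@cone_ball R Y z _ Y0).
  by split; [lra|rewrite mul1r].
rewrite addrAC subrr add0r; apply: V1; split; first by lra.
by rewrite (le_trans (ltW z2)) //; lra.
Qed.

Lemma free_levy_khintchine_voiculescu : exists nu : probability R R,
  voiculescu_ext nu V.
Proof.
have [nu [Y [Y0 hnu]]] := free_levy_khintchine_exists a m.
exists nu; split; first by move=> z z0; apply/derivable_cderiv; exact: cderiv_kh_transform.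
have [Z Z0 hZ] := Ftr_injective_cone nu.
have [Y' YY' hY'] := kh_transform_cone Z0.
exists 1, (Y + Y'), 2, Z; split.
- by rewrite ltr01 addr_gt0 // (lt_le_trans Z0).
- by rewrite Z0 ltr0n.
- by move=> w1 w2 [w11 w12] [w21 w22]; apply: hZ; split => //; exact: ltW.
move=> z [z1 z2]; have Y'0 : 0 < Y' by exact: lt_le_trans YY'.
split; first by apply: hY'; split => //; lra.
by rewrite /Ftr hnu ?invrK //; split => //; lra.
Qed.

End KhintchineTransformMore.

Lemma free_inf_div_levy_khintchine (R : realType) (a : R)
    (m : {finite_measure set R -> \bar R}) (nu : probability R R) :
  voiculescu_on_cone nu (kh_transform a m idfun) -> free_inf_div nu.
Proof.
move=> hnu n n0.
have n0' : 0 < n%:R :> R by rewrite ltr0n.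
have ni : 0 <= n%:R^-1 :> R by rewrite invr_ge0 ltW.
pose mn : {finite_measure set R -> \bar R} := finite_mscale (NngNum ni) m.
have [nun [_ hnun]] := free_levy_khintchine_voiculescu (n%:R^-1 * a) mn.
exists nun, (kh_transform a m idfun), (kh_transform (n%:R^-1 * a) mn idfun); split => //.
exists 1, 1; split => // z [z1 _].
have z0 : 0 < complex.Im z by exact: lt_trans z1.
rewrite /kh_transform cint_mscale; last first.
  by apply: cintegrable_kh_kernel => //; exact: measurable_id.
rewrite rmorphM /= -mulrDr mulrA -[LHS]mul1r; congr (_ * _).
rewrite -(rmorph_nat (real_complex R)) -rmorphM /= mulfV ?rmorph1 //.
by rewrite gt_eqF.
Qed.

(** * Laplace transforms of the Khintchine kernel *)

Section FubiniDominated.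
Context d1 d2 (T1 : measurableType d1) (T2 : measurableType d2) (R : realType).
Variables (m1 : {sigma_finite_measure set T1 -> \bar R}) (m2 : {finite_measure set T2 -> \bar R}).

(** Domination by a function of the first variable suffices because m2 is finite. The indicator of D
    reduces to Fubini on the whole product. *)
Lemma Rintegral_fubini_dominated (D : set T1) (f : T1 * T2 -> R) (g : T1 -> R) :
  measurable D -> measurable_fun setT f ->
  m1.-integrable D (EFin \o g) -> (forall x y, D x -> `|f (x, y)| <= g x) ->
  m1.-integrable D (EFin \o (fun x => Rintegral m2 setT (fun y => f (x, y)))) /\
  Rintegral m1 D (fun x => Rintegral m2 setT (fun y => f (x, y))) =
  Rintegral m2 setT (fun y => Rintegral m1 D (fun x => f (x, y))).
Proof.
move=> mD mf ig fg.
pose f' p : R := f p * \1_D p.1.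
have mf' : measurable_fun setT f'.
  apply: measurable_funM => //.
  have mi : measurable_fun setT (\1_D : T1 -> R) by exact: measurable_indic.
  exact: (measurableT_comp mi measurable_fst).
have f'E x y : f' (x, y) = ((fun x => f (x, y)) \_ D) x.
  by rewrite /f' patchE indicE; case: (x \in D); rewrite ?mulr1 ?mulr0.
have g'P x y : `|f' (x, y)| <= (g \_ D) x.
  rewrite f'E !patchE; case: ifPn => xD; last by rewrite normr0.
  by apply: fg; exact: set_mem.
have ig' : m1.-integrable setT (EFin \o (g \_ D)).
  by rewrite -restrict_EFin; apply/(integrable_mkcond _ mD).
have if1 x : m2.-integrable setT (fun y => (f' (x, y))%:E).
  apply: (@le_integrable _ _ _ m2 setT measurableT _ (EFin \o cst ((g \_ D) x))) => //.
  - apply/measurable_EFinP; apply: (measurableT_comp mf').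
    exact: pair1_measurable.
  - by move=> y _; rewrite /= lee_fin (le_trans (g'P x y)) // ler_norm.
  - exact: integrable_cst_fin.
have mg' : measurable_fun setT (EFin \o (g \_ D)) := measurable_int _ ig'.
have ifp : (m1 \x m2)%E.-integrable setT (EFin \o f').
  apply/integrable12ltyP; first exact/measurable_EFinP.
  have m2T := fin_num_measure m2 _ measurableT.
  apply: (@le_lt_trans _ _ (\int[m1]_x (m2 setT * `|((g \_ D) x)%:E|))%E).
    apply: ge0_le_integral => //.
    - by move=> x _; apply: integral_ge0.
    - apply: (measurable_fun_fubini_tonelli_F (abse \o (EFin \o f'))) => //=.
        by apply: measurableT_comp => //; exact/measurable_EFinP.
    - by apply: emeasurable_funM => //; exact: measurableT_comp.
    move=> x _; rewrite muleC -integral_cst //.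
    apply: ge0_le_integral => //.
    - by apply: measurableT_comp => //; case/integrableP: (if1 x).
    - by move=> y _; rewrite /= lee_fin (le_trans (g'P x y)) // ler_norm.
  rewrite ge0_integralZl //; last exact: measurableT_comp.
  apply: lte_mul_pinfty => //.
  by case/integrableP: ig'.
have innerE x : (fubini_F m2 (EFin \o f') x = (Rintegral m2 setT (fun y => f' (x, y)))%:E)%E.
  by rewrite /Rintegral fineK //; apply: integrable_fin_num.
have innerD : (fun x => Rintegral m2 setT (fun y => f' (x, y))) =
    ((fun x => Rintegral m2 setT (fun y => f (x, y))) \_ D).
  apply/funext => x; rewrite patchE; case: ifPn => xD.
    by apply: eq_Rintegral => y _; rewrite f'E patchE xD.
  rewrite (_ : (fun y => f' (x, y)) = cst 0).
    by rewrite /Rintegral integral0.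
  by apply/funext => y; rewrite f'E patchE (negbTE xD).
split.
  apply/(integrable_mkcond _ mD); rewrite restrict_EFin -innerD.
  have := integrable_fubini_F ifp; congr (_.-integrable _ _).
  by apply/funext => x; rewrite innerE.
have if2 y : m1.-integrable setT (fun x => (f' (x, y))%:E).
  apply: (@le_integrable _ _ _ m1 setT measurableT _ (EFin \o (g \_ D))) => //.
  - by apply/measurable_EFinP; apply: (measurableT_comp mf'); exact: pair2_measurable.
  - by move=> x _; rewrite /= lee_fin (le_trans (g'P x y)) // ler_norm.
rewrite Rintegral_mkcond -innerD.
under [RHS]eq_Rintegral => y _ do rewrite Rintegral_mkcond.
rewrite [LHS]/Rintegral; under eq_integral => x _ do rewrite -innerE.
rewrite Fubini //; congr fine; apply: eq_integral => y _.
have -> : ((fun x => f (x, y)) \_ D) = (fun x => f' (x, y)).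
  by apply/funext => x; rewrite f'E.
by rewrite /Rintegral fineK //; apply: integrable_fin_num.
Qed.

End FubiniDominated.

(** * Laplace integrals from explicit primitives *)

Section LaplaceIntegrals.
Variable R : realType.
Implicit Types (s x y t : R).
Local Notation leb := (@lebesgue_measure R).

Lemma set_ge0_itv : [set s : R | 0 <= s] = `[0, +oo[%classic.
Proof. by apply/seteqP; split => s /=; rewrite in_itv /= andbT. Qed.

Lemma is_derive_expRN t s : is_derive s 1 (fun s => expR (- (t * s))) (- (t * expR (- (t * s)))).
Proof.
have h : is_derive s 1 (fun s => - (t * s)) (- t).
  by apply: is_derive_eq; rewrite /GRing.scale /=; ring.
have := @is_derive1_comp _ expR (fun s => - (t * s)) s _ _ (is_derive_expR _) h.
by rewrite mulrN [_ * t]mulrC.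
Qed.

Lemma continuous_derive1 (f df : R -> R) : (forall s, is_derive s 1 f (df s)) ->
  continuous f.
Proof.
by move=> fd s; apply/differentiable_continuous/derivable1_diffP; case: (fd s).
Qed.

Lemma continuous_expRN t : continuous (fun s => expR (- (t * s))).
Proof. exact: continuous_derive1 (is_derive_expRN t). Qed.

(** The cubic term of the exponential series, exp (ts) >= (ts)^3 / 6, beats the quadratic growth;
    for s >= 1 the quotient is at most 12 C / (t^3 s). *)
Lemma expR_decay t (P : R -> R) (C : R) : 0 < t ->
  (forall s, 0 <= s -> `|P s| <= C * (1 + s ^+ 2)) ->
  P s * expR (- (t * s)) @[s --> +oo] --> (0 : R).
Proof.
move=> t0 PC; have C0 : 0 <= C.
  by have := PC 0 (lexx 0); rewrite expr0n /= addr0 mulr1; exact: le_trans.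
pose K := C * 12 / t ^+ 3.
have K0 : 0 <= K by rewrite divr_ge0 ?mulr_ge0 ?exprn_ge0 // ltW.
apply/cvgrPdist_lt => e e0; near=> s.
have s1 : 1 <= s by near: s; exact: nbhs_pinfty_ge.
have sK : K / e < s by near: s; apply: nbhs_pinfty_gt; rewrite num_real.
have s0 : 0 < s by exact: lt_le_trans s1.
rewrite sub0r normrN normrM [`|expR _|]gtr0_norm ?expR_gt0 // expRN.
have ts0 : 0 <= t * s by rewrite mulr_ge0 // ltW.
have := expR_ge1Dxn 2 ts0; rewrite (_ : 3`! = 6)%N // => ex.
have ex' : (t * s) ^+ 3 / 6 <= expR (t * s) by lra.
have ts3 : 0 < (t * s) ^+ 3 / 6 by rewrite divr_gt0 // exprn_gt0 // mulr_gt0.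
have ss : 1 + s ^+ 2 <= 2 * s ^+ 2.
  by have := exprn_ege1 2 s1; lra.
apply: (@le_lt_trans _ _ (C * (2 * s ^+ 2) / ((t * s) ^+ 3 / 6))).
  rewrite ler_pM ?invr_ge0 ?expR_ge0 //.
    by rewrite (le_trans (PC _ (ltW s0))) // ler_wpM2l.
  by rewrite lef_pV2 ?posrE ?expR_gt0.
have -> : C * (2 * s ^+ 2) / ((t * s) ^+ 3 / 6) = K / s.
  by rewrite /K; field; rewrite !gt_eqF.
by rewrite ltr_pdivrMr // mulrC -ltr_pdivrMr.
Unshelve. all: by end_near. Qed.

Lemma laplace_ge0 t (p P : R -> R) (C : R) : 0 < t ->
  (forall s, 0 <= s -> 0 <= p s) -> continuous p ->
  (forall s, is_derive s 1 (fun s => P s * expR (- (t * s))) (p s * expR (- (t * s)))) ->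
  (forall s, 0 <= s -> `|P s| <= C * (1 + s ^+ 2)) ->
  (\int[leb]_(s in [set s | (0 <= s)%R]) (p s * expR (- (t * s)))%:E)%E = (- P 0)%:E.
Proof.
move=> t0 p0 pc dP PC; rewrite set_ge0_itv.
have cF := continuous_derive1 dP.
rewrite (@ge0_continuous_FTC2y _ _ (fun s => P s * expR (- (t * s))) 0 0).
- by rewrite mulr0 oppr0 expR0 mulr1 sub0e.
- by move=> s s0; rewrite mulr_ge0 ?expR_ge0 // p0.
- apply: continuous_subspaceT => s; apply: cvgM; first exact: pc.
  exact: continuous_expRN.
- exact: expR_decay PC.
- by move=> s _; case: (dP s).
- by apply: cvg_at_right_filter; exact: cF.
- by move=> s _; rewrite derive1E; have [_ ->] := dP s.
Qed.

(** Polynomial factor of the primitive of (1 + s^2) exp (-ts) that vanishes at infinity, by repeated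
    integration by parts. *)
Definition laplace_weight t s : R := - (t^-1 + s ^+ 2 / t + 2 * s / t ^+ 2 + 2 / t ^+ 3).

Lemma laplace_weightE t s : 0 < t -> is_derive s 1
  (fun s => laplace_weight t s * expR (- (t * s))) ((1 + s ^+ 2) * expR (- (t * s))).
Proof.
move=> t0; rewrite /laplace_weight; apply: is_derive_eq.
rewrite /GRing.scale /= !(scaler0, mulr0, add0r, addr0, mulr1); field.
by rewrite gt_eqF.
Qed.

Lemma laplace_weight_le t : 0 < t -> exists2 C : R, 0 <= C &
  forall s, 0 <= s -> `|laplace_weight t s| <= C * (1 + s ^+ 2).
Proof.
move=> t0; have i1 : 0 <= t^-1 by rewrite invr_ge0 ltW.
have i2 : 0 <= t^-1 ^+ 2 by rewrite exprn_ge0.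
have i3 : 0 <= t^-1 ^+ 3 by rewrite exprn_ge0.
exists (t^-1 + t^-1 ^+ 2 + 2 * t^-1 ^+ 3); first by rewrite !addr_ge0 // mulr_ge0.
move=> s s0; rewrite /laplace_weight normrN -!exprVn ger0_norm; last first.
  by rewrite !addr_ge0 // mulr_ge0 ?mulr_ge0 // ?sqr_ge0.
have s2 : 2 * s <= 1 + s ^+ 2 by have := sqr_ge0 (s - 1); rewrite sqrrB; lra.
have a2 : 2 * s * t^-1 ^+ 2 <= (1 + s ^+ 2) * t^-1 ^+ 2 by rewrite ler_wpM2r.
have a3 : 0 <= s ^+ 2 * t^-1 ^+ 3 by rewrite mulr_ge0 ?sqr_ge0.
lra.
Qed.

Lemma integrable_laplace_weight t : 0 < t ->
  leb.-integrable [set s | 0 <= s] (EFin \o (fun s => (1 + s ^+ 2) * expR (- (t * s)))).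
Proof.
move=> t0; have [C _ wC] := laplace_weight_le t0.
have c1 : continuous (fun s : R => 1 + s ^+ 2).
  by move=> s; apply: cvgD; [exact: cvg_cst|exact: exprn_continuous].
have mD : measurable [set s : R | 0 <= s] by rewrite set_ge0_itv.
have p0 s : 0 <= 1 + s ^+ 2 by rewrite addr_ge0 ?sqr_ge0.
apply/integrableP; split.
  apply/measurable_EFinP; apply: measurable_funTS; apply: continuous_measurable_fun => s.
  apply: cvgM; first exact: c1.
  exact: continuous_expRN.
under eq_integral => s _ do rewrite /= ger0_norm ?mulr_ge0 ?expR_ge0 ?p0 //.
by rewrite (laplace_ge0 t0 (fun s _ => p0 s) c1 (fun s => laplace_weightE s t0) wC) ltry.
Qed.

(** Signed integrands reduce to [laplace_ge0]: C (1 + s^2) + p is nonnegative, and the known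
    integral of the weight is then subtracted. *)
Lemma laplace_integral t (p P : R -> R) (C C2 : R) : 0 < t ->
  continuous p -> (forall s, `|p s| <= C * (1 + s ^+ 2)) ->
  (forall s, is_derive s 1 (fun s => P s * expR (- (t * s))) (p s * expR (- (t * s)))) ->
  (forall s, 0 <= s -> `|P s| <= C2 * (1 + s ^+ 2)) ->
  leb.-integrable [set s | 0 <= s] (EFin \o (fun s => p s * expR (- (t * s)))) /\
  Rintegral leb [set s | 0 <= s] (fun s => p s * expR (- (t * s))) = - P 0.
Proof.
move=> t0 pc pC dP PC.
have mD : measurable ([set s | 0 <= s] : set (measurableTypeR R)) by rewrite set_ge0_itv.
have iw := integrable_laplace_weight t0; have [C' C'0 wC] := laplace_weight_le t0.
have C0 : 0 <= C.
  by have := pC 0; rewrite expr0n /= addr0 mulr1; exact: le_trans.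
have icw : leb.-integrable [set s | 0 <= s]
    (EFin \o (fun s => C * (1 + s ^+ 2) * expR (- (t * s)))).
  have := @integrableZl _ _ _ leb _ mD C _ iw; apply: eq_integrable => // s _.
  by rewrite /= -EFinM mulrA.
have ip : leb.-integrable [set s | 0 <= s] (EFin \o (fun s => p s * expR (- (t * s)))).
  apply: (le_integrable mD _ _ icw).
    apply/measurable_EFinP; apply: measurable_funTS; apply: continuous_measurable_fun => s.
    apply: cvgM; first exact: pc.
    exact: continuous_expRN.
  move=> s s0; rewrite /= lee_fin !normrM ler_wpM2r // (le_trans (pC s)) //.
  by rewrite -normrM ler_norm.
split=> //.
have c1 : continuous (fun s : R => 1 + s ^+ 2).
  by move=> s; apply: cvgD; [exact: cvg_cst|exact: exprn_continuous].
have E1 : Rintegral leb [set s | 0 <= s] (fun s => (1 + s ^+ 2) * expR (- (t * s))) =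
    - laplace_weight t 0.
  rewrite /Rintegral (laplace_ge0 t0 _ c1 (fun s => laplace_weightE s t0) wC) //.
  by move=> s _; rewrite addr_ge0 ?sqr_ge0.
have E2 : Rintegral leb [set s | 0 <= s] (fun s => (C * (1 + s ^+ 2) + p s) * expR (- (t * s))) =
    - (C * laplace_weight t 0 + P 0).
  have dQ s : is_derive s 1 (fun s => (C * laplace_weight t s + P s) * expR (- (t * s)))
      ((C * (1 + s ^+ 2) + p s) * expR (- (t * s))).
    have h1 := laplace_weightE s t0; have h2 := dP s.
    rewrite (_ : (fun s => _) = (fun s => C * (laplace_weight t s * expR (- (t * s))) +
      P s * expR (- (t * s)))); last by apply/funext => u; ring.
    by apply: is_derive_eq; rewrite /GRing.scale /= ?scaler0 ?addr0; ring.
  have q0 s : 0 <= s -> 0 <= C * (1 + s ^+ 2) + p s.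
    by move=> _; have := pC s; rewrite ler_norml => /andP[h _]; lra.
  have qc : continuous (fun s => C * (1 + s ^+ 2) + p s).
    move=> s; apply: cvgD; last exact: pc.
    by apply: cvgM; [exact: cvg_cst|exact: c1].
  have QC s : 0 <= s -> `|C * laplace_weight t s + P s| <= (C * C' + C2) * (1 + s ^+ 2).
    move=> s0; rewrite (le_trans (ler_normD _ _)) // mulrDl lerD ?PC //.
    by rewrite normrM (ger0_norm C0) -mulrA ler_wpM2l // wC.
  by rewrite /Rintegral (laplace_ge0 t0 q0 qc dQ QC).
have E3 : (fun s => (C * (1 + s ^+ 2) + p s) * expR (- (t * s))) =
    (fun s => C * (1 + s ^+ 2) * expR (- (t * s)) + p s * expR (- (t * s))).
  by apply/funext => s; ring.
move: E2; rewrite E3 RintegralD //.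
under eq_Rintegral => s _ do rewrite -mulrA.
by rewrite RintegralZl // E1 mulrN opprD => /addrI.
Qed.

End LaplaceIntegrals.

(** * The Khintchine integrand split into real and imaginary parts *)

Section KhinchinLaplace.
Variable R : realType.
Implicit Types (s x y t : R).
Local Notation leb := (@lebesgue_measure R).

Lemma mean_value_le (f df : R -> R) (M y : R) : (forall s, is_derive s 1 f (df s)) ->
  (forall s, `|s| <= `|y| -> `|df s| <= M) -> `|f y - f 0| <= M * `|y|.
Proof.
move=> fd dM; have fc := continuous_derive1 fd.
have [y0|y0] := leP 0 y.
  have [c cI ->] := MVT_segment y0 (fun s _ => fd s) (continuous_subspaceT fc).
  rewrite normrM subr0 ler_wpM2r // dM //.
  by move: cI; rewrite in_itv /= => /andP[c1 c2]; rewrite !ger0_norm.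
have [c cI e] := MVT_segment (ltW y0) (fun s _ => fd s) (continuous_subspaceT fc).
rewrite -normrN opprB e normrM sub0r normrN ler_wpM2r // dM //.
by move: cI; rewrite in_itv /= => /andP[c1 c2]; rewrite !ler0_norm ?lerN2 // ltW.
Qed.

Lemma sin_le y : `|sin y| <= `|y|.
Proof.
have := @mean_value_le sin cos 1 y (fun s => is_derive_sin s) (fun s _ => cos_max s).
by rewrite sin0 subr0 mul1r.
Qed.

Lemma cos_sub1_le y : `|cos y - 1| <= y ^+ 2.
Proof.
have := @mean_value_le cos (fun s => - sin s) `|y| y.
rewrite cos0 -expr2 real_normK ?num_real //; apply => s //.
by rewrite normrN; apply: le_trans; exact: sin_le.
Qed.

Lemma sin_sub_le y : `|sin y - y| <= `|y| ^+ 2.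
Proof.
have h := @mean_value_le (fun s => sin s - s) (fun s => cos s - 1) `|y| y.
rewrite expr2; move: h; rewrite sin0 !subr0; apply => s //.
have h1 := @mean_value_le cos (fun s => - sin s) 1 s.
rewrite cos0 mul1r in h1 => sy; apply: le_trans sy; apply: h1 => u _.
by rewrite normrN sin_max.
Qed.

Definition kh_re s x : R :=
  if x == 0 then - (s ^+ 2) / 2 else (cos (s * x) - 1) * (1 + x^-1 ^+ 2).
(** The compensator is grouped so that the singular factor x^-2 multiplies only sin (sx) - sx, which
    is at most (sx)^2. *)
Definition kh_im s x : R :=
  if x == 0 then 0 else sin (s * x) + (sin (s * x) - s * x) * x^-1 ^+ 2.

Lemma kh_integrandE s x : kh_integrand s x = kh_re s x +i* kh_im s x.
Proof.
rewrite /kh_integrand /kh_re /kh_im; case: eqVneq => // x0.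
have x1 : 1 + x ^+ 2 != 0 by rewrite gt_eqF // ltr_wpDr ?sqr_ge0.
apply: complex_eq; rewrite /cexp /= !(mul0r, mul1r, mulr0, mulr1, subr0, sub0r, add0r, addr0, oppr0, expR0).
  by field.
by field; rewrite x0.
Qed.

(** |cos y - 1| <= 2 serves the constant part of 1 + x^-2 and |cos y - 1| <= y^2 the singular part.
    Uniformity in x with quadratic growth in s is the domination needed for Fubini. *)
Lemma kh_re_le s x : `|kh_re s x| <= 3 * (1 + s ^+ 2).
Proof.
rewrite /kh_re; case: eqVneq => [_|x0].
  rewrite mulNr normrN ger0_norm ?divr_ge0 ?sqr_ge0 //; have := sqr_ge0 s; lra.
have h1 := cos_sub1_le (s * x); have h2 := cos_max (s * x).
have h3 : `|cos (s * x) - 1| <= 2.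
  by rewrite (le_trans (ler_normB _ _)) // normr1; lra.
rewrite mulrDr mulr1 (le_trans (ler_normD _ _)) // normrM normrX.
have -> : `|x^-1| ^+ 2 = x^-1 ^+ 2 by rewrite real_normK ?num_real.
have h4 : `|cos (s * x) - 1| * x^-1 ^+ 2 <= s ^+ 2.
  have -> : s ^+ 2 = (s * x) ^+ 2 * x^-1 ^+ 2 by field.
  by rewrite ler_wpM2r ?sqr_ge0.
have := sqr_ge0 s; lra.
Qed.

Lemma kh_im_le s x : `|kh_im s x| <= 3 * (1 + s ^+ 2).
Proof.
rewrite /kh_im; case: eqVneq => [_|x0].
  by rewrite normr0 mulr_ge0 // addr_ge0 ?sqr_ge0.
have h1 := sin_sub_le (s * x); have h2 := sin_max (s * x).
rewrite (le_trans (ler_normD _ _)) // normrM normrX.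
have -> : `|x^-1| ^+ 2 = x^-1 ^+ 2 by rewrite real_normK ?num_real.
have h4 : `|sin (s * x) - s * x| * x^-1 ^+ 2 <= s ^+ 2.
  have -> : s ^+ 2 = (s * x) ^+ 2 * x^-1 ^+ 2 by field.
  by rewrite ler_wpM2r ?sqr_ge0 // -(real_normK (num_real (s * x))).
have := sqr_ge0 s; lra.
Qed.

Lemma measurable_kh_re : measurable_fun setT (fun p : measurableTypeR R * R => kh_re p.1 p.2).
Proof.
have m1 : measurable_fun setT (fun p : measurableTypeR R * R => p.1 : R) by exact: measurable_fst.
have m2 : measurable_fun setT (fun p : measurableTypeR R * R => p.2 : R) by exact: measurable_snd.
apply: measurable_fun_ifT => /=.
- by apply: measurable_fun_eqr.
- apply: measurable_funM => //; apply: measurableT_comp => //.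
  exact: measurable_funX.
- apply: measurable_funM.
    apply: measurable_funB => //; apply: measurableT_comp; last exact: measurable_funM.
    by apply: continuous_measurable_fun; exact: continuous_cos.
  apply: measurable_funD => //; apply: measurable_funX; exact: measurable_funV.
Qed.

Lemma measurable_kh_im : measurable_fun setT (fun p : measurableTypeR R * R => kh_im p.1 p.2).
Proof.
have m1 : measurable_fun setT (fun p : measurableTypeR R * R => p.1 : R) by exact: measurable_fst.
have m2 : measurable_fun setT (fun p : measurableTypeR R * R => p.2 : R) by exact: measurable_snd.
have ms : measurable_fun setT (fun p : measurableTypeR R * R => sin (p.1 * p.2)).
  apply: measurableT_comp; last exact: measurable_funM.
  by apply: continuous_measurable_fun; exact: continuous_sin.
apply: measurable_fun_ifT => /=.
- by apply: measurable_fun_eqr.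
- exact: measurable_cst.
- apply: measurable_funD => //; apply: measurable_funM.
    by apply: measurable_funB => //; exact: measurable_funM.
  apply: measurable_funX; exact: measurable_funV.
Qed.

(** Factor of an s-primitive of [kh_re s x] times exp (-ts), obtained by integration by parts; minus
    its value at s = 0 is the Laplace transform. *)
Definition kh_re_prim t x s : R :=
  if x == 0 then s ^+ 2 / (2 * t) + s / t ^+ 2 + t^-1 ^+ 3
  else ((x * sin (s * x) - t * cos (s * x)) / (t ^+ 2 + x ^+ 2) + t^-1) * (1 + x^-1 ^+ 2).
Definition kh_im_prim t x s : R :=
  if x == 0 then 0
  else - (t * sin (s * x) + x * cos (s * x)) / (t ^+ 2 + x ^+ 2) * (1 + x^-1 ^+ 2) +
    (s / t + t^-1 ^+ 2) / x.

Lemma sqrD_neq0 t x : 0 < t -> t ^+ 2 + x ^+ 2 != 0.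
Proof. by move=> t0; rewrite gt_eqF // ltr_wpDr ?sqr_ge0 // exprn_gt0. Qed.

Lemma is_derive_sinM x s : is_derive s 1 (fun s => sin (s * x)) (x * cos (s * x)).
Proof.
have h : is_derive s 1 (fun s => s * x) x.
  by apply: is_derive_eq; rewrite /GRing.scale /=; ring.
have := @is_derive1_comp _ sin (fun s => s * x) s _ _ (is_derive_sin _) h.
by rewrite [cos _ * x]mulrC.
Qed.

Lemma is_derive_cosM x s : is_derive s 1 (fun s => cos (s * x)) (- (x * sin (s * x))).
Proof.
have h : is_derive s 1 (fun s => s * x) x.
  by apply: is_derive_eq; rewrite /GRing.scale /=; ring.
have := @is_derive1_comp _ cos (fun s => s * x) s _ _ (is_derive_cos _) h.
by rewrite mulNr [sin _ * x]mulrC.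
Qed.

Lemma kh_re_primE t x s : 0 < t ->
  is_derive s 1 (fun s => kh_re_prim t x s * expR (- (t * s))) (kh_re s x * expR (- (t * s))).
Proof.
move=> t0; have tn : t != 0 by rewrite gt_eqF.
have dE := is_derive_expRN t s.
rewrite /kh_re_prim /kh_re; case: eqVneq => x0.
  by apply: is_derive_eq; rewrite /GRing.scale /= !(scaler0, mulr0, add0r, addr0, mulr1); field.
have dS := is_derive_sinM x s; have dC := is_derive_cosM x s.
have tx := sqrD_neq0 x t0.
apply: is_derive_eq; rewrite /GRing.scale /= !(scaler0, mulr0, add0r, addr0, mulr1); field.
by rewrite x0 tn tx.
Qed.

Lemma kh_im_primE t x s : 0 < t ->
  is_derive s 1 (fun s => kh_im_prim t x s * expR (- (t * s))) (kh_im s x * expR (- (t * s))).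
Proof.
move=> t0; have tn : t != 0 by rewrite gt_eqF.
have dE := is_derive_expRN t s.
rewrite /kh_im_prim /kh_im; case: eqVneq => x0.
  by apply: is_derive_eq; rewrite /GRing.scale /= !(scaler0, mulr0, mul0r, add0r, addr0, mulr1).
have dS := is_derive_sinM x s; have dC := is_derive_cosM x s.
have tx := sqrD_neq0 x t0.
apply: is_derive_eq; rewrite /GRing.scale /= !(scaler0, mulr0, add0r, addr0, mulr1); field.
by rewrite x0 tn tx.
Qed.

Lemma continuous_kh_re x : continuous (kh_re^~ x).
Proof.
rewrite /kh_re; case: (x == 0) => s.
  apply: cvgM; last exact: cvg_cst.
  by apply: cvgN; exact: exprn_continuous.
apply: cvgM; last exact: cvg_cst.
apply: cvgB; last exact: cvg_cst.
exact: continuous_derive1 (is_derive_cosM x) s.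
Qed.

Lemma continuous_kh_im x : continuous (kh_im^~ x).
Proof.
rewrite /kh_im; case: (x == 0) => s; first exact: cvg_cst.
have h := continuous_derive1 (is_derive_sinM x) (x := s).
apply: cvgD => //; apply: cvgM; last exact: cvg_cst.
apply: cvgB => //; apply: cvgM; last exact: cvg_cst.
exact: cvg_id.
Qed.

(** The constant may depend on x: it only makes the boundary term at infinity vanish for one x at a
    time. *)
Lemma kh_re_prim_le t x : 0 < t -> exists C : R, forall s, 0 <= s ->
  `|kh_re_prim t x s| <= C * (1 + s ^+ 2).
Proof.
move=> t0; have tp : 0 < t ^+ 2 by rewrite exprn_gt0.
have i1 : 0 <= t^-1 by rewrite invr_ge0 ltW.
have i2 : 0 <= t^-1 ^+ 2 by rewrite exprn_ge0.
have i3 : 0 <= t^-1 ^+ 3 by rewrite exprn_ge0.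
rewrite /kh_re_prim; case: eqVneq => x0.
  exists (t^-1 + t^-1 ^+ 2 + t^-1 ^+ 3) => s s0.
  have s2 : s <= 1 + s ^+ 2 by have := sqr_ge0 (s - 1); rewrite sqrrB; lra.
  rewrite -[_ / t ^+ 2]/(s * (t ^+ 2)^-1) -exprVn invfM ger0_norm; last first.
    by apply: addr_ge0 => //; apply: addr_ge0; apply: mulr_ge0; rewrite ?sqr_ge0 ?mulr_ge0 ?invr_ge0 ?(ltW t0).
  have a1 : s ^+ 2 * (2^-1 * t^-1) <= (1 + s ^+ 2) * t^-1.
    by rewrite mulrA ler_wpM2r //; have := sqr_ge0 s; lra.
  have a2 : s * t^-1 ^+ 2 <= (1 + s ^+ 2) * t^-1 ^+ 2 by rewrite ler_wpM2r.
  have a3 : 0 <= s ^+ 2 * t^-1 ^+ 3 by rewrite mulr_ge0 ?sqr_ge0.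
  lra.
pose C := ((`|x| + t) / (t ^+ 2 + x ^+ 2) + t^-1) * (1 + x^-1 ^+ 2).
have C0 : 0 <= C.
  apply: mulr_ge0; last by rewrite addr_ge0 ?sqr_ge0.
  by apply: addr_ge0 => //; apply: divr_ge0; rewrite addr_ge0 ?sqr_ge0 // ltW.
exists C => s s0; apply: (@le_trans _ _ C); last by rewrite ler_peMr // lerDl sqr_ge0.
rewrite normrM [`|1 + _|]ger0_norm ?addr_ge0 ?sqr_ge0 // ler_wpM2r ?addr_ge0 ?sqr_ge0 //.
rewrite (le_trans (ler_normD _ _)) // [`|t^-1|]ger0_norm // lerD2r normrM normfV.
rewrite [`|t ^+ 2 + _|]ger0_norm ?addr_ge0 ?sqr_ge0 // ler_wpM2r ?invr_ge0 ?addr_ge0 ?sqr_ge0 //.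
rewrite (le_trans (ler_normB _ _)) // !normrM [`|t|]gtr0_norm // lerD //.
  by rewrite ler_piMr // sin_max.
by rewrite ler_piMr ?cos_max // ltW.
Qed.

Lemma kh_im_prim_le t x : 0 < t -> exists C : R, forall s, 0 <= s ->
  `|kh_im_prim t x s| <= C * (1 + s ^+ 2).
Proof.
move=> t0; have tp : 0 < t ^+ 2 by rewrite exprn_gt0.
have i1 : 0 <= t^-1 by rewrite invr_ge0 ltW.
have i2 : 0 <= t^-1 ^+ 2 by rewrite exprn_ge0.
rewrite /kh_im_prim; case: eqVneq => x0.
  by exists 0 => s _; rewrite normr0 mul0r.
pose B := (t + `|x|) / (t ^+ 2 + x ^+ 2) * (1 + x^-1 ^+ 2).
pose D := (t^-1 + t^-1 ^+ 2) / `|x|.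
have B0 : 0 <= B.
  apply: mulr_ge0; last by rewrite addr_ge0 ?sqr_ge0.
  by apply: divr_ge0; rewrite addr_ge0 ?sqr_ge0 // ltW.
exists (B + D) => s s0; rewrite (mulrDl B D) (le_trans (ler_normD _ _)) // lerD //.
  apply: (@le_trans _ _ B); last by rewrite ler_peMr // lerDl sqr_ge0.
  rewrite normrM [`|1 + _|]ger0_norm ?addr_ge0 ?sqr_ge0 // ler_wpM2r ?addr_ge0 ?sqr_ge0 //.
  rewrite normrM normrN normfV.
  rewrite [`|t ^+ 2 + _|]ger0_norm ?addr_ge0 ?sqr_ge0 // ler_wpM2r ?invr_ge0 ?addr_ge0 ?sqr_ge0 //.
  rewrite (le_trans (ler_normD _ _)) // !normrM [`|t|]gtr0_norm // lerD //.
    by rewrite ler_piMr ?sin_max // ltW.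
  by rewrite ler_piMr // cos_max.
rewrite normrM normfV /D mulrAC ler_wpM2r ?invr_ge0 // ger0_norm; last first.
  by rewrite addr_ge0 // mulr_ge0.
have s2 : s <= 1 + s ^+ 2 by have := sqr_ge0 (s - 1); rewrite sqrrB; lra.
have a1 : s * t^-1 <= (1 + s ^+ 2) * t^-1 by rewrite ler_wpM2r.
have a2 : 0 <= s ^+ 2 * t^-1 ^+ 2 by rewrite mulr_ge0 ?sqr_ge0.
lra.
Qed.

(** This is t^-2 times the imaginary part of [kh_kernel] at it, while [laplace_kh_im] gives t^-2
    times the real part: conjugation and the factor i t^2 exchange the two. *)
Lemma laplace_kh_re t x : 0 < t ->
  leb.-integrable [set s | 0 <= s] (EFin \o (fun s => kh_re s x * expR (- (t * s)))) /\
  Rintegral leb [set s | 0 <= s] (fun s => kh_re s x * expR (- (t * s))) =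
  - ((1 + x ^+ 2) / (t * (t ^+ 2 + x ^+ 2))).
Proof.
move=> t0; have [C PC] := kh_re_prim_le x t0.
have [i ->] := @laplace_integral R t (kh_re^~ x) (kh_re_prim t x) 3 C t0
  (@continuous_kh_re x) (kh_re_le^~ x) (fun s => kh_re_primE x s t0) PC.
split => //; have tn : t != 0 by rewrite gt_eqF.
have tx := sqrD_neq0 x t0.
rewrite /kh_re_prim; have [->|x0] := eqVneq x 0.
  by rewrite expr0n /=; field.
by rewrite mul0r sin0 cos0; field; rewrite x0 tn tx.
Qed.

Lemma laplace_kh_im t x : 0 < t ->
  leb.-integrable [set s | 0 <= s] (EFin \o (fun s => kh_im s x * expR (- (t * s)))) /\
  Rintegral leb [set s | 0 <= s] (fun s => kh_im s x * expR (- (t * s))) =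
  x * (t ^+ 2 - 1) / (t ^+ 2 * (t ^+ 2 + x ^+ 2)).
Proof.
move=> t0; have [C PC] := kh_im_prim_le x t0.
have [i ->] := @laplace_integral R t (kh_im^~ x) (kh_im_prim t x) 3 C t0
  (@continuous_kh_im x) (kh_im_le^~ x) (fun s => kh_im_primE x s t0) PC.
split => //; have tn : t != 0 by rewrite gt_eqF.
have tx := sqrD_neq0 x t0.
rewrite /kh_im_prim; have [->|x0] := eqVneq x 0.
  by rewrite !mul0r oppr0.
by rewrite mul0r sin0 cos0; field; rewrite x0 tn tx.
Qed.

(** Carries the drift: conjugated and multiplied by i t^2, the transform of isa is a. *)
Lemma laplace_id t : 0 < t ->
  leb.-integrable [set s | 0 <= s] (EFin \o (fun s => s * expR (- (t * s)))) /\
  Rintegral leb [set s | 0 <= s] (fun s => s * expR (- (t * s))) = (t ^+ 2)^-1.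
Proof.
move=> t0; have tn : t != 0 by rewrite gt_eqF.
have i1 : 0 <= t^-1 by rewrite invr_ge0 ltW.
have i2 : 0 <= t^-1 ^+ 2 by rewrite exprn_ge0.
have s2 s : `|s| <= 1 + s ^+ 2.
  by rewrite -(real_normK (num_real s)); have := sqr_ge0 (`|s| - 1); rewrite sqrrB; have := normr_ge0 s; lra.
have dP s : is_derive s 1 (fun s => - (s / t + t^-1 ^+ 2) * expR (- (t * s))) (s * expR (- (t * s))).
  have dE := is_derive_expRN t s.
  by apply: is_derive_eq; rewrite /GRing.scale /= !(scaler0, mulr0, add0r, addr0, mulr1); field.
have PC s : 0 <= s -> `|- (s / t + t^-1 ^+ 2)| <= (t^-1 + t^-1 ^+ 2) * (1 + s ^+ 2).
  move=> s0; rewrite normrN ger0_norm ?addr_ge0 ?mulr_ge0 //.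
  have := s2 s; rewrite ger0_norm // => h.
  have a1 : s * t^-1 <= (1 + s ^+ 2) * t^-1 by rewrite ler_wpM2r.
  have a2 : 0 <= s ^+ 2 * t^-1 ^+ 2 by rewrite mulr_ge0 ?sqr_ge0.
  lra.
have [i ->] := @laplace_integral R t id (fun s => - (s / t + t^-1 ^+ 2)) 1 _ t0
  (fun s => cvg_id) (fun s => eq_ind_r (fun u => `|s| <= u) (s2 s) (mul1r _)) dP PC.
by split => //; rewrite opprK mul0r add0r exprVn.
Qed.

Lemma kh_kernel_imag t x : 0 < t -> kh_kernel ('i * t%:C) x =
  (x * (t ^+ 2 - 1) / (t ^+ 2 + x ^+ 2)) -i* (t * (1 + x ^+ 2) / (t ^+ 2 + x ^+ 2)).
Proof.
move=> t0; have tx := sqrD_neq0 x t0.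
have z0 : 0 < complex.Im ('i * t%:C : R[i]) by rewrite /= mul0r mul1r add0r.
apply: (mulIf (upper_subR_neq0 x z0)); rewrite /kh_kernel mulfVK ?upper_subR_neq0 //.
by apply: complex_eq => /=; field.
Qed.

Variables (a : R) (m : {finite_measure set R -> \bar R}).

Lemma integrable_bdd (f : R -> R) (M : R) : measurable_fun setT f -> (forall x, `|f x| <= M) ->
  m.-integrable setT (EFin \o f).
Proof.
move=> mf fM; have [|x|//] := @cintegrable_bdd _ _ _ m (fun x => (f x)%:C) M.
  exact: cmeasurableR.
by rewrite normcR.
Qed.

Lemma khlogE s : khlog a m s =
  Rintegral m setT (kh_re s) +i* (s * a + Rintegral m setT (kh_im s)).
Proof.
rewrite /khlog /cint; under eq_Rintegral do rewrite kh_integrandE /=.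
under [X in _ +i* X]eq_Rintegral do rewrite kh_integrandE /=.
by apply: complex_eq => /=; ring.
Qed.

Lemma laplace_fubini (k : R -> R -> R) t : 0 < t ->
  measurable_fun setT (fun p : measurableTypeR R * R => k p.1 p.2) ->
  (forall s x, `|k s x| <= 3 * (1 + s ^+ 2)) ->
  leb.-integrable [set s | 0 <= s]
    (EFin \o (fun s => Rintegral m setT (k s) * expR (- (t * s)))) /\
  Rintegral leb [set s | 0 <= s] (fun s => Rintegral m setT (k s) * expR (- (t * s))) =
  Rintegral m setT (fun x => Rintegral leb [set s | 0 <= s] (fun s => k s x * expR (- (t * s)))).
Proof.
move=> t0 mk kC; pose S : set (measurableTypeR R) := [set s | 0 <= s].
have mD : measurable S by rewrite /S set_ge0_itv.
have iw : leb.-integrable S (EFin \o (fun s => 3 * ((1 + s ^+ 2) * expR (- (t * s))))).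
  have := @integrableZl _ _ _ leb S mD 3 _ (integrable_laplace_weight t0).
  by apply: eq_integrable.
have mE : measurable_fun setT (fun p : measurableTypeR R * R => expR (- (t * p.1))).
  have m1 : measurable_fun setT (fun s : measurableTypeR R => expR (- (t * s))).
    by apply: continuous_measurable_fun; exact: continuous_expRN.
  exact: (measurableT_comp m1 measurable_fst).
have Ebd s x : S s -> `|k s x * expR (- (t * s))| <= 3 * ((1 + s ^+ 2) * expR (- (t * s))).
  move=> _; rewrite normrM [`|expR _|]gtr0_norm ?expR_gt0 // mulrA ler_wpM2r ?expR_ge0 //.
have [] := @Rintegral_fubini_dominated _ _ _ R R leb m S
  (fun p => k p.1 p.2 * expR (- (t * p.1))) _ mD (measurable_funM mk mE) iw Ebd.
have ik s : m.-integrable setT (EFin \o k s).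
  apply: integrable_bdd (kC s).
  exact: (measurableT_comp mk (pair1_measurable (s : measurableTypeR R))).
have -> : (fun x : measurableTypeR R => Rintegral m setT (fun y => k (x, y).1 (x, y).2 * expR (- (t * (x, y).1)))) =
    (fun s => Rintegral m setT (k s) * expR (- (t * s))).
  by apply/funext => s; rewrite -RintegralZr.
by [].
Qed.

Lemma laplace_khlogE t : 0 < t -> laplace_khlog a m t = kh_transform a m idfun ('i * t%:C).
Proof.
move=> t0; have tn : t != 0 by rewrite gt_eqF.
pose S : set (measurableTypeR R) := [set s | 0 <= s].
have mD : measurable S by rewrite /S set_ge0_itv.
have [iRe FRe] := laplace_fubini t0 measurable_kh_re kh_re_le.
have [iIm FIm] := laplace_fubini t0 measurable_kh_im kh_im_le.
have [iI FI] := laplace_id t0.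
have z0 : 0 < complex.Im ('i * t%:C : R[i]) by rewrite /= mul0r mul1r add0r.
have mid : measurable_fun setT (idfun : R -> R) by exact: measurable_id.
have [ik1 ik2] := @cintegrable_kh_kernel R m _ _ mid z0.
pose K1 := Rintegral m setT (fun x => complex.Re (kh_kernel ('i * t%:C) x)).
pose K2 := Rintegral m setT (fun x => complex.Im (kh_kernel ('i * t%:C) x)).
have FRe' : Rintegral leb S (fun s => Rintegral m setT (kh_re s) * expR (- (t * s))) =
    (t ^+ 2)^-1 * K2.
  rewrite FRe /K2 -(RintegralZl (t ^+ 2)^-1 measurableT ik2); apply: eq_Rintegral => x _.
  have [_ ->] := laplace_kh_re x t0; rewrite kh_kernel_imag //=.
  by field; rewrite tn sqrD_neq0.
have FIm' : Rintegral leb S (fun s => Rintegral m setT (kh_im s) * expR (- (t * s))) =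
    (t ^+ 2)^-1 * K1.
  rewrite FIm /K1 -(RintegralZl (t ^+ 2)^-1 measurableT ik1); apply: eq_Rintegral => x _.
  have [_ ->] := laplace_kh_im x t0; rewrite kh_kernel_imag //=.
  by field; rewrite tn sqrD_neq0.
have E1 : Rintegral leb S (fun s => complex.Re ((khlog a m s)^* * (expR (- (t * s)))%:C)) =
    (t ^+ 2)^-1 * K2.
  rewrite -FRe'; apply: eq_Rintegral => s _.
  by rewrite khlogE /= mulr0 subr0.
have E2 : Rintegral leb S (fun s => complex.Im ((khlog a m s)^* * (expR (- (t * s)))%:C)) =
    - ((t ^+ 2)^-1 * (a + K1)).
  rewrite mulrDr -FIm' [_ * a]mulrC -FI -RintegralZl // -RintegralD //; last first.
    have := @integrableZl _ _ _ leb S mD a _ iI.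
    by apply: eq_integrable.
  rewrite -[in RHS]mulN1r -RintegralZl //; last first.
    have := @integrableD _ _ _ leb S mD _ _ (@integrableZl _ _ _ leb S mD a _ iI) iIm.
    by apply: eq_integrable.
  by apply: eq_Rintegral => s _; rewrite khlogE /= mulr0 add0r; ring.
rewrite /laplace_khlog /cint -/S E1 E2 /kh_transform /cint -/K1 -/K2.
by apply: complex_eq => /=; field.
Qed.

End KhinchinLaplace.

(** * Uniqueness and Stieltjes inversion *)

Section CauchyAgreement.
Variable R : realType.
Implicit Types (nu : probability R R) (w h : R[i]) (n : nat).

(** Remainder of order n, without its factor (w0 - w)^n, in the geometric expansion of the Cauchy
    transform about w0; at w = w0 it is the n-th Taylor coefficient up to sign. *)
Definition cauchy_rem nu w0 n w : R[i] :=
  cint nu setT (fun x => (w0 - x%:C)^-1 ^+ n * (w - x%:C)^-1).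

Lemma normc_cauchy_rem_integrand w0 n w (x : R) : 0 < complex.Im w0 -> 0 < complex.Im w ->
  normc ((w0 - x%:C)^-1 ^+ n * (w - x%:C)^-1) <= (complex.Im w0)^-1 ^+ n * (complex.Im w)^-1.
Proof.
move=> w00 wp; rewrite normcM normcX ler_pM ?exprn_ge0 ?normc_ge0 ?normc_fraction_le //.
by rewrite lerXn2r ?nnegrE ?normc_ge0 ?invr_ge0 ?(ltW w00) // normc_fraction_le.
Qed.

Lemma cmeasurable_cauchy_rem w0 n w :
  cmeasurable setT (fun x : R => (w0 - x%:C)^-1 ^+ n * (w - x%:C)^-1).
Proof.
have mid : measurable_fun setT (idfun : R -> R) by exact: measurable_id.
apply: cmeasurableM; last exact: (cmeasurable_fraction _ mid).
elim: n => [|n IH]; first exact: cmeasurable_cst.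
under eq_fun do rewrite exprS.
by apply: cmeasurableM => //; exact: (cmeasurable_fraction _ mid).
Qed.

Lemma cintegrable_cauchy_rem nu w0 n w : 0 < complex.Im w0 -> 0 < complex.Im w ->
  cintegrable nu setT (fun x => (w0 - x%:C)^-1 ^+ n * (w - x%:C)^-1).
Proof.
move=> w00 wp; apply: (@cintegrable_bdd _ _ _ nu _ ((complex.Im w0)^-1 ^+ n * (complex.Im w)^-1)).
  exact: cmeasurable_cauchy_rem.
by move=> x; exact: normc_cauchy_rem_integrand.
Qed.

Lemma normc_cauchy_rem nu w0 n w : 0 < complex.Im w0 -> 0 < complex.Im w ->
  normc (cauchy_rem nu w0 n w) <= (complex.Im w0)^-1 ^+ n * (complex.Im w)^-1.
Proof.
move=> w00 wp; have := @normc_cint_bdd _ _ _ nu _ _ (cmeasurable_cauchy_rem w0 n w)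
  (fun x => normc_cauchy_rem_integrand n x w00 wp).
by rewrite (_ : fine _ = 1) ?mulr1 // [LHS](congr1 fine (probability_setT nu)).
Qed.

Lemma cauchy_remS nu w0 n w : 0 < complex.Im w0 -> 0 < complex.Im w ->
  cauchy_rem nu w0 n w = cauchy_rem nu w0 n w0 + (w0 - w) * cauchy_rem nu w0 n.+1 w.
Proof.
move=> w00 wp; have i1 := @cintegrable_cauchy_rem nu w0 n w0 w00 w00.
have i2 := @cintegrable_cauchy_rem nu w0 n.+1 w w00 wp.
rewrite /cauchy_rem -cintZ // -cintD //; last exact: cintegrableZ.
apply: eq_cint => x _; have ux := upper_subR_neq0 x w00; have vx := upper_subR_neq0 x wp.
have e : (w - x%:C)^-1 = (w0 - x%:C)^-1 + (w0 - w) * ((w0 - x%:C)^-1 * (w - x%:C)^-1).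
  by field; rewrite ?ux ?vx.
by rewrite [in LHS]e exprSr; ring.
Qed.

Definition cauchy_agree nu nu' w := Defs.cauchy nu w = Defs.cauchy nu' w.

Definition agree_accum nu nu' w0 := forall e : R, 0 < e ->
  exists w, [/\ w != w0, normc (w - w0) < e & cauchy_agree nu nu' w].

Lemma Im_ge_dist w w0 : complex.Im w0 - normc (w - w0) <= complex.Im w.
Proof.
have := normc_Im (w - w0); rewrite cImD cImN ler_norml => /andP[+ _]; lra.
Qed.

(** Zeros of the difference accumulate at w0. If the remainders of order n agree at these points,
    [base] passes to the limit at w0; subtracting the common coefficient and dividing by w0 - w
    gives agreement at order n + 1. *)
Lemma agree_accum_rem nu nu' w0 : 0 < complex.Im w0 -> agree_accum nu nu' w0 ->
  forall n, cauchy_rem nu w0 n w0 = cauchy_rem nu' w0 n w0.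
Proof.
move=> w00 acc.
have rem0 mu w : cauchy_rem mu w0 0 w = Defs.cauchy mu w.
  by apply: eq_cint => x _; rewrite expr0 mul1r.
have base n : (forall w, 0 < complex.Im w -> w != w0 -> cauchy_agree nu nu' w ->
    cauchy_rem nu w0 n w = cauchy_rem nu' w0 n w) ->
    cauchy_rem nu w0 n w0 = cauchy_rem nu' w0 n w0.
  move=> Q; apply/eqP; rewrite -subr_eq0; apply/eqP/eq0_normc/eqP.
  rewrite eq_le normc_ge0 andbT; apply/ler_addgt0Pr => e e0; rewrite add0r.
  pose K := (complex.Im w0)^-1 ^+ n.+1 * (2 / complex.Im w0).
  have K0 : 0 < K by rewrite mulr_gt0 ?exprn_gt0 ?invr_gt0 // divr_gt0.
  have r0 : 0 < Num.min (complex.Im w0 / 2) (e / (2 * K)).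
    by rewrite lt_min !divr_gt0 // mulr_gt0.
  have [w [ww0]] := acc _ r0; rewrite lt_min => /andP[h1 h2] ag.
  have wI : complex.Im w0 / 2 <= complex.Im w by have := Im_ge_dist w w0; lra.
  have wp : 0 < complex.Im w by apply: lt_le_trans wI; rewrite divr_gt0.
  have := Q w wp ww0 ag; rewrite (cauchy_remS nu) // (cauchy_remS nu') // => E.
  have -> : cauchy_rem nu w0 n w0 - cauchy_rem nu' w0 n w0 =
      (w0 - w) * (cauchy_rem nu' w0 n.+1 w - cauchy_rem nu w0 n.+1 w).
    apply/eqP; rewrite subr_eq mulrBr addrAC eq_sym subr_eq eq_sym; apply/eqP.
    by rewrite E addrC.
  have bK mu : normc (cauchy_rem mu w0 n.+1 w) <= K.
    rewrite (le_trans (normc_cauchy_rem mu n.+1 w00 wp)) // /K ler_wpM2l //.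
      by rewrite exprn_ge0 // invr_ge0 ltW.
    by rewrite -[2 / _]invrK invfM invrK lef_pV2 ?posrE ?mulr_gt0 ?invr_gt0 // mulrC.
  rewrite normcM normcBC (le_trans (ler_wpM2l (normc_ge0 _) (normcB _ _))) //.
  rewrite (le_trans (ler_wpM2l (normc_ge0 _) (lerD (bK nu') (bK nu)))) //.
  clear bK; clearbody K; move: h2; rewrite ltr_pdivlMr ?mulr_gt0 // => /ltW.
  by rewrite (_ : K + K = 2 * K) //; ring.
suff Q n : forall w, 0 < complex.Im w -> w != w0 -> cauchy_agree nu nu' w ->
    cauchy_rem nu w0 n w = cauchy_rem nu' w0 n w by move=> n; exact/base/Q.
elim: n => [w wp ww0|n IH w wp ww0 ag]; first by rewrite !rem0.
have := IH w wp ww0 ag; rewrite (cauchy_remS nu) // (cauchy_remS nu') // base //.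
by move=> /addrI /mulfI; apply; rewrite subr_eq0 eq_sym.
Qed.

(** With all coefficients equal, only the remainders are left, and they are at most K (|w - w0| / Im
    w0)^n. The radius Im w0 is the distance to the real line. *)
Lemma agree_accum_disc nu nu' w0 w : 0 < complex.Im w0 -> agree_accum nu nu' w0 ->
  normc (w - w0) < complex.Im w0 -> cauchy_agree nu nu' w.
Proof.
move=> w00 acc hw; have eqs := agree_accum_rem w00 acc.
have wp : 0 < complex.Im w by have := Im_ge_dist w w0; lra.
have E n : Defs.cauchy nu w - Defs.cauchy nu' w =
    (w0 - w) ^+ n * (cauchy_rem nu w0 n w - cauchy_rem nu' w0 n w).
  elim: n => [|n ->].
    by rewrite expr0 mul1r; congr (_ - _); apply: eq_cint => x _; rewrite expr0 mul1r.
  by rewrite (cauchy_remS nu) // (cauchy_remS nu') // eqs exprSr; ring.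
apply/eqP; rewrite -subr_eq0; apply/eqP/eq0_normc/eqP; rewrite eq_le normc_ge0 andbT.
pose q := normc (w - w0) / complex.Im w0; pose K := 2 * (complex.Im w)^-1.
have Eq n : normc (Defs.cauchy nu w - Defs.cauchy nu' w) <= K * q ^+ n.
  rewrite (E n) normcM normcX normcBC.
  rewrite (le_trans (ler_wpM2l (exprn_ge0 _ (normc_ge0 _)) (normcB _ _))) //.
  rewrite (le_trans (ler_wpM2l (exprn_ge0 _ (normc_ge0 _))
    (lerD (normc_cauchy_rem _ n w00 wp) (normc_cauchy_rem _ n w00 wp)))) //.
  by rewrite /K /q exprMn le_eqVlt; apply/orP; left; apply/eqP; ring.
have Kc : K * q ^+ n @[n --> \oo] --> (0 : R).
  rewrite -[X in _ --> X](mulr0 K); apply: cvgMr; apply: cvg_expr.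
  by rewrite ger0_norm ?divr_ge0 ?normc_ge0 ?(ltW w00) // ltr_pdivrMr // mul1r.
by rewrite -(cvg_lim _ Kc) //; apply: limr_ge; [apply/cvg_ex; exists 0|apply: nearW].
Qed.

Lemma agree_accum_move nu nu' w0 w : 0 < complex.Im w0 -> agree_accum nu nu' w0 ->
  normc (w - w0) < complex.Im w0 -> agree_accum nu nu' w.
Proof.
move=> w00 acc hw e e0; pose d := Num.min (e / 2) ((complex.Im w0 - normc (w - w0)) / 2).
have d0 : 0 < d by rewrite lt_min !divr_gt0 // subr_gt0.
have nd : normc (d%:C : R[i]) = d by rewrite normcR gtr0_norm.
have wd : w + d%:C - w = d%:C by rewrite addrAC subrr add0r.
have : d <= d by []. 
rewrite {2}/d le_min => /andP[d1 d2].
exists (w + d%:C); split.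
- by rewrite -subr_eq0 wd -normc_gt0 nd.
- by rewrite wd nd; lra.
apply: (agree_accum_disc w00 acc).
have -> : w + d%:C - w0 = (w - w0) + d%:C by ring.
by rewrite (le_lt_trans (le_normcD _ _)) // nd; lra.
Qed.

(** Agreement travels along the line of height y0 by discs of radius y0, in horizontal steps of at
    most y0 / 2; one more disc reaches down to every 0 < y <= y0. *)
Lemma agree_accum_strip nu nu' (x0 y0 : R) : 0 < y0 -> agree_accum nu nu' (x0 +i* y0) ->
  forall x y, 0 < y <= y0 -> cauchy_agree nu nu' (x +i* y).
Proof.
move=> y00 acc x y /andP[yp yy].
suff hor n (x' : R) : `|x' - x0| <= n%:R * (y0 / 2) -> agree_accum nu nu' (x' +i* y0).
  have accx : agree_accum nu nu' (x +i* y0).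
    apply: (hor (Num.truncn (`|x - x0| / (y0 / 2))).+1).
    by rewrite -ler_pdivrMr ?divr_gt0 // ltW // truncnS_gt.
  apply: (agree_accum_disc _ accx) => //.
  have -> : (x +i* y) - (x +i* y0) = 0 +i* (y - y0) by apply: complex_eq => /=; ring.
  by rewrite /= expr0n add0r sqrtr_sqr ler0_norm ?subr_le0 //; lra.
elim: n x' => [|n IH] x'.
  by rewrite mul0r normr_le0 subr_eq0 => /eqP ->.
(* The last but one point when the way from x0 to x' is cut into n + 1 equal steps; each step is at
   most y0 / 2. *)
move=> hx; pose x1 := x0 + (x' - x0) * (n%:R / n.+1%:R).
have n0 : 0 < n.+1%:R :> R by rewrite ltr0n.
have accx : agree_accum nu nu' (x1 +i* y0).
  apply: IH; have -> : x1 - x0 = (x' - x0) * (n%:R / n.+1%:R) by rewrite /x1; ring.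
  have an : `|n%:R / n.+1%:R| = n%:R / n.+1%:R :> R by rewrite ger0_norm // divr_ge0.
  rewrite normrM an [leLHS]mulrA ler_pdivrMr //.
  by rewrite mulrC -[leRHS]mulrA ler_wpM2l // [leRHS]mulrC.
apply: (agree_accum_move _ accx) => //=.
have -> : x' - x1 = (x' - x0) / n.+1%:R.
  by rewrite /x1 -natr1; field; rewrite natr1 gt_eqF.
rewrite subrr expr0n addr0 sqrtr_sqr normrM normfV [`|n.+1%:R|]gtr0_norm //.
by rewrite ltr_pdivrMr // (le_lt_trans hx) // mulrC ltr_pM2r // ltr_pdivrMr // ltr_pMr // ltr1n.
Qed.

End CauchyAgreement.

(** * Stieltjes inversion through Poisson integrals over half lines *)

Section StieltjesInversion.
Variable R : realType.
Implicit Types (nu : probability R R) (b u x y : R).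
Local Notation leb := (@lebesgue_measure R).

Lemma fubini_tonelli_set d1 d2 (T1 : measurableType d1) (T2 : measurableType d2)
    (m1 : {sigma_finite_measure set T1 -> \bar R})
    (m2 : {sigma_finite_measure set T2 -> \bar R}) (D : set T1) (f : T1 * T2 -> R) :
  measurable D -> measurable_fun setT f -> (forall p, 0 <= f p) ->
  (\int[m1]_(x in D) \int[m2]_y (f (x, y))%:E = \int[m2]_y \int[m1]_(x in D) (f (x, y))%:E)%E.
Proof.
move=> mD mf f0.
pose f' p : R := f p * \1_D p.1.
have mf' : measurable_fun setT f'.
  apply: measurable_funM => //.
  have mi : measurable_fun setT (\1_D : T1 -> R) by exact: measurable_indic.
  exact: (measurableT_comp mi measurable_fst).
have f'E (x : T1) (y : T2) : f' (x, y) = ((fun x : T1 => f (x, y)) \_ D) x.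
  by rewrite /f' patchE indicE; case: (x \in D); rewrite ?mulr1 ?mulr0.
have := @fubini_tonelli _ _ T1 T2 R m1 m2 (EFin \o f').
move=> /(_ _ _) H; have {}H := H _ _.
rewrite integral_mkcond; transitivity (\int[m1]_x \int[m2]_y (f' (x, y))%:E)%E.
  apply: eq_integral => x _; rewrite patchE; case: ifPn => xD.
    by apply: eq_integral => y _; rewrite f'E patchE xD.
  by rewrite integral0_eq // => y _; rewrite f'E patchE (negbTE xD).
rewrite H //; last 2 first.
- exact/measurable_EFinP.
- by move=> [x y]; rewrite /= lee_fin f'E patchE; case: ifP.
by apply: eq_integral => y _; rewrite [RHS]integral_mkcond; apply: eq_integral => x _;
  rewrite /= f'E !patchE; case: ifP.
Qed.

Lemma poisson_tail b u y : 0 < y ->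
  (\int[leb]_(x in `[b, +oo[) (y / ((x - u) ^+ 2 + y ^+ 2))%:E = (pi / 2 - atan ((b - u) / y))%:E)%E.
Proof.
move=> y0; have yn : y != 0 by rewrite gt_eqF.
have dn x : (x - u) ^+ 2 + y ^+ 2 != 0 by rewrite gt_eqF // ltr_wpDl ?sqr_ge0 ?exprn_gt0.
pose F x := atan ((x - u) / y).
have dF x : is_derive x 1 F (y / ((x - u) ^+ 2 + y ^+ 2)).
  have h : is_derive x 1 (fun x => (x - u) / y) y^-1.
    by apply: is_derive_eq; rewrite /GRing.scale /= ?scaler0 ?mulr0 ?add0r ?addr0 ?subr0 ?mulr1.
  have := @is_derive1_comp _ atan (fun x => (x - u) / y) x _ _ (is_derive1_atan _) h.
  congr (is_derive _ _ _ _); field.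
  by rewrite dn yn.
have cF := continuous_derive1 dF.
rewrite (@ge0_continuous_FTC2y _ _ F b (pi / 2)) ?EFinB //.
- by move=> x _; rewrite divr_ge0 ?addr_ge0 ?sqr_ge0 // ltW.
- apply: continuous_subspaceT => x; apply: cvgM; first exact: cvg_cst.
  apply: cvgV => //; apply: cvgD; last exact: cvg_cst.
  have hx : z - u @[z --> x] --> x - u by apply: cvgB; [exact: cvg_id|exact: cvg_cst].
  by rewrite expr2; exact: cvgM.
- apply: (@cvg_comp _ _ _ (fun x => (x - u) / y) atan _ _ _ _ (@cvgy_atan R)).
  apply/cvgryPge => A; near=> x.
  rewrite ler_pdivlMr // lerBrDr; near: x; apply: nbhs_pinfty_ge.
  by rewrite num_real.
- by apply: cvg_at_right_filter; exact: cF.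
- by move=> x _; rewrite derive1E; have [_ ->] := dF x.
Unshelve. all: by end_near. Qed.

Lemma Im_cauchy nu x y : 0 < y ->
  (\int[nu]_u (y / ((x - u) ^+ 2 + y ^+ 2))%:E = (- complex.Im (Defs.cauchy nu (x +i* y)))%:E)%E.
Proof.
move=> y0; have mid : measurable_fun setT (idfun : R -> R) by exact: measurable_id.
have [_ i2] : cintegrable nu setT (fun u : R => ((x +i* y) - u%:C)^-1).
  apply: (@cintegrable_bdd _ _ _ nu _ (y^-1)); first exact: (cmeasurable_fraction _ mid).
  by move=> u; exact: normc_fraction_le.
have E u : complex.Im ((x +i* y) - u%:C)^-1 = - (y / ((x - u) ^+ 2 + y ^+ 2)).
  by rewrite cImV normc_sqr /= subr0 mulNr.
have i3 : nu.-integrable setT (EFin \o (fun u : R => y / ((x - u) ^+ 2 + y ^+ 2))).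
  have := @integrableZl _ _ _ nu setT measurableT (-1) _ i2.
  apply: eq_integrable => // u _; rewrite [(EFin \o _) u]/comp E -EFinM mulN1r opprK //.
have -> : complex.Im (Defs.cauchy nu (x +i* y)) =
    Rintegral nu setT (fun u : R => - 1 * (y / ((x - u) ^+ 2 + y ^+ 2))).
  by apply: eq_Rintegral => u _; rewrite E mulN1r.
rewrite RintegralZl // mulN1r opprK /Rintegral fineK //; exact: integrable_fin_num.
Qed.

(** Minus the imaginary part of the transform at height y is the Poisson integral of the law.
    Integrating it over [b, oo[ and exchanging by Tonelli leaves the arctangent primitive of the
    Poisson kernel. *)
Lemma cauchy_agree_tail nu nu' (y : R) : 0 < y ->
  (forall x, cauchy_agree nu nu' (x +i* y)) -> forall b,
  Rintegral nu setT (fun u => pi / 2 - atan ((b - u) / y)) =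
  Rintegral nu' setT (fun u => pi / 2 - atan ((b - u) / y)).
Proof.
move=> y0 ag b.
have mf : measurable_fun setT (fun p : measurableTypeR R * R => y / ((p.1 - p.2) ^+ 2 + y ^+ 2)).
  have m1 : measurable_fun setT (fun p : measurableTypeR R * R => p.1 : R) by exact: measurable_fst.
  have m2 : measurable_fun setT (fun p : measurableTypeR R * R => p.2 : R) by exact: measurable_snd.
  apply: measurable_funM => //; apply: measurable_funV => //.
  apply: measurable_funD => //; apply: measurable_funX; exact: measurable_funB.
have f0 (p : measurableTypeR R * R) : 0 <= y / ((p.1 - p.2) ^+ 2 + y ^+ 2).
  by rewrite divr_ge0 ?addr_ge0 ?sqr_ge0 // ltW.
have mD : measurable (`[b, +oo[%classic : set (measurableTypeR R)) by exact: measurable_itv.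
have T (mu : probability R R) : (\int[mu]_u (pi / 2 - atan ((b - u) / y))%:E =
    \int[leb]_(x in `[b, +oo[) (- complex.Im (Defs.cauchy mu (x +i* y)))%:E)%E.
  have := @fubini_tonelli_set _ _ (measurableTypeR R) R leb mu _ _ mD mf f0.
  under eq_integral => x _ do rewrite Im_cauchy //.
  by under [X in _ = X]eq_integral => u _ do rewrite poisson_tail //.
rewrite /Rintegral !T; congr fine; apply: eq_integral => x _.
by rewrite (ag x).
Qed.

Lemma stieltjes_inversion nu nu' (y0 : R) : 0 < y0 ->
  (forall x y, 0 < y <= y0 -> cauchy_agree nu nu' (x +i* y)) ->
  forall A : set R, measurable A -> nu A = nu' A.
Proof.
move=> y00 ag.
have tail b : nu `]b, +oo[%classic = nu' `]b, +oo[%classic.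
  (* The height shrinks faster than the shift to the right of b, so that at u = b the arctangent
     still tends to pi / 2: the limit is the indicator of the open half line, without half of an
     atom at b. *)
  pose bn n := b + n.+1%:R^-1; pose yn n := y0 / n.+1%:R ^+ 2.
  have n0 n : 0 < n.+1%:R :> R by rewrite ltr0n.
  have yp n : 0 < yn n by rewrite divr_gt0 // exprn_gt0.
  have yl n : yn n <= y0.
    by rewrite ler_pdivrMr ?exprn_gt0 // ler_peMr ?(ltW y00) // exprn_ege1 // ler1n.
  have E n := cauchy_agree_tail (yp n) (fun x => ag x (yn n) (introT andP (conj (yp n) (yl n)))) (bn n).
  pose g n u : R[i] := (pi / 2 - atan ((bn n - u) / yn n))%:C.
  pose gl u : R[i] := (pi * \1_(`]b, +oo[%classic : set R) u)%:C.
  have mg n : cmeasurable setT (g n).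
    apply: cmeasurableR; apply: measurable_funB => //; apply: measurableT_comp.
      by apply: continuous_measurable_fun => x; exact: continuous_atan.
    by apply: measurable_funM => //; apply: measurable_funB.
  have mgl : cmeasurable setT gl.
    by apply: cmeasurableR; apply: measurable_funM => //; exact: measurable_indic.
  have pi0 := @pi_gt0 R.
  have gb n u : normc (g n u) <= pi.
    rewrite normcR ler_norml.
    have := @atan_gtNpi2 R ((bn n - u) / yn n); have := @atan_ltpi2 R ((bn n - u) / yn n).
    by move=> h1 h2; apply/andP; split; lra.
  have glb u : normc (gl u) <= pi.
    rewrite normcR indicE; case: (_ \in _); rewrite ?mulr1 ?mulr0 ?normr0 ?(ltW pi0) //.
    by rewrite gtr0_norm.
  have gc u : normc (g n u - gl u) @[n --> \oo] --> (0 : R).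
    have nE n : normc (g n u - gl u) =
        `|pi / 2 - atan ((bn n - u) / yn n) - pi * \1_(`]b, +oo[%classic : set R) u|.
      by rewrite /g /gl -rmorphB normcR.
    under eq_fun do rewrite nE.
    apply/norm_cvg0P; rewrite indicE mem_setE in_itv /= andbT.
    have aE n : (bn n - u) / yn n = y0^-1 * ((b - u) * n.+1%:R ^+ 2 + n.+1%:R).
      by rewrite /bn /yn; field; rewrite !gt_eqF.
    under eq_fun do rewrite aE.
    have ninf : (n.+1%:R : R) @[n --> \oo] --> +oo%R.
      by apply/cvgryPge => A; near=> n; rewrite (le_trans _ (_ : n%:R <= _)) ?ler_nat //;
        near: n; exact: nbhs_infty_ger.
    have [ub|ub] := ltP b u; last first.
      have h : pi / 2 - atan (y0^-1 * ((b - u) * n.+1%:R ^+ 2 + n.+1%:R)) @[n --> \oo] -->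
          (pi / 2 - pi / 2 : R).
        apply: cvgB; first exact: cvg_cst.
        apply: (@cvg_comp _ _ _ _ atan _ _ _ _ (@cvgy_atan R)).
        apply/cvgryPge => A; near=> n.
        rewrite mulrC ler_pdivlMr //; apply: (@le_trans _ _ n.+1%:R).
          by near: n; move/cvgryPge: ninf; exact.
        by rewrite lerDr mulr_ge0 ?sqr_ge0 // subr_ge0.
      rewrite subrr in h; under eq_fun do rewrite mulr0 subr0; exact: h.
    have h : pi / 2 - - atan (y0^-1 * ((u - b) * n.+1%:R ^+ 2 - n.+1%:R)) - pi @[n --> \oo] -->
        (pi / 2 - - (pi / 2) - pi : R).
      apply: cvgB; last exact: cvg_cst.
      apply: cvgB; first exact: cvg_cst.
      apply: cvgN; apply: (@cvg_comp _ _ _ _ atan _ _ _ _ (@cvgy_atan R)).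
      apply/cvgryPge => A; near=> n.
      rewrite mulrC ler_pdivlMr //; apply: (@le_trans _ _ n.+1%:R).
        by near: n; move/cvgryPge: ninf; exact.
      have : 2 / (u - b) <= n.+1%:R by near: n; move/cvgryPge: ninf; exact.
      rewrite ler_pdivrMr ?subr_gt0 // => h.
      have := n0 n; move: (n.+1%:R : R) h => N h N0.
      have : 2 * N <= N * (u - b) * N by rewrite ler_wpM2r // ltW.
      have -> : (u - b) * N ^+ 2 = N * (u - b) * N by ring.
      lra.
    have e0 : pi / 2 - - (pi / 2) - pi = 0 :> R by field.
    rewrite e0 in h; apply: cvg_trans h; apply: near_eq_cvg; apply: nearW => n.
    by rewrite -atanN mulr1; congr (_ - atan _ - _); ring.
  have L (mu : probability R R) : normc (cint mu setT (g n) - cint mu setT gl) @[n --> \oo] --> (0 : R).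
    exact: (@cint_bdd_cvg _ _ _ mu g gl pi mg mgl gb glb gc).
  have glE (mu : probability R R) : cint mu setT gl = (pi * fine (mu `]b, +oo[%classic))%:C.
    rewrite /gl cint_real; congr (_%:C); rewrite RintegralZl //.
      by rewrite /Rintegral integral_indic // setIT.
    exact: integrable_indic.
  have gE n : cint nu setT (g n) = cint nu' setT (g n).
    by rewrite /g !cint_real E.
  have := L nu; under eq_fun do rewrite gE.
  move=> /(normc_cvg_unique (L nu')); rewrite !glE => /complexI /mulfI.
  rewrite gt_eqF // => /(_ isT) h.
  by rewrite -[LHS]fineK ?fin_num_measure // -[RHS]fineK ?fin_num_measure // -h.
apply: (measure_unique (@RGenOInfty.G R) (fun n => `]- n%:R, +oo[%classic)).
- exact: (@RGenOInfty.measurableE R).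
- move=> _ _ [x1 ->] [x2 ->]; exists (Num.max x1 x2).
  apply/seteqP; split => x /=; rewrite !in_itv /= !andbT gt_max.
    by move=> [-> ->].
  by move=> /andP[].
- by move=> n; exists (- n%:R).
- apply/seteqP; split => // x _; exists (Num.truncn `|x|).+1 => //=.
  rewrite in_itv /= andbT ltrNl (le_lt_trans _ (truncnS_gt _)) //.
  by rewrite -normrN ler_norm.
- by move=> _ [x ->]; exact: tail.
- by move=> n; rewrite ltey_eq fin_num_measure.
Unshelve. all: by end_near. Qed.

End StieltjesInversion.

(** * Uniqueness from the values on the imaginary axis *)

Section Uniqueness.
Variable R : realType.
Variables (a : R) (m : {finite_measure set R -> \bar R}).

Lemma voiculescu_imag_unique (nu nu' : probability R R) (V V' : R[i] -> R[i]) :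
  voiculescu_on_cone nu V -> voiculescu_on_cone nu' V' ->
  (forall t : R, 0 < t -> V ('i * t%:C) = kh_transform a m idfun ('i * t%:C)) ->
  (forall t : R, 0 < t -> V' ('i * t%:C) = kh_transform a m idfun ('i * t%:C)) ->
  forall A : set R, measurable A -> nu A = nu' A.
Proof.
move=> [al [be [al' [be' [/andP[al0 be0] /andP[al'0 be'0] _ hV]]]]].
move=> [ga [de [ga' [de' [/andP[ga0 de0] _ _ hV']]]]] E E'.
have e2 : 0 < 2^-1 :> R by rewrite invr_gt0.
have [Y [Y1 hY]] := kh_transform_small a m e2.
have mid : measurable_fun setT (idfun : R -> R) by exact: measurable_id.
have [_ hL] := hY idfun mid (fun x => lexx _).
pose w t : R[i] := 'i * t%:C + kh_transform a m idfun ('i * t%:C).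
have imE t : 'i * t%:C = 0 +i* t :> R[i] by apply: complex_eq => /=; ring.
pose T := Num.max (Num.max be de) Y.
have T0 : 0 < T by rewrite !lt_max be0.
have ag t : T < t -> 0 < complex.Im (w t) /\ cauchy_agree nu nu' (w t).
  rewrite !gt_max => /andP[/andP[t1 t2] t3]; have t0 : 0 < t by exact: lt_trans be0 t1.
  have c1 : cone al be ('i * t%:C).
    by rewrite imE; split; rewrite //= normr0 mulr_gt0.
  have c2 : cone ga de ('i * t%:C).
    by rewrite imE; split; rewrite //= normr0 mulr_gt0.
  have [[p1 _] F1] := hV _ c1; have [_ F2] := hV' _ c2.
  rewrite E // -/(w t) in p1 F1; rewrite E' // -/(w t) in F2.
  split; first exact: lt_trans p1.
  by rewrite /cauchy_agree -[LHS]invrK -[RHS]invrK -/(Ftr nu _) -/(Ftr nu' _) F1 F2.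
(* V has Lipschitz constant 1/2 here, so the curve w is injective above T and its points near w (T +
   1) really accumulate there. *)
have wd t u : T < t -> T < u -> normc (w t - w u - ('i * (t - u)%:C)) <= 2^-1 * `|t - u|.
  rewrite !gt_max => /andP[_ t3] /andP[_ u3].
  have cw v : Y < v -> wide_cone Y ('i * v%:C).
    move=> hv; have v0 : 0 < v by rewrite (lt_trans _ hv) // (lt_le_trans ltr01).
    by rewrite imE; split; rewrite //= normr0 mulr_ge0 // ltW.
  have := hL _ _ (cw t t3) (cw u u3).
  rewrite -mulrBr -rmorphB normcM normci mul1r normcR.
  by congr (normc _ <= _); rewrite /w rmorphB; ring.
have T1 : T < T + 1 by rewrite ltrDl.
have [wI _] := ag _ T1.
have acc : agree_accum nu nu' (w (T + 1)).
  move=> e e0; pose t := T + 1 + e / 2.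
  have tT : T < t by rewrite /t; lra.
  have td : t - (T + 1) = e / 2 by rewrite /t; ring.
  have := wd t (T + 1) tT T1; rewrite td [`|e / 2|]gtr0_norm ?divr_gt0 // => h.
  have nI : normc ('i * (e / 2)%:C : R[i]) = e / 2.
    by rewrite normcM normci mul1r normcR gtr0_norm // divr_gt0.
  exists (w t); split; last by case: (ag t tT).
    rewrite -subr_eq0 -normc_gt0.
    have := normc_sub_ge ('i * (e / 2)%:C) ('i * (e / 2)%:C - (w t - w (T + 1))).
    rewrite subKr nI (normcBC _ (w t - _)).
    by move=> h2; have := le_trans (lerB (lexx _) h) h2; lra.
  have := le_normcD (w t - w (T + 1) - 'i * (e / 2)%:C) ('i * (e / 2)%:C).
  rewrite subrK nI; lra.
case: (w _) acc wI => x0 y0 acc /= y00.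
exact: (stieltjes_inversion y00 (agree_accum_strip y00 acc)).
Qed.

End Uniqueness.

(** * Goursat theorem and identity theorem *)

Section SegmentIntegral.
Variable R : realType.
Implicit Types (g : R -> R[i]) (a b c s : R).
Local Notation leb := (@lebesgue_measure R).

Definition ccontinuous_at g s := forall e, 0 < e ->
  exists2 r, 0 < r & forall s', `|s' - s| < r -> normc (g s' - g s) <= e.

(** Half-open, so that adjacent segments are disjoint and splitting needs no null set. *)
Definition seg_int g a b : R[i] := cint leb `[a, b[ g.

Lemma ccontinuous_at_ReIm g s : ccontinuous_at g s ->
  {for s, continuous (fun s => complex.Re (g s))} /\
  {for s, continuous (fun s => complex.Im (g s))}.
Proof.
move=> cg; split; apply/cvgrPdist_lt => e e0; have e20 : 0 < e / 2 by rewrite divr_gt0.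
- have [r r0 hr] := cg _ e20; apply/nbhs_ballP; exists r => // s' /=.
  rewrite /ball /= distrC => /hr h.
  rewrite distrC -cReN -cReD (le_lt_trans (normc_Re _)) // (le_lt_trans h) //.
  by rewrite ltr_pdivrMr // ltr_pMr // ltr1n.
- have [r r0 hr] := cg _ e20; apply/nbhs_ballP; exists r => // s' /=.
  rewrite /ball /= distrC => /hr h.
  rewrite distrC -cImN -cImD (le_lt_trans (normc_Im _)) // (le_lt_trans h) //.
  by rewrite ltr_pdivrMr // ltr_pMr // ltr1n.
Qed.

Lemma cintegrable_seg g a b : (forall s, a <= s <= b -> ccontinuous_at g s) ->
  cintegrable leb `[a, b[ g.
Proof.
move=> cg.
have i1 : leb.-integrable `[a, b] (EFin \o (fun s => complex.Re (g s))).
  apply: continuous_compact_integrable; first exact: segment_compact.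
  apply: continuous_in_subspaceT => s; rewrite inE /= in_itv /= => /cg.
  by move=> /ccontinuous_at_ReIm[].
have i2 : leb.-integrable `[a, b] (EFin \o (fun s => complex.Im (g s))).
  apply: continuous_compact_integrable; first exact: segment_compact.
  apply: continuous_in_subspaceT => s; rewrite inE /= in_itv /= => /cg.
  by move=> /ccontinuous_at_ReIm[].
split.
- apply: integrableS i1 => //.
  by move=> x /=; rewrite !in_itv /= => /andP[-> /ltW ->].
- apply: integrableS i2 => //.
  by move=> x /=; rewrite !in_itv /= => /andP[-> /ltW ->].
Qed.

Lemma seg_int_split g a c b : a <= c -> c <= b -> cintegrable leb `[a, b[ g ->
  seg_int g a b = seg_int g a c + seg_int g c b.
Proof.
move=> ac cb ig.
have e : `[a, c[ `|` `[c, b[ = `[a, b[%classic :> set R.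
  by rewrite -itv_bndbnd_setU // bnd_simp.
rewrite /seg_int -e cint_setU //; first by rewrite e.
apply/disj_setPS => y [/=]; rewrite 2!in_itv/= => /andP[_ y1] /andP[y2 _].
by rewrite ltNge y2 in y1.
Qed.

Lemma lebesgue_seg a b : a <= b -> fine (leb `[a, b[) = b - a.
Proof.
rewrite le_eqVlt => /orP[/eqP ->|ab]; first by rewrite set_itvco0 measure0 subrr.
by rewrite lebesgue_measure_itv /= lte_fin ab.
Qed.

Lemma seg_int_cst k a b : a <= b -> seg_int (cst k) a b = k * (b - a)%:C.
Proof. by move=> ab; rewrite /seg_int cint_cst // lebesgue_seg. Qed.

Lemma normc_seg_int g a b (M : R) : a <= b -> cintegrable leb `[a, b[ g ->
  (forall s, a <= s <= b -> normc (g s) <= M) -> normc (seg_int g a b) <= M * (b - a).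
Proof.
move=> ab ig gM.
rewrite -(lebesgue_seg ab) -Rintegral_cst //.
apply: normc_cint_le => //.
  apply: (@integrableS _ _ _ leb `[a, b]) => //.
    by move=> x /=; rewrite !in_itv /= => /andP[-> /ltW ->].
  apply: continuous_compact_integrable; first exact: segment_compact.
  by apply: continuous_subspaceT => s; exact: cvg_cst.
by move=> s /=; rewrite in_itv /= => /andP[h1 /ltW h2]; apply: gM; rewrite h1.
Qed.

Lemma cintegrable_seg_cst k a b : cintegrable leb `[a, b[ (cst k).
Proof.
apply: cintegrable_seg => s _ e e0; exists 1 => // s' _.
by rewrite /= subrr normc0 ltW.
Qed.

Lemma seg_int_near_cst g k a b (M : R) : a <= b -> cintegrable leb `[a, b[ g ->
  (forall s, a <= s <= b -> normc (g s - k) <= M) ->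
  normc (seg_int g a b - k * (b - a)%:C) <= M * (b - a).
Proof.
move=> ab ig gM; rewrite -seg_int_cst // /seg_int -cintB //; last exact: cintegrable_seg_cst.
by apply: normc_seg_int => //; apply: cintegrableB => //; exact: cintegrable_seg_cst.
Qed.

End SegmentIntegral.

Lemma dyadic_half (R : realType) (u : R) n : u / 2 ^+ n.+1 + u / 2 ^+ n.+1 = u / 2 ^+ n.
Proof. by rewrite exprS; field; rewrite expf_neq0. Qed.

(** [P n x y] speaks of the n-th generation rectangle with lower left corner (x, y). Failure passes
    to one of the four quarters, and the nested corners have a common limit point. *)
Lemma bisection2 (R : realType) (w h x0 y0 : R) (P : nat -> R -> R -> Prop) :
  0 <= w -> 0 <= h -> ~ P 0 x0 y0 ->
  (forall n x y, P n.+1 x y -> P n.+1 (x + w / 2 ^+ n.+1) y ->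
     P n.+1 x (y + h / 2 ^+ n.+1) ->
     P n.+1 (x + w / 2 ^+ n.+1) (y + h / 2 ^+ n.+1) -> P n x y) ->
  exists xs ys, forall n, exists x y,
    [/\ ~ P n x y, x <= xs <= x + w / 2 ^+ n, y <= ys <= y + h / 2 ^+ n,
        x0 <= x /\ x + w / 2 ^+ n <= x0 + w & y0 <= y /\ y + h / 2 ^+ n <= y0 + h].
Proof.
move=> w0 h0 P0 step.
have half := @dyadic_half R.
have pos (u : R) n : 0 <= u -> 0 <= u / 2 ^+ n by move=> ?; rewrite divr_ge0 // exprn_ge0.
(* The premise sits under the existential, so that [choice] yields a total successor function. *)
have ex n (q : R * R) : exists q' : R * R, ~ P n q.1 q.2 -> [/\ ~ P n.+1 q'.1 q'.2,
    q.1 <= q'.1 /\ q'.1 + w / 2 ^+ n.+1 <= q.1 + w / 2 ^+ n &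
    q.2 <= q'.2 /\ q'.2 + h / 2 ^+ n.+1 <= q.2 + h / 2 ^+ n].
  have hw := half w n; have hh := half h n.
  have pw := pos _ n.+1 w0; have ph := pos _ n.+1 h0.
  have [|N1] := pselect (P n.+1 q.1 q.2); last first.
    by exists q => _; split => //; split; lra.
  have [|N2] := pselect (P n.+1 (q.1 + w / 2 ^+ n.+1) q.2); last first.
    by exists (q.1 + w / 2 ^+ n.+1, q.2) => _ /=; split => //; split; lra.
  have [|N3] := pselect (P n.+1 q.1 (q.2 + h / 2 ^+ n.+1)); last first.
    by exists (q.1, q.2 + h / 2 ^+ n.+1) => _ /=; split => //; split; lra.
  have [|N4] := pselect (P n.+1 (q.1 + w / 2 ^+ n.+1) (q.2 + h / 2 ^+ n.+1)); last first.
    by exists (q.1 + w / 2 ^+ n.+1, q.2 + h / 2 ^+ n.+1) => _ /=; split => //; split; lra.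
  by move=> ? ? ? ?; exists q => /(_ _)[]; apply: step.
have [nx nxP] := choice (fun nq : nat * (R * R) => ex nq.1 nq.2).
pose s := fix s n := if n is n'.+1 then nx (n', s n') else (x0, y0).
have sP n : ~ P n (s n).1 (s n).2.
  by elim: n => [//|n IH]; have [] := nxP (n, s n) IH.
have s1 n : (s n).1 <= (s n.+1).1 /\ (s n.+1).1 + w / 2 ^+ n.+1 <= (s n).1 + w / 2 ^+ n.
  by have [] := nxP (n, s n) (sP n).
have s2 n : (s n).2 <= (s n.+1).2 /\ (s n.+1).2 + h / 2 ^+ n.+1 <= (s n).2 + h / 2 ^+ n.
  by have [] := nxP (n, s n) (sP n).
have nested (u : nat -> R) (v : R) : 0 <= v ->
    (forall n, u n <= u n.+1 /\ u n.+1 + v / 2 ^+ n.+1 <= u n + v / 2 ^+ n) ->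
    exists us, forall n, [/\ u n <= us <= u n + v / 2 ^+ n, u 0%N <= u n &
      u n + v / 2 ^+ n <= u 0%N + v].
  move=> v0 hu.
  have up n k : u n <= u (n + k)%N.
    by elim: k => [|k IH]; rewrite ?addn0 // addnS (le_trans IH) //; case: (hu (n + k)%N).
  have dn n k : u (n + k)%N + v / 2 ^+ (n + k)%N <= u n + v / 2 ^+ n.
    elim: k => [|k IH]; rewrite ?addn0 // addnS (le_trans _ IH) //.
    by case: (hu (n + k)%N).
  have ub n k : u k <= u n + v / 2 ^+ n.
    have [kn|nk] := leqP k n.
      have := up k (n - k)%N; rewrite (subnKC kn) => /le_trans; apply.
      by rewrite lerDl pos.
    have := dn n (k - n)%N; rewrite (subnKC (ltnW nk)); apply: le_trans.
    by rewrite lerDl pos.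
  exists (sup (range u)) => n; split.
  - apply/andP; split.
      apply: ub_le_sup; last by exists n.
      by exists (u 0%N + v / 2 ^+ 0) => _ [k _ <-].
    by apply: ge_sup; [exists (u 0%N), 0%N|move=> _ [k _ <-]].
  - by have := up 0%N n; rewrite add0n.
  - by have := dn 0%N n; rewrite add0n expr0 invr1 mulr1.
have [xs hxs] := nested (fun n => (s n).1) w w0 s1.
have [ys hys] := nested (fun n => (s n).2) h h0 s2.
exists xs, ys => n; exists (s n).1, (s n).2.
by have [a1 a2 a3] := hxs n; have [b1 b2 b3] := hys n; split.
Qed.

Section Goursat.
Variable R : realType.
Variable f : R[i] -> R[i].
Hypothesis fD : forall z, 0 < complex.Im z -> exists d, cderiv f z d.
Implicit Types (x y s : R).
Local Notation leb := (@lebesgue_measure R).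

Lemma cderiv_continuous (g : R[i] -> R[i]) z d : cderiv g z d ->
  forall e : R, 0 < e -> exists2 r : R, 0 < r &
    forall h, normc h < r -> normc (g (z + h) - g z) <= e.
Proof.
move=> gd e e0; have [r r0 hr] := gd _ ltr01.
have K0 : 0 < normc d + 1 by rewrite ltr_wpDl ?normc_ge0.
exists (Num.min r (e / (normc d + 1))); first by rewrite lt_min r0 divr_gt0.
move=> h; rewrite lt_min ltr_pdivlMr // => /andP[/hr h1 h2].
rewrite -(subrK (d * h) (_ - _)) (le_trans (le_normcD _ _)) // normcM.
by move: h1 h2; rewrite mul1r; move: (normc h) (normc d) (normc _) => A B C; lra.
Qed.

Lemma hline_shift x y s : s +i* y = (x +i* y) + (s - x)%:C :> R[i].
Proof. by apply: complex_eq; rewrite /= ?addr0 // addrC subrK. Qed.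

Lemma vline_shift x y s : x +i* s = (x +i* y) + (0 +i* (s - y)) :> R[i].
Proof. by apply: complex_eq; rewrite /= ?addr0 // addrC subrK. Qed.

Lemma normc_imag y : normc (0 +i* y : R[i]) = `|y|.
Proof. by rewrite /= expr0n /= add0r sqrtr_sqr. Qed.

Lemma hline_continuous y s : 0 < y -> ccontinuous_at (fun s => f (s +i* y)) s.
Proof.
move=> y0 e e0; have [d fd] := fD (z := s +i* y) y0.
have [r r0 hr] := cderiv_continuous fd e0; exists r => // s' ss'.
by rewrite (hline_shift s y s') hr // normcR.
Qed.

Lemma vline_continuous x s : 0 < s -> ccontinuous_at (fun s => f (x +i* s)) s.
Proof.
move=> s0 e e0; have [d fd] := fD (z := x +i* s) s0.
have [r r0 hr] := cderiv_continuous fd e0; exists r => // s' ss'.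
by rewrite (vline_shift x s s') hr // normc_imag.
Qed.

Lemma hline_integrable y a b : 0 < y -> cintegrable leb `[a, b[ (fun s => f (s +i* y)).
Proof. by move=> y0; apply: cintegrable_seg => s _; exact: hline_continuous. Qed.

Lemma vline_integrable x a b : 0 < a -> cintegrable leb `[a, b[ (fun s => f (x +i* s)).
Proof.
move=> a0; apply: cintegrable_seg => s /andP[a_s _]; apply: vline_continuous.
exact: lt_le_trans a_s.
Qed.

Definition hint a b y := seg_int (fun s => f (s +i* y)) a b.
Definition vint a b x := seg_int (fun s => f (x +i* s)) a b.

(** The counterclockwise contour integral: dz is ds on horizontal sides and i ds on vertical
    ones. *)
Definition rect_int x1 x2 y1 y2 : R[i] :=
  hint x1 x2 y1 - hint x1 x2 y2 + 'i * (vint y1 y2 x2 - vint y1 y2 x1).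

(** Opposite sides are paired: bottom minus top is close to -ihd and right minus left to wd, each
    within 2 e (w + h). The linear parts cancel in the contour integral. *)
Lemma rect_int_local x y w h xs ys (d : R[i]) (e : R) : 0 < y -> 0 <= w -> 0 <= h ->
  x <= xs <= x + w -> y <= ys <= y + h ->
  (forall z, normc (z - (xs +i* ys)) <= w + h ->
     normc (f z - f (xs +i* ys) - d * (z - (xs +i* ys))) <= e * (w + h)) ->
  normc (rect_int x (x + w) y (y + h)) <= 2 * e * (w + h) ^+ 2.
Proof.
move=> y0 w0 h0 /andP[x1 x2] /andP[y1 y2] hE; set zs := xs +i* ys in hE.
have near s t : x <= s <= x + w -> y <= t <= y + h -> normc ((s +i* t) - zs) <= w + h.
  move=> /andP[s1 s2] /andP[t1 t2]; rewrite (le_trans (normc_le _)) //= lerD //;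
  by rewrite ler_norml; apply/andP; split; lra.
pose E z := f z - f zs - d * (z - zs).
have diff u v : normc (u - zs) <= w + h -> normc (v - zs) <= w + h ->
    normc (f u - f v - d * (u - v)) <= 2 * e * (w + h).
  move=> hu hv; have -> : f u - f v - d * (u - v) = E u - E v by rewrite /E; ring.
  by rewrite (le_trans (normcB _ _)) //; have := hE _ hu; have := hE _ hv; rewrite -/(E u) -/(E v); lra.
have yh0 : 0 < y + h by lra.
have I1 : hint x (x + w) y - hint x (x + w) (y + h) =
    seg_int (fun s => f (s +i* y) - f (s +i* (y + h))) x (x + w).
  by rewrite /seg_int cintB //; exact: hline_integrable.
have I2 : vint y (y + h) (x + w) - vint y (y + h) x =
    seg_int (fun s => f ((x + w) +i* s) - f (x +i* s)) y (y + h).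
  by rewrite /seg_int cintB //; exact: vline_integrable.
have B1 : normc (seg_int (fun s => f (s +i* y) - f (s +i* (y + h))) x (x + w) -
    d * (0 -i* h) * (x + w - x)%:C) <= 2 * e * (w + h) * (x + w - x).
  apply: seg_int_near_cst; first by lra.
    by apply: cintegrableB => //; exact: hline_integrable.
  move=> s sI; have -> : (0 -i* h : R[i]) = (s +i* y) - (s +i* (y + h)).
    by apply: complex_eq => /=; ring.
  by apply: diff; apply: near => //; apply/andP; split; lra.
have B2 : normc (seg_int (fun s => f ((x + w) +i* s) - f (x +i* s)) y (y + h) -
    d * w%:C * (y + h - y)%:C) <= 2 * e * (w + h) * (y + h - y).
  apply: seg_int_near_cst; first by lra.
    by apply: cintegrableB => //; exact: vline_integrable.
  move=> s sI; have -> : w%:C = ((x + w) +i* s) - (x +i* s) :> R[i].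
    by apply: complex_eq => /=; ring.
  by apply: diff; apply: near => //; apply/andP; split; lra.
rewrite /rect_int I1 I2; move: B1 B2; set S1 := seg_int _ _ _; set S2 := seg_int _ _ _.
rewrite [x + w - x]addrAC subrr add0r [y + h - y]addrAC subrr add0r => B1 B2.
have -> : S1 + 'i * S2 = (S1 - d * (0 -i* h) * w%:C) + 'i * (S2 - d * w%:C * h%:C).
  have -> : (0 -i* h : R[i]) = - ('i * h%:C) by apply: complex_eq => /=; ring.
  ring.
rewrite (le_trans (le_normcD _ _)) // normcM normci mul1r.
rewrite (le_trans (lerD B1 B2)) // -mulrDr expr2 mulrA //.
Qed.

Lemma rect_int_split x1 xm x2 y1 ym y2 : 0 < y1 -> x1 <= xm -> xm <= x2 ->
  y1 <= ym -> ym <= y2 ->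
  rect_int x1 x2 y1 y2 = rect_int x1 xm y1 ym + rect_int xm x2 y1 ym +
    rect_int x1 xm ym y2 + rect_int xm x2 ym y2.
Proof.
move=> y0 xa xb ya yb; rewrite /rect_int.
have y2p : 0 < y2 by lra.
rewrite /hint (@seg_int_split _ (fun s => f (s +i* y1)) x1 xm x2) //; last exact: hline_integrable.
rewrite (@seg_int_split _ (fun s => f (s +i* y2)) x1 xm x2) //; last exact: hline_integrable.
rewrite /vint (@seg_int_split _ (fun s => f (x1 +i* s)) y1 ym y2) //; last exact: vline_integrable.
rewrite (@seg_int_split _ (fun s => f (x2 +i* s)) y1 ym y2) //; last exact: vline_integrable.
ring.
Qed.

Lemma goursat x1 x2 y1 y2 : 0 < y1 -> x1 <= x2 -> y1 <= y2 -> rect_int x1 x2 y1 y2 = 0.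
Proof.
move=> y1p x12 y12; pose w := x2 - x1; pose h := y2 - y1.
have w0 : 0 <= w by rewrite subr_ge0.
have h0 : 0 <= h by rewrite subr_ge0.
have -> : x2 = x1 + w by rewrite /w addrC subrK.
have -> : y2 = y1 + h by rewrite /h addrC subrK.
clearbody w h.
have half := @dyadic_half R.
have pos (u : R) n : 0 <= u -> 0 <= u / 2 ^+ n by move=> ?; rewrite divr_ge0 // exprn_ge0.
have key e : 0 < e -> normc (rect_int x1 (x1 + w) y1 (y1 + h)) <= 2 * e * (w + h) ^+ 2.
  move=> e0; apply: contrapT => /negP; rewrite -ltNge => big.
  (* The bound scales by 1/4 per subdivision, so the bounds of four quarters add up to that of the
     whole and failure is inherited; [rect_int_local] refutes it at a small scale. *)
  pose P n x y := 0 < y ->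
    normc (rect_int x (x + w / 2 ^+ n) y (y + h / 2 ^+ n)) <=
    2 * e * ((w + h) / 2 ^+ n) ^+ 2.
  have NP0 : ~ P 0%N x1 y1.
    by rewrite /P !expr0 !divr1 => /(_ y1p); rewrite leNgt big.
  have [n x y p1 p2 p3 p4 y0|xs [ys hxy]] := bisection2 w0 h0 NP0.
    have pw := pos _ n.+1 w0; have ph := pos _ n.+1 h0.
    have hw := half w n; have hh := half h n.
    have y0' : 0 < y + h / 2 ^+ n.+1 by lra.
    rewrite (@rect_int_split x (x + w / 2 ^+ n.+1) _ y (y + h / 2 ^+ n.+1)) //; try lra.
    have := p1 y0; have := p2 y0; have := p3 y0'; have := p4 y0'.
    have ew t : t + w / 2 ^+ n.+1 + w / 2 ^+ n.+1 = t + w / 2 ^+ n by rewrite -addrA half.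
    have eh t : t + h / 2 ^+ n.+1 + h / 2 ^+ n.+1 = t + h / 2 ^+ n by rewrite -addrA half.
    rewrite !ew !eh => q4 q3 q2 q1.
    have -> : ((w + h) / 2 ^+ n) ^+ 2 = 4 * ((w + h) / 2 ^+ n.+1) ^+ 2.
      by rewrite -(half (w + h) n); ring.
    rewrite (le_trans (le_normcD _ _)) // (le_trans (lerD (le_normcD _ _) (lexx _))) //.
    rewrite (le_trans (lerD (lerD (le_normcD _ _) (lexx _)) (lexx _))) //.
    move: q1 q2 q3 q4; move: (normc _) (normc _) (normc _) (normc _) => A B C D.
    move: (_ ^+ 2) => Q; lra.
  have ysp : 0 < ys.
    by have [x [y [_ _ /andP[h1 _] _ [h2 _]]]] := hxy 0%N; lra.
  have [d fd] := fD (z := xs +i* ys) ysp.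
  have [r r0 hr] := fd _ e0.
  have [n hn] : exists n, (w + h) / 2 ^+ n < r.
    have : (w + h) * (2^-1) ^+ n @[n --> \oo] --> (0 : R).
      rewrite -[X in _ --> X](mulr0 (w + h)); apply: cvgMr; apply: cvg_expr.
      by rewrite ger0_norm ?invr_ge0 // invf_lt1 // ltr1n.
    move=> /cvgrPdist_lt/(_ _ r0)[n _ hn]; exists n; have := hn n (leqnn n).
    by rewrite /= sub0r normrN exprVn => /(le_lt_trans (ler_norm _)).
  have [x [y [NP hx hy _ [y1y _]]]] := hxy n.
  apply: NP => y0; rewrite (mulrDl w h).
  apply: (@rect_int_local _ _ _ _ xs ys d) => //; [exact: pos|exact: pos|].
  move=> z; rewrite -mulrDl => hz.
  have zE : (xs +i* ys) + (z - (xs +i* ys)) = z by rewrite addrC subrK.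
  have := hr (z - (xs +i* ys)) (le_lt_trans hz hn); rewrite zE => /le_trans; apply.
  by rewrite ler_wpM2l // ltW.
apply/eq0_normc/eqP; rewrite eq_le normc_ge0 andbT; apply/ler_addgt0Pr => e e0.
rewrite add0r.
have K0 : 0 < 2 * (w + h) ^+ 2 + 1 by rewrite ltr_wpDl // mulr_ge0 // sqr_ge0.
have e0' : 0 < e / (2 * (w + h) ^+ 2 + 1) by rewrite divr_gt0.
rewrite (le_trans (key _ e0')) // mulrAC mulrCA ler_piMr ?(ltW e0) //.
by rewrite ler_pdivrMr // mul1r lerDl.
Qed.


Variables (x0 y0 : R).
Hypothesis y00 : 0 < y0.

(** Integral of f along the path from x0 + i y0 that runs horizontally and then vertically. *)
Definition prim (z : R[i]) : R[i] :=
  hint x0 (complex.Re z) y0 + 'i * vint y0 (complex.Im z) (complex.Re z).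

(** Goursat's theorem enters here, through the rectangle between heights y0 and y; vertical
    increments of [prim] need only splitting of the segment. *)
Lemma primB_h x1 x2 y : x0 <= x1 -> x1 <= x2 -> y0 <= y ->
  prim (x2 +i* y) - prim (x1 +i* y) = hint x1 x2 y.
Proof.
move=> x01 x12 yy; apply/eqP; rewrite -subr_eq0 -(goursat y00 x12 yy); apply/eqP.
rewrite /prim /= /hint (@seg_int_split _ (fun s => f (s +i* y0)) x0 x1 x2) //.
  by rewrite /rect_int /hint; ring.
exact: hline_integrable.
Qed.

Lemma primB_v x y1 y2 : y0 <= y1 -> y1 <= y2 ->
  prim (x +i* y2) - prim (x +i* y1) = 'i * vint y1 y2 x.
Proof.
move=> y01 y12; rewrite /prim /= /vint.
rewrite (@seg_int_split _ (fun s => f (x +i* s)) y0 y1 y2) //; last exact: vline_integrable.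
ring.
Qed.

Lemma prim_hleg x x' y (k : R[i]) (M : R) : x0 <= x -> x0 <= x' -> y0 <= y ->
  (forall s, `|s - x| <= `|x' - x| -> normc (f (s +i* y) - k) <= M) ->
  normc (prim (x' +i* y) - prim (x +i* y) - k * (x' - x)%:C) <= M * `|x' - x|.
Proof.
move=> hx hx' hy hM; have yp : 0 < y by exact: lt_le_trans hy.
have [xx|/ltW xx] := leP x x'.
  rewrite primB_h // ger0_norm ?subr_ge0 //; apply: seg_int_near_cst => //.
    exact: hline_integrable.
  move=> s /andP[s1 s2]; apply: hM; rewrite ger0_norm ?subr_ge0 //.
  by rewrite ger0_norm ?subr_ge0 // lerB.
have -> : prim (x' +i* y) - prim (x +i* y) - k * (x' - x)%:C =
    - (prim (x +i* y) - prim (x' +i* y) - k * (x - x')%:C).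
  by rewrite !rmorphB /=; ring.
rewrite normcN primB_h // distrC ger0_norm ?subr_ge0 //; apply: seg_int_near_cst => //.
  exact: hline_integrable.
move=> s /andP[s1 s2]; apply: hM; rewrite distrC ger0_norm ?subr_ge0 //.
by rewrite distrC ger0_norm ?subr_ge0 // lerB.
Qed.

Lemma prim_vleg x y y' (k : R[i]) (M : R) : y0 <= y -> y0 <= y' ->
  (forall s, `|s - y| <= `|y' - y| -> normc (f (x +i* s) - k) <= M) ->
  normc (prim (x +i* y') - prim (x +i* y) - k * (0 +i* (y' - y))) <= M * `|y' - y|.
Proof.
move=> hy hy' hM.
have iE t : 0 +i* t = 'i * t%:C :> R[i] by apply: complex_eq => /=; ring.
have yp : 0 < y by exact: lt_le_trans hy.
have yp' : 0 < y' by exact: lt_le_trans hy'.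
rewrite iE mulrCA; have [yy|/ltW yy] := leP y y'.
  rewrite primB_v // -mulrBr normcM normci mul1r ger0_norm ?subr_ge0 //.
  apply: seg_int_near_cst => //; first exact: vline_integrable.
  move=> s /andP[s1 s2]; apply: hM; rewrite ger0_norm ?subr_ge0 //.
  by rewrite ger0_norm ?subr_ge0 // lerB.
have -> : prim (x +i* y') - prim (x +i* y) - 'i * (k * (y' - y)%:C) =
    - (prim (x +i* y) - prim (x +i* y') - 'i * (k * (y - y')%:C)).
  by rewrite !rmorphB /=; ring.
rewrite normcN primB_v // -mulrBr normcM normci mul1r distrC ger0_norm ?subr_ge0 //.
apply: seg_int_near_cst => //; first exact: vline_integrable.
move=> s /andP[s1 s2]; apply: hM; rewrite distrC ger0_norm ?subr_ge0 //.
by rewrite distrC ger0_norm ?subr_ge0 // lerB.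
Qed.

Lemma cderiv_prim z : x0 < complex.Re z -> y0 < complex.Im z -> cderiv prim z (f z).
Proof.
case: z => x y /= xx yy e e0; have e20 : 0 < e / 2 by rewrite divr_gt0.
have yp : 0 < y by exact: lt_trans yy.
have [d fd] := fD (z := x +i* y) yp.
have [r r0 hr] := cderiv_continuous fd e20.
exists (Num.min r (Num.min (x - x0) (y - y0))).
  by rewrite !lt_min r0 !subr_gt0 xx yy.
case=> hx hy; rewrite !lt_min => /and3P[h1 h2 h3].
have ax : `|hx| <= normc (hx +i* hy) := normc_Re (hx +i* hy).
have ay : `|hy| <= normc (hx +i* hy) := normc_Im (hx +i* hy).
set N := normc (hx +i* hy) in ax ay h1 h2 h3 *.
have -> : prim ((x +i* y) + (hx +i* hy)) - prim (x +i* y) - f (x +i* y) * (hx +i* hy) =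
    (prim ((x + hx) +i* (y + hy)) - prim (x +i* (y + hy)) -
       f (x +i* y) * ((x + hx) - x)%:C) +
    (prim (x +i* (y + hy)) - prim (x +i* y) - f (x +i* y) * (0 +i* ((y + hy) - y))).
  have -> : hx +i* hy = ((x + hx) - x)%:C + (0 +i* ((y + hy) - y)) :> R[i].
    by apply: complex_eq => /=; ring.
  have -> : (x +i* y) + (((x + hx) - x)%:C + (0 +i* ((y + hy) - y))) = (x + hx) +i* (y + hy) :> R[i].
    by apply: complex_eq => /=; ring.
  ring.
rewrite (le_trans (le_normcD _ _)) //.
have hx1 : - N <= hx <= N by rewrite -ler_norml.
have hy1 : - N <= hy <= N by rewrite -ler_norml.
move/andP: hx1 => [hx1 hx2]; move/andP: hy1 => [hy1 hy2].
have xE : x + hx - x = hx by ring.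
have yE : y + hy - y = hy by ring.
have B1 : normc (prim ((x + hx) +i* (y + hy)) - prim (x +i* (y + hy)) -
    f (x +i* y) * (x + hx - x)%:C) <= e / 2 * `|x + hx - x|.
  apply: prim_hleg; try lra.
  rewrite xE => s hs.
  have -> : s +i* (y + hy) = (x +i* y) + ((s - x) +i* hy) by apply: complex_eq => /=; ring.
  apply: hr; apply: le_lt_trans h1; rewrite /N /= ler_wsqrtr // lerD2r.
  by rewrite -(real_normK (num_real hx)) -(real_normK (num_real (s - x))) lerXn2r ?nnegrE.
have B2 : normc (prim (x +i* (y + hy)) - prim (x +i* y) -
    f (x +i* y) * (0 +i* (y + hy - y))) <= e / 2 * `|y + hy - y|.
  apply: prim_vleg; try lra.
  rewrite yE => s hs.
  have -> : x +i* s = (x +i* y) + (0 +i* (s - y)) by apply: complex_eq => /=; ring.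
  by apply: hr; rewrite normc_imag (le_lt_trans hs) // (le_lt_trans ay).
rewrite (le_trans (lerD B1 B2)) // xE yE.
have : e / 2 * `|hx| <= e / 2 * N by rewrite ler_wpM2l // ltW.
have : e / 2 * `|hy| <= e / 2 * N by rewrite ler_wpM2l // ltW.
lra.
Qed.

(** The linear term of the integrand is kept, because its quadratic contribution is what the cross
    difference of the primitive has to cancel. *)
Lemma seg_int_affine (g : R -> R[i]) (k d : R[i]) a b c (M : R) : a <= b ->
  cintegrable leb `[a, b[ g ->
  (forall s, a <= s <= b -> normc (g s - k - d * (s - c)%:C) <= M) ->
  normc (seg_int g a b - k * (b - a)%:C -
         d * (((b - c) ^+ 2 - (a - c) ^+ 2) / 2)%:C) <= M * (b - a).
Proof.
move=> ab ig gM.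
have il : cintegrable leb `[a, b[ (fun s => (s - c)%:C : R[i]).
  apply: cintegrable_seg => s _ e e0; exists e => // s' /ltW.
  by rewrite -rmorphB normcR (_ : s' - c - (s - c) = s' - s) //; ring.
have lE : seg_int (fun s => (s - c)%:C) a b = (((b - c) ^+ 2 - (a - c) ^+ 2) / 2)%:C.
  rewrite /seg_int cint_real; congr (_%:C).
  move: ab; rewrite le_eqVlt => /orP[/eqP ->|ab].
    by rewrite set_itvco0 Rintegral_set0 subrr mul0r.
  rewrite Rintegral_itv_bndo_bndc; last by case: il.
  pose F s : R := (s - c) ^+ 2 / 2.
  have dF s : is_derive s 1 F (s - c).
    by apply: is_derive_eq; rewrite !scaler0 add0r subr0 /GRing.scale /=; field.
  have cF : continuous F.
    by move=> s; apply/differentiable_continuous/derivable1_diffP; case: (dF s).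
  rewrite /Rintegral (@continuous_FTC2 _ _ F) //.
  - by rewrite /F /=; field.
  - by apply: continuous_subspaceT => s; apply: cvgB => //; exact: cvg_cst.
  - split; first by move=> s _; case: (dF s).
      by apply: cvg_at_right_filter; exact: cF.
    by apply: cvg_at_left_filter; exact: cF.
  - by move=> s _; rewrite derive1E; have [_ ->] := dF s.
rewrite -lE -seg_int_cst // -addrA -opprD.
have -> : d * seg_int (fun s => (s - c)%:C) a b = seg_int (fun s => d * (s - c)%:C) a b.
  by rewrite /seg_int cintZ.
rewrite /seg_int -cintD //; [|exact: cintegrable_seg_cst|exact: cintegrableZ].
rewrite -cintB //; last first.
  by apply: cintegrableD => //; [exact: cintegrable_seg_cst|exact: cintegrableZ].
apply: normc_seg_int => //.
  apply: cintegrableB => //; apply: cintegrableD => //; last exact: cintegrableZ.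
  exact: cintegrable_seg_cst.
by move=> s sI; rewrite opprD addrA; exact: gM.
Qed.

(** The five-point discrete Laplacian, not divided by t^2. *)
Definition cross_diff (F : R[i] -> R[i]) z t : R[i] :=
  F (z + t%:C) + F (z - t%:C) + F (z + (0 +i* t)) + F (z - (0 +i* t)) - 4 * F z.

(* A weak form of harmonicity: it is preserved by products of differentiable functions and
   suffices for the maximum principle, without any regularity of the derivative. *)
Definition cross_harmonic (F : R[i] -> R[i]) z := forall e : R, 0 < e ->
  exists2 r : R, 0 < r & forall t, 0 < t < r -> normc (cross_diff F z t) <= e * t ^+ 2.

(** The first-order expansion of f integrates to second-order terms of the primitive: the horizontal
    legs give d t^2 and the vertical ones i^2 d t^2, which cancel. *)
Lemma cross_harmonic_prim z : x0 < complex.Re z -> y0 < complex.Im z ->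
  cross_harmonic prim z.
Proof.
case: z => x y /= xx yy e e0; have e40 : 0 < e / 4 by rewrite divr_gt0.
have yp : 0 < y by exact: lt_trans yy.
have [d fd] := fD (z := x +i* y) yp.
have [r r0 hr] := fd _ e40.
exists (Num.min r (Num.min (x - x0) (y - y0))).
  by rewrite !lt_min r0 !subr_gt0 xx yy.
move=> t /andP[t0]; rewrite !lt_min => /and3P[h1 h2 h3].
set k := f (x +i* y) in hr.
have nearx h : normc h <= t -> normc (f ((x +i* y) + h) - k - d * h) <= e / 4 * t.
  by move=> ht; rewrite (le_trans (hr _ (le_lt_trans ht h1))) // ler_wpM2l // ltW.
have nh s : x - t <= s <= x + t -> normc (f (s +i* y) - k - d * (s - x)%:C) <= e / 4 * t.
  move=> /andP[s1 s2]; rewrite (hline_shift x y s); apply: nearx.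
  by rewrite normcR ler_norml; apply/andP; split; lra.
have nv s : y - t <= s <= y + t ->
    normc (f (x +i* s) - k - ('i * d) * (s - y)%:C) <= e / 4 * t.
  move=> /andP[s1 s2]; rewrite (vline_shift x y s).
  have -> : 'i * d * (s - y)%:C = d * (0 +i* (s - y)).
    by have -> : 0 +i* (s - y) = 'i * (s - y)%:C :> R[i]; [apply: complex_eq => /=; ring|ring].
  by apply: nearx; rewrite normc_imag ler_norml; apply/andP; split; lra.
have t2 : e / 4 * t * t = e / 4 * t ^+ 2 by ring.
have A1 : normc (hint x (x + t) y - k * t%:C - d * (t ^+ 2 / 2)%:C) <= e / 4 * t ^+ 2.
  have := @seg_int_affine (fun s => f (s +i* y)) k d x (x + t) x (e / 4 * t) _ (hline_integrable _ _ yp) _.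
  rewrite subrr expr0n /= subr0 [x + t - x]addrAC subrr add0r t2; apply; first by lra.
  by move=> s /andP[s1 s2]; apply: nh; apply/andP; split; lra.
have A2 : normc (hint (x - t) x y - k * t%:C + d * (t ^+ 2 / 2)%:C) <= e / 4 * t ^+ 2.
  have := @seg_int_affine (fun s => f (s +i* y)) k d (x - t) x x (e / 4 * t) _ (hline_integrable _ _ yp) _.
  rewrite subrr expr0n /= sub0r [x - t - x]addrAC subrr add0r sqrrN mulNr rmorphN /= mulrN opprK opprB.
  rewrite [_ + (t - _)]addrC subrK t2; apply; first by lra.
  by move=> s /andP[s1 s2]; apply: nh; apply/andP; split; lra.
have ym : 0 < y - t by rewrite subr_gt0 (lt_trans h3) // gtrBl.
have B1 : normc (vint y (y + t) x - k * t%:C - 'i * d * (t ^+ 2 / 2)%:C) <= e / 4 * t ^+ 2.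
  have := @seg_int_affine (fun s => f (x +i* s)) k ('i * d) y (y + t) y (e / 4 * t) _ (vline_integrable _ _ yp) _.
  rewrite subrr expr0n /= subr0 [y + t - y]addrAC subrr add0r t2; apply; first by lra.
  by move=> s /andP[s1 s2]; apply: nv; apply/andP; split; lra.
have B2 : normc (vint (y - t) y x - k * t%:C + 'i * d * (t ^+ 2 / 2)%:C) <= e / 4 * t ^+ 2.
  have := @seg_int_affine (fun s => f (x +i* s)) k ('i * d) (y - t) y y (e / 4 * t) _ (vline_integrable _ _ ym) _.
  rewrite subrr expr0n /= sub0r [y - t - y]addrAC subrr add0r sqrrN mulNr rmorphN /= mulrN opprK opprB.
  rewrite [_ + (t - _)]addrC subrK t2; apply; first by lra.
  by move=> s /andP[s1 s2]; apply: nv; apply/andP; split; lra.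
have E1 : prim ((x +i* y) + t%:C) - prim (x +i* y) = hint x (x + t) y.
  rewrite -primB_h //; [|lra|lra|lra].
  by congr (prim _ - _); apply: complex_eq => /=; ring.
have E2 : prim (x +i* y) - prim ((x +i* y) - t%:C) = hint (x - t) x y.
  rewrite -primB_h //; [|lra|lra|lra].
  by congr (_ - prim _); apply: complex_eq => /=; ring.
have E3 : prim ((x +i* y) + (0 +i* t)) - prim (x +i* y) = 'i * vint y (y + t) x.
  rewrite -primB_v //; [|lra|lra].
  by congr (prim _ - _); apply: complex_eq => /=; ring.
have E4 : prim (x +i* y) - prim ((x +i* y) - (0 +i* t)) = 'i * vint (y - t) y x.
  rewrite -primB_v //; [|lra|lra].
  by congr (_ - prim _); apply: complex_eq => /=; ring.
have -> : cross_diff prim (x +i* y) t =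
    (hint x (x + t) y - k * t%:C - d * (t ^+ 2 / 2)%:C) -
    (hint (x - t) x y - k * t%:C + d * (t ^+ 2 / 2)%:C) +
    ('i * (vint y (y + t) x - k * t%:C - 'i * d * (t ^+ 2 / 2)%:C) -
    'i * (vint (y - t) y x - k * t%:C + 'i * d * (t ^+ 2 / 2)%:C)).
  rewrite -E1 -E2 [in RHS]mulrBr [in RHS]mulrBr [in RHS]mulrDr [in RHS]mulrBr -E3 -E4.
  have ii : 'i * ('i * d * (t ^+ 2 / 2)%:C) = - (d * (t ^+ 2 / 2)%:C) :> R[i].
    by rewrite !mulrA -expr2 sqr_i mulN1r mulNr.
  rewrite ii /cross_diff; ring.
rewrite (le_trans (le_normcD _ _)) // (le_trans (lerD (normcB _ _) (normcB _ _))) //.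
rewrite !normcM normci !mul1r; lra.
Qed.

End Goursat.

(** * Products of differentiable cross-harmonic functions *)

Section CrossHarmonicAlgebra.
Variable R : realType.
Implicit Types (F G : R[i] -> R[i]) (z h c : R[i]).

Definition holo2 F z := (exists d, cderiv F z d) /\ cross_harmonic F z.

(** The sums of h and of h^2 over the four directions t, -t, it, -it vanish, so a second-order
    expansion leaves only its error. *)
Lemma holo2_taylor F z (a1 a2 : R[i]) :
  (forall e : R, 0 < e -> exists2 r : R, 0 < r & forall h, normc h < r ->
    normc (F (z + h) - F z - a1 * h - a2 * h ^+ 2) <= e * normc h ^+ 2) ->
  holo2 F z.
Proof.
move=> hF; split.
  exists a1 => e e0; have [r r0 hr] := hF _ e0.
  have K0 : 0 < normc a2 + e + 1 by rewrite ltr_wpDl // addr_ge0 ?normc_ge0 // ltW.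
  exists (Num.min r (e / (normc a2 + e + 1))); first by rewrite lt_min r0 divr_gt0.
  move=> h; rewrite lt_min ltr_pdivlMr // => /andP[/hr h1 h2].
  rewrite -(subrK (a2 * h ^+ 2) (_ - a1 * h)) (le_trans (le_normcD _ _)) //.
  rewrite normcM normcX.
  have h0 := normc_ge0 h; have a0 := normc_ge0 a2.
  move: h1 h2 h0 a0; move: (normc h) (normc a2) (normc _) => A B C h1 h2 h0 a0.
  rewrite (le_trans (lerD h1 (lexx _))) //.
  have -> : e * A ^+ 2 + B * A ^+ 2 = (A * (B + e)) * A by ring.
  by rewrite ler_wpM2r //; lra.
move=> e e0; have e40 : 0 < e / 4 by rewrite divr_gt0.
have [r r0 hr] := hF _ e40; exists r => // t /andP[t0 tr].
have nt : normc (t%:C : R[i]) = t by rewrite normcR gtr0_norm.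
have ni : normc (0 +i* t : R[i]) = t by rewrite normc_imag gtr0_norm.
have := hr t%:C; have := hr (- t%:C); have := hr (0 +i* t); have := hr (- (0 +i* t)).
rewrite !normcN nt ni => /(_ tr) B4 /(_ tr) B3 /(_ tr) B2 /(_ tr) B1.
have iE : 0 +i* t = 'i * t%:C :> R[i] by apply: complex_eq => /=; ring.
set E1 := (_ - _ - _ - _) in B1; set E2 := (_ - _ - _ - _) in B2.
set E3 := (_ - _ - _ - _) in B3; set E4 := (_ - _ - _ - _) in B4.
have -> : cross_diff F z t = E1 + E2 + (E3 + E4).
  have ii : (0 +i* t) ^+ 2 = - (t%:C ^+ 2) :> R[i].
    by rewrite iE exprMn sqr_i mulN1r.
  by rewrite /E1 /E2 /E3 /E4 /cross_diff !sqrrN ii; ring.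
rewrite (le_trans (le_normcD _ _)) // (le_trans (lerD (le_normcD _ _) (le_normcD _ _))) //.
lra.
Qed.

Lemma holo2_local0 F z (r : R) : 0 < r -> (forall h, normc h < r -> F (z + h) = 0) ->
  holo2 F z.
Proof.
move=> r0 hr; apply: (@holo2_taylor F z 0 0) => e e0; exists r => // h hh.
rewrite hr // -[z]addr0 hr ?normc0 // !mul0r !subrr normc0.
by rewrite mulr_ge0 ?exprn_ge0 ?normc_ge0 // ltW.
Qed.

Lemma holo2_inv c z : z != c -> holo2 (fun z => (z - c)^-1) z.
Proof.
move=> zc; set u := z - c; have u0 : u != 0 by rewrite subr_eq0.
have nu0 : 0 < normc u by rewrite normc_gt0.
apply: (@holo2_taylor _ z (- (u^-1 ^+ 2)) (u^-1 ^+ 3)) => e e0.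
pose K := 2 * (normc u)^-1 ^+ 4.
have K0 : 0 < K by rewrite mulr_gt0 // exprn_gt0 // invr_gt0.
exists (Num.min (normc u / 2) (e / K)); first by rewrite lt_min !divr_gt0.
move=> h; rewrite lt_min ltr_pdivlMr // => /andP[h1 h2].
have uh : normc u / 2 <= normc (u + h).
  have := normc_sub_ge u (- h); rewrite normcN opprK; lra.
have uh0 : u + h != 0 by rewrite -normc_gt0 (lt_le_trans _ uh) // divr_gt0.
have -> : z + h - c = u + h by rewrite /u; ring.
have -> : (u + h)^-1 - u^-1 - - u^-1 ^+ 2 * h - u^-1 ^+ 3 * h ^+ 2 =
    - (u^-1 ^+ 3 * (u + h)^-1 * h) * h ^+ 2.
  by field; rewrite u0 uh0.
rewrite normcM normcX normcN ler_wpM2r ?exprn_ge0 ?normc_ge0 //.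
rewrite [normc (_ * h)]normcM [normc (_ / _)]normcM normcX !normcV.
have : (normc (u + h))^-1 <= 2 * (normc u)^-1.
  by rewrite -[leRHS]invrK invfM invrK lef_pV2 ?posrE ?mulr_gt0 ?invr_gt0 ?normc_gt0 // mulrC.
move=> i1; have p3 : 0 <= (normc u)^-1 ^+ 3 by rewrite exprn_ge0 // invr_ge0 normc_ge0.
rewrite (le_trans (ler_wpM2r (normc_ge0 h) (ler_wpM2l p3 i1))) //.
have -> : (normc u)^-1 ^+ 3 * (2 * (normc u)^-1) * normc h = normc h * K by rewrite /K; ring.
by rewrite -ler_pdivlMr // ltW.
Qed.

(** The cross difference of FG is F times that of G, plus G times that of F, plus the products of
    increments. These are f g h^2 up to o(t^2) by differentiability, and h^2 sums to zero over the
    four directions. *)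
Lemma holo2M F G z : holo2 F z -> holo2 G z -> holo2 (fun z => F z * G z) z.
Proof.
move=> [[f Ff] Fl] [[g Gg] Gl]; split.
  exists (f * G z + F z * g) => e e0.
  pose K := normc (G z) + normc (F z) + (normc f + 1) * (normc g + 1) + 1.
  have K0 : 0 < K.
    by rewrite ltr_wpDl // !addr_ge0 ?normc_ge0 // mulr_ge0 ?addr_ge0 ?normc_ge0.
  have e1 : 0 < Num.min 1 (e / K) by rewrite lt_min ltr01 divr_gt0.
  have [r1 r10 h1] := Ff _ e1; have [r2 r20 h2] := Gg _ e1.
  exists (Num.min (Num.min r1 r2) (e / K)); first by rewrite !lt_min r10 r20 divr_gt0.
  move=> h; rewrite !lt_min => /andP[/andP[hr1 hr2] hK].
  have {h1} := h1 _ hr1; have {h2} := h2 _ hr2.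
  set EG := (_ - _ - _); set EF := (_ - _ - _) => hG hF.
  have -> : F (z + h) * G (z + h) - F z * G z - (f * G z + F z * g) * h =
      EF * G z + F z * EG + (f * h + EF) * (g * h + EG) by rewrite /EF /EG; ring.
  have m1 : Num.min 1 (e / K) <= 1 by rewrite ge_min lexx.
  have m2 : Num.min 1 (e / K) <= e / K by rewrite ge_min lexx orbT.
  have h0 := normc_ge0 h.
  have hF1 : normc EF <= e / K * normc h by rewrite (le_trans hF) // ler_wpM2r.
  have hG1 : normc EG <= e / K * normc h by rewrite (le_trans hG) // ler_wpM2r.
  have hF2 : normc (f * h + EF) <= (normc f + 1) * normc h.
    by rewrite (le_trans (le_normcD _ _)) // normcM mulrDl lerD2l (le_trans hF) // ler_wpM2r.
  have hG2 : normc (g * h + EG) <= (normc g + 1) * normc h.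
    by rewrite (le_trans (le_normcD _ _)) // normcM mulrDl lerD2l (le_trans hG) // ler_wpM2r.
  rewrite (le_trans (le_normcD _ _)) // (le_trans (lerD (le_normcD _ _) (lexx _))) //.
  rewrite !normcM.
  have b1 : normc EF * normc (G z) <= e / K * normc h * normc (G z) by rewrite ler_wpM2r ?normc_ge0.
  have b2 : normc (F z) * normc EG <= normc (F z) * (e / K * normc h) by rewrite ler_wpM2l ?normc_ge0.
  have b3 : normc (f * h + EF) * normc (g * h + EG) <=
      (normc f + 1) * normc h * ((normc g + 1) * normc h) by rewrite ler_pM ?normc_ge0.
  have b4 : (normc f + 1) * normc h * ((normc g + 1) * normc h) <=
      (normc f + 1) * (normc g + 1) * (e / K) * normc h.
    have -> : (normc f + 1) * normc h * ((normc g + 1) * normc h) =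
        (normc f + 1) * (normc g + 1) * normc h * normc h by ring.
    by rewrite ler_wpM2r // ler_wpM2l ?(ltW hK) // mulr_ge0 ?addr_ge0 ?normc_ge0.
  have bK : e / K * normc h * (normc (G z) + normc (F z) + (normc f + 1) * (normc g + 1)) <= e * normc h.
    rewrite [leLHS](_ : _ = (normc (G z) + normc (F z) + (normc f + 1) * (normc g + 1)) / K * (e * normc h)); last by ring.
    by rewrite ler_piMl ?mulr_ge0 ?(ltW e0) // ler_pdivrMr // mul1r lerDl.
  lra.
move=> e e0.
pose K := normc (F z) + normc (G z) + 4 * (normc f + normc g + 1).
have K0 : 0 < K + 1.
  by rewrite ltr_wpDl // !addr_ge0 ?normc_ge0 // mulr_ge0 ?addr_ge0 ?normc_ge0.
have e1 : 0 < Num.min 1 (e / (K + 1)) by rewrite lt_min ltr01 divr_gt0.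
have [r1 r10 h1] := Ff _ e1; have [r2 r20 h2] := Gg _ e1.
have [r3 r30 h3] := Fl _ e1; have [r4 r40 h4] := Gl _ e1.
exists (Num.min (Num.min r1 r2) (Num.min r3 r4)); first by rewrite !lt_min r10 r20 r30 r40.
move: e1 h1 h2 h3 h4; set q := Num.min 1 _ => e1 h1 h2 h3 h4.
have m1 : q <= 1 by rewrite ge_min lexx.
have m2 : q <= e / (K + 1) by rewrite ge_min lexx orbT.
move=> t; rewrite !lt_min => /andP[t0 /andP[/andP[t1 t2] /andP[t3 t4]]].
have {h3} L1 := h3 t; rewrite t0 t3 in L1; have {L1} L1 := L1 isT.
have {h4} L2 := h4 t; rewrite t0 t4 in L2; have {L2} L2 := L2 isT.
have prod h : normc h = t ->
    normc ((F (z + h) - F z) * (G (z + h) - G z) - f * g * h ^+ 2) <=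
    q * (normc f + normc g + 1) * t ^+ 2.
  move=> ht; have := h1 h; have := h2 h; rewrite ht => /(_ t2) b2 /(_ t1) b1.
  set EF := F _ - F _ - _ in b1; set EG := G _ - G _ - _ in b2.
  have -> : (F (z + h) - F z) * (G (z + h) - G z) - f * g * h ^+ 2 =
     f * h * EG + EF * (g * h) + EF * EG by rewrite /EF /EG; ring.
  rewrite (le_trans (le_normcD _ _)) // (le_trans (lerD (le_normcD _ _) (lexx _))) //.
  rewrite !normcM ht.
  have c1 : normc f * t * normc EG <= normc f * t * (q * t).
    by rewrite ler_wpM2l // mulr_ge0 ?normc_ge0 // ltW.
  have c2 : normc EF * (normc g * t) <= q * t * (normc g * t).
    by rewrite ler_wpM2r // mulr_ge0 ?normc_ge0 // ltW.
  have c3 : normc EF * normc EG <= q * t * (1 * t).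
    by rewrite ler_pM ?normc_ge0 // (le_trans b2) // ler_wpM2r // (ltW t0).
  rewrite (le_trans (lerD (lerD c1 c2) c3)) // le_eqVlt; apply/orP; left; apply/eqP; ring.
have nt : normc (t%:C : R[i]) = t by rewrite normcR gtr0_norm.
have ni : normc (0 +i* t : R[i]) = t by rewrite normc_imag gtr0_norm.
have p1 := prod _ nt; have p2 := prod (- t%:C); rewrite normcN nt in p2; have {p2} p2 := p2 erefl.
have p3 := prod _ ni; have p4 := prod (- (0 +i* t)); rewrite normcN ni in p4; have {p4} p4 := p4 erefl.
have iE : 0 +i* t = 'i * t%:C :> R[i] by apply: complex_eq => /=; ring.
have ii : (0 +i* t) ^+ 2 = - (t%:C ^+ 2) :> R[i] by rewrite iE exprMn sqr_i mulN1r.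
set P1 := (_ * _ - _) in p1; set P2 := (_ * _ - _) in p2.
set P3 := (_ * _ - _) in p3; set P4 := (_ * _ - _) in p4.
have -> : cross_diff (fun z => F z * G z) z t =
    F z * cross_diff G z t + G z * cross_diff F z t + ((P1 + P2) + (P3 + P4)).
  by rewrite /P1 /P2 /P3 /P4 /cross_diff !sqrrN ii; ring.
rewrite (le_trans (le_normcD _ _)) // (le_trans (lerD (le_normcD _ _) (le_normcD _ _))) //.
rewrite (le_trans (lerD (lexx _) (lerD (le_normcD _ _) (le_normcD _ _)))) //.
rewrite !normcM.
have c1 : normc (F z) * normc (cross_diff G z t) <= normc (F z) * (q * t ^+ 2).
  by rewrite ler_wpM2l ?normc_ge0.
have c2 : normc (G z) * normc (cross_diff F z t) <= normc (G z) * (q * t ^+ 2).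
  by rewrite ler_wpM2l ?normc_ge0.
have c3 : q * K * t ^+ 2 <= e * t ^+ 2.
  rewrite ler_wpM2r ?sqr_ge0 // (le_trans (ler_wpM2r _ m2)) //.
    by rewrite !addr_ge0 ?normc_ge0 // mulr_ge0 ?addr_ge0 ?normc_ge0.
  by rewrite mulrAC ler_pdivrMr // ler_wpM2l ?(ltW e0) // lerDl.
have c4 : q * K * t ^+ 2 = normc (F z) * (q * t ^+ 2) + normc (G z) * (q * t ^+ 2) +
   4 * (q * (normc f + normc g + 1) * t ^+ 2) by rewrite /K; ring.
lra.
Qed.

Lemma holo2_exp F z n : holo2 F z -> holo2 (fun z => F z ^+ n) z.
Proof.
move=> hF; elim: n => [|n IH].
  apply: (@holo2_taylor _ z 0 0) => e e0; exists 1 => // h _.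
  by rewrite !expr0 !mul0r !subrr normc0 mulr_ge0 ?exprn_ge0 ?normc_ge0 // ltW.
by under eq_fun do rewrite exprS; exact: holo2M.
Qed.

End CrossHarmonicAlgebra.

Section MaximumPrinciple.
Variable R : realType.
Implicit Types (F G : R[i] -> R[i]) (x y : R).

Lemma holo2_continuous_Re G (k : R[i]) x y : holo2 G (x +i* y) ->
  {for (x, y), continuous (fun p : R * R => complex.Re (k * G (p.1 +i* p.2)))}.
Proof.
move=> [[d Gd] _]; apply/cvgrPdist_lt => e e0.
have K0 : 0 < normc k + 1 by rewrite ltr_wpDl ?normc_ge0.
have e1 : 0 < e / (normc k + 1) by rewrite divr_gt0.
have [r r0 hr] := cderiv_continuous Gd e1.
have r20 : 0 < r / 2 by rewrite divr_gt0.
exists (ball x (r / 2), ball y (r / 2)).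
  by split; exact: nbhsx_ballx.
move=> [x' y'] /=; rewrite /ball /= => -[h1 h2].
rewrite distrC -cReN -cReD -mulrBr (le_lt_trans (normc_Re _)) // normcM.
have -> : x' +i* y' = (x +i* y) + ((x' - x) +i* (y' - y)) :> R[i].
  by apply: complex_eq => /=; ring.
have nr : normc ((x' - x) +i* (y' - y)) < r.
  by rewrite (le_lt_trans (normc_le _)) //= [`|x' - x|]distrC [`|y' - y|]distrC; lra.
rewrite (le_lt_trans (ler_wpM2l (normc_ge0 k) (hr _ nr))) //.
by rewrite mulrCA gtr_pMr // ltr_pdivrMr // mul1r ltrDl.
Qed.

Lemma quadratic_continuous (e c d : R) (p : R * R) :
  {for p, continuous (fun p : R * R => e * ((p.1 - c) ^+ 2 + (p.2 - d) ^+ 2))}.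
Proof.
have c1 : (q.1 - c) @[q --> p] --> p.1 - c.
  by apply: cvgB; [exact: cvg_fst|exact: cvg_cst].
have c2 : (q.2 - d) @[q --> p] --> p.2 - d.
  by apply: cvgB; [exact: cvg_snd|exact: cvg_cst].
by apply: cvgM; [exact: cvg_cst|apply: cvgD; rewrite expr2; apply: cvgM].
Qed.

(** At a point with |G| > M, a unimodular k makes kG real positive; a small multiple of the squared
    distance to a corner is added to Re (kG). At the resulting interior maximum the cross difference
    is nonpositive, yet it is at least 4 e t^2 - e t^2. *)
Lemma maximum_principle G (x1 x2 y1 y2 M : R) :
  (forall x y, x1 <= x <= x2 -> y1 <= y <= y2 -> holo2 G (x +i* y)) ->
  (forall x y, x1 <= x <= x2 -> y1 <= y <= y2 ->
     [\/ x = x1, x = x2, y = y1 | y = y2] -> normc (G (x +i* y)) <= M) ->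
  forall x y, x1 <= x <= x2 -> y1 <= y <= y2 -> normc (G (x +i* y)) <= M.
Proof.
move=> Gh GM xa ya xaI yaI; rewrite leNgt; apply/negP => big.
have x12 : x1 <= x2 by case/andP: xaI => /le_trans; apply.
have y12 : y1 <= y2 by case/andP: yaI => /le_trans; apply.
have M0 : 0 <= M.
  apply: le_trans (GM x1 y1 _ _ _); rewrite ?normc_ge0 ?lexx //; exact: Or41.
set N := normc _ in big; have N0 : 0 < N by exact: le_lt_trans big.
pose k : R[i] := (G (xa +i* ya))^* * (N^-1)%:C.
have k1 : normc k = 1.
  by rewrite /k normcM normc_conj normcR ger0_norm ?invr_ge0 ?(ltW N0) // divff // gt_eqF.
have kN : complex.Re (k * G (xa +i* ya)) = N.
  rewrite /k mulrAC [_^* * _]mulrC.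
  have : complex.Re (G (xa +i* ya) * (G (xa +i* ya))^*) = N ^+ 2.
    by rewrite normc_sqr; case: (G _) => u v /=; ring.
  by move=> h; rewrite cReM h /= mulr0 subr0; field; rewrite gt_eqF.
pose L := (x2 - x1) ^+ 2 + (y2 - y1) ^+ 2.
have L0 : 0 <= L by rewrite addr_ge0 ?sqr_ge0.
(* Over the rectangle the quadratic term stays below the gap N - M, so the maximum cannot move to
   the boundary. *)
pose e := (N - M) / (2 * (L + 1)).
have e0 : 0 < e by rewrite divr_gt0 ?subr_gt0 // mulr_gt0 // ltr_wpDl.
have eL : e * L < N - M.
  rewrite /e mulrAC ltr_pdivrMr ?mulr_gt0 ?ltr_wpDl // ltr_pM2l ?subr_gt0 //; lra.
pose v (p : R * R) := complex.Re (k * G (p.1 +i* p.2)) +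
  e * ((p.1 - x1) ^+ 2 + (p.2 - y1) ^+ 2).
have [|||[px py]] := @compact_EVT_max _ _ v (`[x1, x2]%classic `*` `[y1, y2]%classic).
- by exists (x1, y1); split; rewrite /= in_itv /= lexx.
- by apply: compact_setX; exact: segment_compact.
- apply: continuous_in_subspaceT => -[x y]; rewrite inE /= !in_itv /= => -[h1 h2].
  apply: cvgD; last exact: quadratic_continuous.
  by apply: holo2_continuous_Re; exact: Gh.
rewrite inE /= !in_itv /= => -[pxI pyI] vmax.
have {}vmax x y : x1 <= x <= x2 -> y1 <= y <= y2 -> v (x, y) <= v (px, py).
  by move=> h1 h2; apply: vmax; rewrite inE /= !in_itv.
have vN : N <= v (px, py).
  apply: le_trans (vmax _ _ xaI yaI); rewrite /v kN lerDl mulr_ge0 ?(ltW e0) //.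
  by rewrite addr_ge0 ?sqr_ge0.
have inner : ~ [\/ px = x1, px = x2, py = y1 | py = y2].
  move=> /(GM _ _ pxI pyI) pM.
  have : complex.Re (k * G (px +i* py)) <= M.
    by rewrite (le_trans (ler_norm _)) // (le_trans (normc_Re _)) // normcM k1 mul1r.
  have : e * ((px - x1) ^+ 2 + (py - y1) ^+ 2) <= e * L.
    case/andP: pxI => ? ?; case/andP: pyI => ? ?.
    by rewrite ler_wpM2l ?(ltW e0) // /L lerD // lerXn2r ?nnegrE ?subr_ge0 // lerB.
  move: vN; rewrite /v /=; lra.
have xl : x1 < px.
  by case/andP: pxI; rewrite le_eqVlt => /orP[/eqP ?|//]; case: inner; exact: Or41.
have xr : px < x2.
  by case/andP: pxI => _; rewrite le_eqVlt => /orP[/eqP ?|//]; case: inner; exact: Or42.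
have yl : y1 < py.
  by case/andP: pyI; rewrite le_eqVlt => /orP[/eqP ?|//]; case: inner; exact: Or43.
have yr : py < y2.
  by case/andP: pyI => _; rewrite le_eqVlt => /orP[/eqP ?|//]; case: inner; exact: Or44.
have [_ Gc] := Gh _ _ pxI pyI; have [r r0 hr] := Gc _ e0.
pose t := Num.min (r / 2) (Num.min (Num.min (px - x1) (x2 - px)) (Num.min (py - y1) (y2 - py))).
have t0 : 0 < t by rewrite !lt_min !subr_gt0 divr_gt0 // xl xr yl yr.
have : t <= t by [].
rewrite {2}/t !le_min => /and3P[tr /andP[t1 t2] /andP[t3 t4]].
have tr' : 0 < t < r by rewrite t0 (le_lt_trans tr) // ltr_pdivrMr // ltr_pMr // ltr1n.
have {tr'} := hr _ tr'; set C := cross_diff _ _ _ => CE.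
have CRe : - (e * t ^+ 2) <= complex.Re (k * C).
  have : `|complex.Re (k * C)| <= e * t ^+ 2.
    by rewrite (le_trans (normc_Re _)) // normcM k1 mul1r.
  by rewrite ler_norml => /andP[].
have inI (p q1 q2 : R) : q1 < p -> p < q2 -> t <= p - q1 -> t <= q2 - p ->
    q1 <= p + t <= q2 /\ q1 <= p - t <= q2.
  by move: t0; clear => t0 *; split; apply/andP; split; lra.
have [hx1 hx2] := inI _ _ _ xl xr t1 t2; have [hy1 hy2] := inI _ _ _ yl yr t3 t4.
have v1 : v (px + t, py) <= v (px, py) := vmax _ _ hx1 pyI.
have v2 : v (px - t, py) <= v (px, py) := vmax _ _ hx2 pyI.
have v3 : v (px, py + t) <= v (px, py) := vmax _ _ pxI hy1.
have v4 : v (px, py - t) <= v (px, py) := vmax _ _ pxI hy2.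
have CE2 : k * C = k * G ((px + t) +i* py) + k * G ((px - t) +i* py) +
    k * G (px +i* (py + t)) + k * G (px +i* (py - t)) - 4 * (k * G (px +i* py)).
  have -> : (px + t) +i* py = (px +i* py) + t%:C :> R[i] by apply: complex_eq => /=; ring.
  have -> : (px - t) +i* py = (px +i* py) - t%:C :> R[i] by apply: complex_eq => /=; ring.
  have -> : px +i* (py + t) = (px +i* py) + (0 +i* t) :> R[i] by apply: complex_eq => /=; ring.
  have -> : px +i* (py - t) = (px +i* py) - (0 +i* t) :> R[i] by apply: complex_eq => /=; ring.
  by rewrite /C /cross_diff; ring.
have four z : complex.Re (4 * z) = 4 * complex.Re z :> R.
  have -> : 4 = (4%:R)%:C :> R[i] by rewrite rmorph_nat.
  by rewrite cReM /= mul0r subr0.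
move: CRe; rewrite CE2 !(cReD, cReN) four.
move: v1 v2 v3 v4; rewrite /v /=.
have t20 : 0 < e * t ^+ 2 by rewrite mulr_gt0 // exprn_gt0.
rewrite !mulrDr.
have -> : (px + t - x1) ^+ 2 = (px - x1) ^+ 2 + 2 * t * (px - x1) + t ^+ 2 by ring.
have -> : (px - t - x1) ^+ 2 = (px - x1) ^+ 2 - 2 * t * (px - x1) + t ^+ 2 by ring.
have -> : (py + t - y1) ^+ 2 = (py - y1) ^+ 2 + 2 * t * (py - y1) + t ^+ 2 by ring.
have -> : (py - t - y1) ^+ 2 = (py - y1) ^+ 2 - 2 * t * (py - y1) + t ^+ 2 by ring.
rewrite !mulrDr !mulrN; lra.
Qed.

End MaximumPrinciple.
Section IdentityTheorem.
Variable R : realType.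
Implicit Types (F G : R[i] -> R[i]) (x y : R).

(** The extreme value theorem is applied to Re (kG) for k = 1, -1, i, -i. *)
Lemma holo2_rect_bounded G (x1 x2 y1 y2 : R) :
  (forall x y, x1 <= x <= x2 -> y1 <= y <= y2 -> holo2 G (x +i* y)) ->
  exists2 M : R, 0 <= M &
    forall x y, x1 <= x <= x2 -> y1 <= y <= y2 -> normc (G (x +i* y)) <= M.
Proof.
move=> Gh.
have bnd (k : R[i]) : exists2 M : R, 0 <= M & forall x y, x1 <= x <= x2 -> y1 <= y <= y2 ->
    complex.Re (k * G (x +i* y)) <= M.
  have [x12|x12] := leP x1 x2; last first.
    by exists 0 => // x y /andP[h /(le_trans h)]; rewrite leNgt x12.
  have [y12|y12] := leP y1 y2; last first.
    by exists 0 => // x y _ /andP[h /(le_trans h)]; rewrite leNgt y12.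
  have [|||[px py] _ pmax] := @compact_EVT_max _ _
    (fun p : R * R => complex.Re (k * G (p.1 +i* p.2))) (`[x1, x2]%classic `*` `[y1, y2]%classic).
  - by exists (x1, y1); split; rewrite /= in_itv /= lexx.
  - by apply: compact_setX; exact: segment_compact.
  - apply: continuous_in_subspaceT => -[x y]; rewrite inE /= !in_itv /= => -[h1 h2].
    by apply: holo2_continuous_Re; exact: Gh.
  exists `|complex.Re (k * G (px +i* py))| => // x y h1 h2.
  by rewrite (le_trans _ (ler_norm _)) // (pmax (x, y)) // inE /= !in_itv.
have [M1 M10 h1] := bnd 1; have [M2 M20 h2] := bnd (-1).
have [M3 M30 h3] := bnd 'i; have [M4 M40 h4] := bnd (- 'i).
exists (M1 + M2 + (M3 + M4)) => [|x y hx hy]; first by rewrite !addr_ge0.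
have := h1 x y hx hy; have := h2 x y hx hy; have := h3 x y hx hy; have := h4 x y hx hy.
rewrite !mulNr mul1r !cReN cReM /= mul0r mul1r sub0r opprK => q4 q3 q2 q1.
by rewrite (le_trans (normc_le _)) // lerD // ler_norml; apply/andP; split; lra.
Qed.

Lemma holo2_subc F (k : R[i]) z : holo2 F z -> holo2 (fun z => F z - k) z.
Proof.
move=> [[d Fd] Fc]; split.
  exists d => e e0; have [r r0 hr] := Fd _ e0; exists r => // h /hr.
  by have -> : F (z + h) - k - (F z - k) = F (z + h) - F z by ring.
move=> e e0; have [r r0 hr] := Fc _ e0; exists r => // t /hr.
by have -> : cross_diff (fun z => F z - k) z t = cross_diff F z t by rewrite /cross_diff; ring.
Qed.

Lemma cderiv_local0 F z d (r : R) : 0 < r -> (forall h, normc h < r -> F (z + h) = 0) ->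
  cderiv F z d -> d = 0.
Proof.
move=> r0 F0 Fd; apply/eq0_normc/eqP; rewrite eq_le normc_ge0 andbT.
apply/ler_addgt0Pr => e e0; rewrite add0r; have [r' r'0 hr] := Fd _ e0.
pose t := Num.min (r / 2) (r' / 2).
have t0 : 0 < t by rewrite lt_min !divr_gt0.
have tr : t < r by rewrite gt_min ltr_pdivrMr // ltr_pMr // ltr1n.
have tr' : t < r' by rewrite gt_min [X in _ || X]ltr_pdivrMr // ltr_pMr // ltr1n orbT.
have nt : normc (t%:C : R[i]) = t by rewrite normcR gtr0_norm.
have := hr t%:C; rewrite nt => /(_ tr').
have F00 : F z = 0 by rewrite -[z]addr0 F0 ?normc0.
by rewrite F0 ?nt // F00 subrr sub0r normcN normcM nt ler_pM2r.
Qed.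

(* Dividing a primitive [F] vanishing near [c] by [(z - c) ^ n] keeps it holomorphic, so the
   maximum principle on a square around [c] yields [|F z| <= M (|z - c| / rho) ^ n]. *)
Lemma identity_theorem (f : R[i] -> R[i]) (Y eta : R) :
  (forall z, 0 < complex.Im z -> exists d, cderiv f z d) ->
  0 < eta -> (forall h, normc h < eta -> f ((0 +i* Y) + h) = 0) ->
  forall t, 0 < t < Y -> f (0 +i* t) = 0.
Proof.
move=> fD eta0 fz t /andP[t0 tY]; set c := 0 +i* Y in fz.
(* The square of half-side rho about c lies above height t / 2, inside the domain of the primitive,
   and the disc of radius rho contains the disc of radius t / 2 about it. *)
pose rho := Y - t / 2; pose y0 := t / 4; pose x0 := - rho - 1.
have rho0 : 0 < rho by rewrite /rho; lra.
have y00 : 0 < y0 by rewrite /y0; lra.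
(* Cross harmonicity is known for the primitive, not for f itself; the constant makes F vanish near
   c. *)
pose F z := prim f x0 y0 z - prim f x0 y0 c.
have Fh z : x0 < complex.Re z -> y0 < complex.Im z -> holo2 F z.
  move=> h1 h2; apply: holo2_subc; split; last exact: cross_harmonic_prim.
  by exists (f z); exact: cderiv_prim.
pose q := Num.min eta (t / 4).
have q0 : 0 < q by rewrite lt_min eta0 divr_gt0.
have qe : q <= eta by rewrite ge_min lexx.
have qt : q <= t / 4 by rewrite ge_min lexx orbT.
have F0 h : normc h < q -> F (c + h) = 0.
  case: h => hx hy hq.
  have hx1 : `|hx| < q := le_lt_trans (normc_Re (hx +i* hy)) hq.
  have hy1 : `|hy| < q := le_lt_trans (normc_Im (hx +i* hy)) hq.
  move: (hx1) (hy1); rewrite !ltr_norml => /andP[hx2 hx3] /andP[hy2 hy3].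
  have cE : c + (hx +i* hy) = hx +i* (Y + hy) by apply: complex_eq => /=; ring.
  have B1 : normc (prim f x0 y0 (hx +i* (Y + hy)) - prim f x0 y0 (0 +i* (Y + hy)) -
      0 * (hx - 0)%:C) <= 0 * `|hx - 0|.
    apply: prim_hleg => //; rewrite ?/x0 ?/y0; try (rewrite /rho; lra).
    move=> s; rewrite !subr0 => hs.
    have -> : s +i* (Y + hy) = c + (s +i* hy) by apply: complex_eq => /=; ring.
    rewrite fz ?normc0 //; apply: lt_le_trans qe; apply: le_lt_trans hq.
    rewrite /= ler_wsqrtr // lerD2r.
    by rewrite -(real_normK (num_real hx)) -(real_normK (num_real s)) lerXn2r ?nnegrE.
  have B2 : normc (prim f x0 y0 (0 +i* (Y + hy)) - prim f x0 y0 c -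
      0 * (0 +i* (Y + hy - Y))) <= 0 * `|Y + hy - Y|.
    apply: prim_vleg => //; rewrite ?/y0; try lra.
    move=> s; have -> : Y + hy - Y = hy by ring.
    move=> hs; have -> : 0 +i* s = c + (0 +i* (s - Y)) by apply: complex_eq => /=; ring.
    by rewrite subr0 fz ?normc0 // normc_imag (le_lt_trans hs) // (lt_le_trans hy1).
  move: B1 B2; rewrite !mul0r !subr0 => B1 B2.
  have E1 := eq0_normc (le_anti (introT andP (conj B1 (normc_ge0 _)))).
  have E2 := eq0_normc (le_anti (introT andP (conj B2 (normc_ge0 _)))).
  by rewrite /F cE; have := congr2 +%R E1 E2; rewrite addr0 addrA subrK.
have Kx x : - rho <= x <= rho -> x0 < x by move=> /andP[h _]; rewrite /x0; lra.
have Ky y : Y - rho <= y <= Y + rho -> y0 < y.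
  by move=> /andP[h _]; rewrite /y0; move: h; rewrite /rho; lra.
have [M M0 FM] := @holo2_rect_bounded F (- rho) rho (Y - rho) (Y + rho)
  (fun x y hx hy => Fh (x +i* y) (Kx x hx) (Ky y hy)).
pose G n z := F z * (z - c)^-1 ^+ n.
have Gh n x y : - rho <= x <= rho -> Y - rho <= y <= Y + rho -> holo2 (G n) (x +i* y).
  (* At c the convention 0^-1 = 0 is harmless: F, hence the quotient, vanishes on a whole
     neighbourhood. *)
  move=> hx hy; have [->|zc] := eqVneq (x +i* y) c.
    by apply: (holo2_local0 q0) => h /F0; rewrite /G => ->; rewrite mul0r.
  apply: holo2M; first exact: (Fh (x +i* y) (Kx x hx) (Ky y hy)).
  by apply: holo2_exp; exact: holo2_inv.
have Gb n x y : - rho <= x <= rho -> Y - rho <= y <= Y + rho ->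
    [\/ x = - rho, x = rho, y = Y - rho | y = Y + rho] ->
    normc (G n (x +i* y)) <= M * rho^-1 ^+ n.
  move=> hx hy hb; rewrite /G normcM normcX normcV ler_pM ?normc_ge0 ?exprn_ge0 ?invr_ge0 ?normc_ge0 //.
    exact: FM.
  have : rho <= normc ((x +i* y) - c).
    case: hb => e.
    - by apply: le_trans (normc_Re _); rewrite /= e subr0 normrN gtr0_norm.
    - by apply: le_trans (normc_Re _); rewrite /= e subr0 gtr0_norm.
    - apply: le_trans (normc_Im _); rewrite /= e.
      by rewrite (_ : Y - rho - Y = - rho) ?normrN ?gtr0_norm //; ring.
    - apply: le_trans (normc_Im _); rewrite /= e.
      by rewrite (_ : Y + rho - Y = rho) ?gtr0_norm //; ring.
  by move=> h; rewrite lerXn2r ?nnegrE ?invr_ge0 ?normc_ge0 ?(ltW rho0) // lef_pV2 // posrE (lt_le_trans rho0).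
have Fz x y : normc ((x +i* y) - c) < rho -> F (x +i* y) = 0.
  move=> hz; have [->|zc] := eqVneq (x +i* y) c; first by rewrite /F subrr.
  have hx := le_lt_trans (normc_Re _) hz; have hy := le_lt_trans (normc_Im _) hz.
  rewrite /= subr0 in hx; rewrite /= in hy.
  move: hx hy; rewrite !ltr_norml => /andP[hx1 hx2] /andP[hy1 hy2].
  have hx : - rho <= x <= rho by apply/andP; split; lra.
  have hy : Y - rho <= y <= Y + rho by apply/andP; split; lra.
  set p := normc ((x +i* y) - c) in hz.
  have p0 : 0 < p by rewrite normc_gt0 subr_eq0.
  have Fp n : normc (F (x +i* y)) <= M * (p / rho) ^+ n.
    have := maximum_principle (Gh n) (Gb n) hx hy.
    rewrite /G normcM normcX normcV -/p => h.
    rewrite exprMn mulrCA -ler_pdivrMl ?exprn_gt0 // -exprVn mulrC //.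
  apply/eq0_normc/eqP; rewrite eq_le normc_ge0 andbT.
  have Mc : M * (p / rho) ^+ n @[n --> \oo] --> (0 : R).
    rewrite -[X in _ --> X](mulr0 M); apply: cvgMr; apply: cvg_expr.
    by rewrite ger0_norm ?divr_ge0 ?(ltW p0) ?(ltW rho0) // ltr_pdivrMr // mul1r.
  by rewrite -(cvg_lim _ Mc) //; apply: limr_ge; [apply/cvg_ex; exists 0|apply: nearW].
have t2 : y0 < complex.Im (0 +i* t : R[i]) by rewrite /y0 /=; lra.
have t1 : x0 < complex.Re (0 +i* t : R[i]) by rewrite /x0 /=; lra.
(* f is recovered as the derivative of F, which vanishes on a disc about it. *)
apply: (@cderiv_local0 F (0 +i* t) _ (t / 2)); first by rewrite divr_gt0.
  move=> [hx hy] hh.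
  have -> : (0 +i* t) + (hx +i* hy) = hx +i* (t + hy) by apply: complex_eq => /=; ring.
  apply: Fz; have -> : hx +i* (t + hy) - c = (hx +i* hy) + (0 +i* (t - Y)).
    by apply: complex_eq => /=; ring.
  rewrite (le_lt_trans (le_normcD _ _)) // normc_imag ltr0_norm ?subr_lt0 // /rho; lra.
move=> e e0; have [r r0 hr] := cderiv_prim fD y00 t1 t2 e0; exists r => // h /hr.
by have -> : F ((0 +i* t) + h) - F (0 +i* t) =
  prim f x0 y0 ((0 +i* t) + h) - prim f x0 y0 (0 +i* t) by rewrite /F; ring.
Qed.

End IdentityTheorem.

(** * Continuation to the imaginary axis and symmetry *)

Section VoiculescuContinuation.
Variable R : realType.
Variables (a : R) (m : {finite_measure set R -> \bar R}).
Local Notation V0 := (kh_transform a m idfun).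

(* Both functions invert [Ftr nu] near [iT] for [T] large, with values in one cone where
   [Ftr nu] is injective; the identity theorem carries the equality down the imaginary axis. *)
Lemma voiculescu_ext_imag (nu : probability R R) (V : R[i] -> R[i]) :
  voiculescu_on_cone nu V0 -> voiculescu_ext nu V ->
  forall t : R, 0 < t -> V ('i * t%:C) = V0 ('i * t%:C).
Proof.
move=> [ga [de [ga' [de' [/andP[ga0 de0] _ _ hV0]]]]].
move=> [Vd [al [be [al' [be' [/andP[al0 be0] /andP[al'0 be'0] inj hV]]]]]] t t0.
(* Quarters of the apertures put the disc of radius eT about iT in both cones, and z + V0 z in the
   cone where [Ftr nu] is injective. *)
pose e := Num.min 8^-1 (Num.min (al' / 4) (Num.min (al / 4) (ga / 4))).
have e0 : 0 < e by rewrite !lt_min invr_gt0 ltr0n !divr_gt0.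
have : e <= e by []. 
rewrite {2}/e !le_min => /and4P[e1 e2 e3 e4]; clearbody e.
have [Y [Y1 hY]] := kh_transform_small a m e0.
have mid : measurable_fun setT (idfun : R -> R) by exact: measurable_id.
have [hL _] := hY idfun mid (fun x => lexx _).
(* The factor 2 keeps 7/8 T and 47/64 T above all truncation heights; t is included so that it lies
   below iT. *)
pose T := 2 * (be + be' + de + Y + t).
have T0 : 0 < T by rewrite /T; lra.
have eT : 0 < e * T by rewrite mulr_gt0.
have eT8 : e * T <= 8^-1 * T by rewrite ler_wpM2r // ltW.
have eTa' : e * T <= al' / 4 * T by rewrite ler_wpM2r // ltW.
have eTa : e * T <= al / 4 * T by rewrite ler_wpM2r // ltW.
have eTg : e * T <= ga / 4 * T by rewrite ler_wpM2r // ltW.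
have near_iT h : normc h < e * T -> V ((0 +i* T) + h) = V0 ((0 +i* T) + h).
  move=> hh; set z := (0 +i* T) + h.
  have zR : `|complex.Re z| <= e * T.
    by rewrite /z cReD /= add0r (le_trans (normc_Re h)) // ltW.
  have zI : T - e * T <= complex.Im z.
    have := normc_Im h; rewrite ler_norml => /andP[h1 _]; rewrite /z cImD /=; lra.
  have zn : normc z <= T + e * T.
    rewrite (le_trans (le_normcD _ _)) // lerD ?(ltW hh) //.
    by rewrite /= expr0n add0r sqrtr_sqr gtr0_norm.
  have zI' : 7 / 8 * T <= complex.Im z by lra.
  have Tz (c : R) : 0 < c -> e * T <= c / 4 * T -> `|complex.Re z| < c * complex.Im z.
    move=> c0 h1; rewrite (le_lt_trans zR) // (le_lt_trans h1) //.
    rewrite (@lt_le_trans _ _ (c * (7 / 8 * T))) ?ler_wpM2l ?(ltW c0) //.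
    by rewrite -mulrA ltr_pM2l //; lra.
  have z1 : cone al be z by split; [rewrite /T in zI'; lra|exact: Tz].
  have z2 : cone ga de z by split; [rewrite /T in zI'; lra|exact: Tz].
  have z3 : wide_cone Y z.
    by split; [rewrite /T in zI'; lra|rewrite (le_trans zR) //; lra].
  have [c1 F1] := hV _ z1; have [_ F2] := hV0 _ z2.
  apply: (addrI z); apply: inj; rewrite ?F1 ?F2 //.
  have Vn := hL _ z3.
  have eN : e * normc z <= 9 / 8 * (e * T).
    have : e * normc z <= e * (T + e * T) by rewrite ler_wpM2l // ltW.
    have : e * (e * T) <= 8^-1 * (e * T) by rewrite ler_wpM2r // ltW.
    rewrite mulrDr; lra.
  have VR := le_trans (normc_Re _) (le_trans Vn eN).
  have := le_trans (normc_Im _) (le_trans Vn eN); rewrite ler_norml => /andP[VI _].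
  (* Im z >= 7/8 T and |V0 z| <= (9/8) e T <= 9/64 T. *)
  have I1 : 47 / 64 * T <= complex.Im z + complex.Im (V0 z) by lra.
  have Tb : be' < 47 / 64 * T by rewrite /T; lra.
  clearbody z; split; first by rewrite cImD (lt_le_trans Tb).
  rewrite cReD cImD.
  rewrite (le_lt_trans (ler_normD _ _)) // (le_lt_trans (lerD zR VR)) //.
  apply: (@lt_le_trans _ _ (al' * (47 / 64 * T))); last by rewrite ler_wpM2l // ltW.
  have : 0 < al' * T by rewrite mulr_gt0.
  have -> : al' * (47 / 64 * T) = 47 / 64 * (al' * T) by ring.
  have : e * T <= 4^-1 * (al' * T) by rewrite (le_trans eTa') // le_eqVlt; apply/orP; left; apply/eqP; ring.
  lra.
have imE : 'i * t%:C = 0 +i* t :> R[i] by apply: complex_eq => /=; ring.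
rewrite imE; apply/eqP; rewrite -subr_eq0; apply/eqP.
apply: (@identity_theorem R (fun z => V z - V0 z) T (e * T)) => //.
- move=> z z0; have [d1 h1] := (derivable_cderiv V z).1 (Vd z z0).
  have [d2 h2] := @cderiv_kh_transform R a m z z0.
  exists (d1 - d2) => e' e'0; have e20 : 0 < e' / 2 by rewrite divr_gt0.
  have [r1 r10 k1] := h1 _ e20; have [r2 r20 k2] := h2 _ e20.
  exists (Num.min r1 r2) => [|h]; first by rewrite lt_min r10.
  rewrite lt_min => /andP[/k1 q1 /k2 q2].
  have -> : V (z + h) - V0 (z + h) - (V z - V0 z) - (d1 - d2) * h =
    (V (z + h) - V z - d1 * h) - (V0 (z + h) - V0 z - d2 * h) by ring.
  rewrite (le_trans (normcB _ _)) // (le_trans (lerD q1 q2)) //; lra.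
- by move=> h hh; rewrite near_iT // subrr.
- by rewrite t0 /T; lra.
Qed.

End VoiculescuContinuation.

Section Symmetric.
Variable R : realType.
Variable m : {finite_measure set R -> \bar R}.
Hypothesis m_sym : forall A : set R, measurable A -> m ((fun x => - x) @^-1` A) = m A.
Local Notation leb := (@lebesgue_measure R).

Lemma Rintegral_odd (f : R -> R) : m.-integrable setT (EFin \o f) ->
  (forall x, f (- x) = - f x) -> Rintegral m setT f = 0.
Proof.
move=> fi fodd.
have mN : measurable_fun setT (fun x : R => - x) by exact: oppr_measurable.
have E : (\int[m]_x (f x)%:E = \int[m]_x (f (- x))%:E)%E.
  rewrite -[RHS](@integral_pushforward _ _ _ _ R _ mN m setT (EFin \o f)) //.
  - by apply: eq_measure_integral => A mA _; rewrite [RHS]m_sym.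
  - exact: measurable_int fi.
  - have := integrableN fi; apply: eq_integrable => // x _.
    by rewrite /= fodd.
have : Rintegral m setT f = - Rintegral m setT f.
  rewrite {1}/Rintegral E -mulN1r -RintegralZl //.
  by apply: eq_Rintegral => x _; rewrite fodd mulN1r.
lra.
Qed.

Lemma Rintegral_kh_im_sym s : Rintegral m setT (kh_im s) = 0.
Proof.
apply: Rintegral_odd.
  apply: (@integrable_bdd R m _ (3 * (1 + s ^+ 2))); last exact: kh_im_le.
  exact: (measurableT_comp (@measurable_kh_im R) (pair1_measurable (s : measurableTypeR R))).
move=> x; rewrite /kh_im oppr_eq0; case: eqP => _; first by rewrite oppr0.
by rewrite mulrN sinN invrN sqrrN; ring.
Qed.

Lemma kh_transform_sym t : 0 < t -> kh_transform 0 m idfun ('i * t%:C) =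
  - ('i * t%:C) * (Rintegral m setT (fun x => (1 + x ^+ 2) / (t ^+ 2 + x ^+ 2)))%:C.
Proof.
move=> t0; have z0 : 0 < complex.Im ('i * t%:C : R[i]) by rewrite /= mul0r mul1r add0r.
have mid : measurable_fun setT (idfun : R -> R) by exact: measurable_id.
have [ik1 ik2] := @cintegrable_kh_kernel R m _ _ mid z0.
rewrite /kh_transform add0r /cint.
rewrite (Rintegral_odd ik1); last first.
  by move=> x; rewrite !kh_kernel_imag //= sqrrN mulNr mulNr.
have E : Rintegral m setT (fun x => complex.Im (kh_kernel ('i * t%:C) (idfun x))) =
    - t * Rintegral m setT (fun x => (1 + x ^+ 2) / (t ^+ 2 + x ^+ 2)).
  rewrite -RintegralZl //.
    by apply: eq_Rintegral => x _; rewrite kh_kernel_imag //=; ring.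
  have := @integrableZl _ _ _ m setT measurableT (- t^-1) _ ik2.
  apply: eq_integrable => // x _; rewrite /comp kh_kernel_imag // -EFinM; congr EFin => /=.
  by field; rewrite sqrD_neq0 //= gt_eqF.
by rewrite E; apply: complex_eq => /=; ring.
Qed.

Lemma laplace_khlog_sym t : 0 < t -> laplace_khlog 0 m t =
  'i * t%:C * cint leb [set s | 0 <= s]
    (fun s => (Rintegral m setT
       (fun x => if x == 0 then - (s ^+ 2) / 2
                 else (cos (s * x) - 1) * ((1 + x ^+ 2) / x ^+ 2))
         * t * expR (- (s * t)))%:C).
Proof.
move=> t0; rewrite /laplace_khlog.
have kE s : Rintegral m setT
       (fun x => if x == 0 then - (s ^+ 2) / 2
                 else (cos (s * x) - 1) * ((1 + x ^+ 2) / x ^+ 2)) = Rintegral m setT (kh_re s).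
  apply: eq_Rintegral => x _; rewrite /kh_re; case: eqVneq => // x0.
  by congr (_ * _); field.
have [i _] := laplace_fubini m t0 (@measurable_kh_re R) (@kh_re_le R).
rewrite cint_real.
have -> : Rintegral leb [set s | 0 <= s] (fun s => Rintegral m setT
       (fun x => if x == 0 then - (s ^+ 2) / 2
                 else (cos (s * x) - 1) * ((1 + x ^+ 2) / x ^+ 2)) * t * expR (- (s * t))) =
    t * Rintegral leb [set s | 0 <= s] (fun s => Rintegral m setT (kh_re s) * expR (- (t * s))).
  rewrite -RintegralZl //; last by rewrite set_ge0_itv.
  by apply: eq_Rintegral => s _; rewrite kE [s * t]mulrC; ring.
rewrite (_ : cint _ _ _ = (Rintegral leb [set s | 0 <= s]
    (fun s => Rintegral m setT (kh_re s) * expR (- (t * s))))%:C).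
  by rewrite !rmorphM /=; ring.
rewrite -cint_real; apply: eq_cint => s _.
rewrite khlogE Rintegral_kh_im_sym mulr0 addr0.
by apply: complex_eq => /=; ring.
Qed.

End Symmetric.

Theorem theorem1 (R : realType) (mu : probability R R) (a : R)
    (m : {finite_measure set R -> \bar R}) :
  (forall t : R, charfun mu t = cexp (khlog a m t)) ->
  (exists mt : probability R R,
     [/\ free_inf_div mt,
      (exists V, voiculescu_ext mt V /\
         forall t : R, 0 < t -> V ('i * t%:C) = laplace_khlog a m t),
      (forall nu : probability R R, free_inf_div nu ->
         (exists V, voiculescu_ext nu V /\
            forall t : R, 0 < t -> V ('i * t%:C) = laplace_khlog a m t) ->
         forall A : set R, measurable A -> nu A = mt A) &
      (a = 0 ->
       (forall A : set R, measurable A -> m ((fun x => - x) @^-1` A) = m A) ->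
       forall V, voiculescu_ext mt V -> forall t : R, 0 < t ->
         V ('i * t%:C) =
           'i * t%:C *
           cint (@lebesgue_measure R) [set s | 0 <= s]
             (fun s => (Rintegral m setT
                  (fun x => if x == 0 then - (s ^+ 2) / 2
                            else (cos (s * x) - 1) * ((1 + x ^+ 2) / x ^+ 2))
                        * t * expR (- (s * t)))%:C)
         /\ V ('i * t%:C) =
           - ('i * t%:C) *
           (Rintegral m setT (fun x => (1 + x ^+ 2) / (t ^+ 2 + x ^+ 2)))%:C)])
  /\
  (forall t : R, 0 < t ->
     laplace_khlog a m t =
       a%:C + cint m setT (fun x => (1 + 'i * (t * x)%:C) / ('i * t%:C - x%:C))).
Proof.
move=> _; split; last first.
  move=> t t0; rewrite laplace_khlogE // /kh_transform /kh_kernel.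
  by congr (_ + _); apply: eq_cint => x _; rewrite rmorphM mulrA.
have [mt [V0d V0c]] := free_levy_khintchine_voiculescu a m.
exists mt; split.
- exact: free_inf_div_levy_khintchine V0c.
- by exists (kh_transform a m idfun); split => // t t0; rewrite laplace_khlogE.
- move=> nu _ [V [[_ Vc] VE]].
  by apply: (voiculescu_imag_unique Vc V0c) => // t t0; rewrite VE // laplace_khlogE.
(* Every admissible V takes the values of [kh_transform] on the imaginary axis, so both formulas are
   checked for that function only. *)
move=> a0 msym V Vext t t0; rewrite (voiculescu_ext_imag V0c Vext t0) a0; split.
  by rewrite -laplace_khlogE // laplace_khlog_sym.
exact: kh_transform_sym.
Qed.
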